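(* Let $\cong$ be a congruence on LTSs such that $L\doteq L'$ implies $L\cong L'$ and $V\cong B$. Then: (1) if $\cong$ preserves $\mathit{sanF}$ and $\mathit{minD}$ but preserves neither $\mathit{Tr}$ nor $\mathit{anF}$, then $\cong$ is the equivalence induced by $\Sigma,\mathit{sanF},\mathit{minD},\mathit{anI}$; (2) if $\cong$ preserves $\mathit{Tr},\mathit{sanF},\mathit{minD}$ but preserves none of $\mathit{anF},\mathit{Div},\mathit{Inf}$, then $\cong$ is the equivalence induced by $\Sigma,\mathit{Tr},\mathit{sanF},\mathit{minD},\mathit{anI}$; (3) if $\cong$ preserves $\mathit{sanF},\mathit{minD},\mathit{Inf}$ but preserves neither $\mathit{anF}$ nor $\mathit{Div}$, then $\cong$ is the equivalence induced by $\Sigma,\mathit{Tr},\mathit{sanF},\mathit{minD},\mathit{Inf}$; (4) if $\cong$ preserves $\mathit{sanF}$ and $\mathit{Div}$ but preserves none of $\mathit{anF},\mathit{snF},\mathit{aenI}$, then $\cong$ is the equivalence induced by $\Sigma,\mathit{Tr},\mathit{sanF},\mathit{Div},\mathit{eanI}$; (5) if $\cong$ preserves $\mathit{sanF},\mathit{Div},\mathit{aenI}$ but preserves none of $\mathit{anF},\mathit{snF},\mathit{Inf}$, then $\cong$ is the equivalence induced by $\Sigma,\mathit{Tr},\mathit{sanF},\mathit{Div},\mathit{aenI}$; (6) if $\cong$ preserves $\mathit{sanF},\mathit{Div},\mathit{Inf}$ but preserves neither $\mathit{anF}$ nor $\mathit{snF}$, then $\cong$ is the equivalence induced by $\Sig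ma,\mathit{Tr},\mathit{sanF},\mathit{Div},\mathit{Inf}$.
   Context: An LTS is a tuple $L=(S,\Sigma,\Delta,\hat s)$ with states $S$, alphabet $\Sigma$ (possibly infinite), $\tau\notin\Sigma$ a reserved invisible action, transitions $\Delta\subseteq S\times(\Sigma\cup\{\tau\})\times S$, initial state $\hat s$; $\Sigma(L)$ denotes the alphabet. Operators: action prefix $a.L$ ($a\neq\tau$): new initial state $\hat s'$, alphabet $\Sigma\cup\{a\}$, transitions $\Delta\cup\{(\hat s',a,\hat s)\}$. Hiding $L\setminus A$: alphabet $\Sigma\setminus A$, each transition labelled by an element of $A$ relabelled $\tau$, otherwise unchanged. Relational renaming $L\Phi$ ($\Phi$ a set of pairs, $\tau$ not in its domain $\mathcal D(\Phi)$ or range; $\Phi(a,b)$ means $(a,b)\in\Phi$ or $a=b\notin\mathcal D(\Phi)$): alphabet $\{b\mid\exists a\in\Sigma:\Phi(a,b)\}$, transitions $\{(s,b,s')\mid\exists a:(s,a,s')\in\Delta\wedge\Phi(a,b)\}$, same states and initial state. Parallel composition $L_1\|L_2$: states $S_1\times S_2$, alphabet $\Sigma_1\cup\Sigma_2$, initial $(\hat s_1,\hat s_2)$; actions in $\Sigma_1\cap\Sigma_2$ are taken jointly by both components, all other actions (including $\tau$) by one component while the other stays put. A congruence is an equivalence $\cong$ with $L\cong L'\Rightarrow a.L\cong a.L',\ L\setminus A\cong L'\setminus A,\ L\Phi\cong L'\Phi,\ L\|L''\cong L'\|L'',\ L''\|L\cong L''\|L'$. For $\sigma=a_1\cdots a_n\in\Sigma^*$,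 $s\stackrel{\sigma}{\Rightarrow}s'$ means a finite path from $s$ to $s'$ whose non-$\tau$ labels are exactly $a_1,\dots,a_n$ in order; $\hat s\stackrel{\xi}{\Rightarrow}$ for $\xi\in\Sigma^\omega$ means an infinite path from $\hat s$ whose non-$\tau$ label sequence is $\xi$; $s\stackrel{\tau^\omega}{\to}$ means an infinite path of $\tau$-transitions from $s$. Define $\mathit{Tr}(L)=\{\sigma\in\Sigma^*\mid\exists s:\hat s\stackrel\sigma\Rightarrow s\}$, $\mathit{Div}(L)=\{\sigma\in\Sigma^*\mid\exists s:\hat s\stackrel\sigma\Rightarrow s\wedge s\stackrel{\tau^\omega}\to\}$, $\mathit{Inf}(L)=\{\xi\in\Sigma^\omega\mid\hat s\stackrel\xi\Rightarrow\}$, $\mathit{Sf}(L)=\{(\sigma,A)\in\Sigma^*\times2^\Sigma\mid\exists s:\hat s\stackrel\sigma\Rightarrow s\wedge\forall a\in A\cup\{\tau\}\,\forall s':(s,a,s')\notin\Delta\}$. Further: $\mathit{minD}(L)=\{a_1\cdots a_n\in\mathit{Div}(L)\mid\forall i,0\le i<n: a_1\cdots a_i\notin\mathit{Div}(L)\}$; $\mathit{extT}(L)=\{a_1\cdots a_n\in\Sigma(L)^*\mid\exists i,0\le i\le n: a_1\cdots a_i\in\mathit{minD}(L)\}$; $\mathit{extI}(L)=\{a_1a_2\cdots\in\Sigma(L)^\omega\mid\exists i\ge0: a_1\cdots a_i\in\mathit{minD}(L)\}$; $\mathit{anI}(L)=\mathit{Inf}(L)\setminus\mathit{extI}(L)$;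 $\mathit{eanI}(L)=\{a_1a_2\cdots\in\mathit{Inf}(L)\mid\exists n\ge0\,\forall i\ge n: a_1\cdots a_i\notin\mathit{Div}(L)\}$; $\mathit{aenI}(L)=\{a_1a_2\cdots\in\mathit{Inf}(L)\mid\forall n\ge0\,\exists i\ge n: a_1\cdots a_i\notin\mathit{Div}(L)\}$; $\mathit{nF}(L)=\{(\sigma,A)\in\mathit{Sf}(L)\mid\sigma\notin\mathit{Div}(L)\}$; $\mathit{snF}(L)=\{(\sigma,A)\in\mathit{nF}(L)\mid\forall a\in A:\sigma a\notin\mathit{Div}(L)\}$; $\mathit{anF}(L)=\{(\sigma,A)\in\mathit{Sf}(L)\mid\sigma\notin\mathit{extT}(L)\}$; $\mathit{sanF}(L)=\{(\sigma,A)\in\mathit{anF}(L)\mid\forall a\in A:\sigma a\notin\mathit{minD}(L)\}$. $L\doteq L'$ (CFFD-equivalence) iff $\Sigma,\mathit{Sf},\mathit{Div},\mathit{Inf}$ all agree on $L$ and $L'$. An equivalence preserves $X$ if $L\cong L'\Rightarrow X(L)=X(L')$; the equivalence induced by $\Sigma,X_1,\dots,X_k$ relates $L,L'$ iff all these functions agree on them. $V$ is the one-state LTS with empty alphabet and a single $\tau$ self-loop; $B$ is the LTS with empty alphabet, states $s_0$ (initial) and $s_1$, and transitions $(s_0,\tau,s_0)$, $(s_0,\tau,s_1)$. *)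

(* Defs.v *)
From mathcomp Require Import all_boot.
From mathcomp Require Import boolp classical_sets functions cardinality.
From Stdlib Require Import RelationClasses.
From Stdlib Require List.

Set Implicit Arguments.
Unset Strict Implicit.
Unset Printing Implicit Defensive.

Local Open Scope classical_set_scope.

(* Visible actions are taken from a type [Act]; a label is an [option Act],
   where [None] is the invisible action tau.  An alphabet is an arbitrary
   (possibly infinite) subset of [Act]. *)
Record LTS (Act : Type) : Type := MkLTS {
  state : Type;
  alph : set Act;
  trans : state -> option Act -> state -> Prop;
  init : state;
  trans_alph : forall s a s', trans s (Some a) s' -> alph a
}.

Arguments MkLTS {Act} state alph trans init trans_alph.
Arguments state {Act} l.
Arguments alph {Act} l.
Arguments trans {Act} l s l0 s'.
Arguments init {Act} l.

Inductive act_prefix_trans (Act : Type) (a : Act) (L : LTS Act) :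
    option (state L) -> option Act -> option (state L) -> Prop :=
| act_prefix_first : act_prefix_trans a None (Some a) (Some (init L))
| act_prefix_rest s l s' :
    trans L s l s' -> act_prefix_trans a (Some s) l (Some s').

Lemma act_prefix_alph (Act : Type) (a : Act) (L : LTS Act) s b s' :
  @act_prefix_trans Act a L s (Some b) s' -> (alph L `|` [set a]) b.
Proof.
move E : (Some b) => l H; case: H E => [[->]|t l' t' H E]; first by right.
by left; rewrite -E in H; exact: trans_alph H.
Qed.

(* a.L; the new initial state is [None]. *)
Definition lts_prefix (Act : Type) (a : Act) (L : LTS Act) : LTS Act :=
  MkLTS (option (state L)) (alph L `|` [set a]) (@act_prefix_trans Act a L)
        None (@act_prefix_alph Act a L).

Definition hide_trans (Act : Type) (L : LTS Act) (A : set Act)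
    (s : state L) (l : option Act) (s' : state L) : Prop :=
  match l with
  | Some a => trans L s (Some a) s' /\ ~ A a
  | None => trans L s None s' \/ exists2 a, A a & trans L s (Some a) s'
  end.

Lemma hide_alph (Act : Type) (L : LTS Act) (A : set Act) s b s' :
  @hide_trans Act L A s (Some b) s' -> (alph L `\` A) b.
Proof. by case=> H nA; split=> //; exact: trans_alph H. Qed.

Definition lts_hide (Act : Type) (L : LTS Act) (A : set Act) : LTS Act :=
  MkLTS (state L) (alph L `\` A) (@hide_trans Act L A) (init L)
        (@hide_alph Act L A).

Definition ren_dom (Act : Type) (Phi : set (Act * Act)) : set Act :=
  [set a | exists b, Phi (a, b)].

Definition ren_rel (Act : Type) (Phi : set (Act * Act)) (a b : Act) : Prop :=
  Phi (a, b) \/ (a = b /\ ~ ren_dom Phi a).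

Definition rename_trans (Act : Type) (L : LTS Act) (Phi : set (Act * Act))
    (s : state L) (l : option Act) (s' : state L) : Prop :=
  match l with
  | Some b => exists a, trans L s (Some a) s' /\ ren_rel Phi a b
  | None => trans L s None s'
  end.

Lemma rename_alph (Act : Type) (L : LTS Act) (Phi : set (Act * Act)) s b s' :
  @rename_trans Act L Phi s (Some b) s' ->
  [set b | exists a, alph L a /\ ren_rel Phi a b] b.
Proof. by case=> a [H R]; exists a; split=> //; exact: trans_alph H. Qed.

Definition lts_rename (Act : Type) (L : LTS Act) (Phi : set (Act * Act)) :
    LTS Act :=
  MkLTS (state L) [set b | exists a, alph L a /\ ren_rel Phi a b]
        (@rename_trans Act L Phi) (init L) (@rename_alph Act L Phi).

Definition shared (Act : Type) (L1 L2 : LTS Act) (l : option Act) : Prop :=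
  if l is Some a then (alph L1 `&` alph L2) a else False.

Inductive par_trans (Act : Type) (L1 L2 : LTS Act) :
    state L1 * state L2 -> option Act -> state L1 * state L2 -> Prop :=
| par_sync l s1 s1' s2 s2' : shared L1 L2 l ->
    trans L1 s1 l s1' -> trans L2 s2 l s2' ->
    par_trans (s1, s2) l (s1', s2')
| par_left l s1 s1' s2 : ~ shared L1 L2 l ->
    trans L1 s1 l s1' -> par_trans (s1, s2) l (s1', s2)
| par_right l s1 s2 s2' : ~ shared L1 L2 l ->
    trans L2 s2 l s2' -> par_trans (s1, s2) l (s1, s2').

Lemma par_alph (Act : Type) (L1 L2 : LTS Act) s b s' :
  @par_trans Act L1 L2 s (Some b) s' -> (alph L1 `|` alph L2) b.
Proof.
move E : (Some b) => l H.
case: H E => [l' s1 s1' s2 s2' _ H _|l' s1 s1' s2 _ H|l' s1 s2 s2' _ H] E;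
  rewrite -E in H; [left|left|right]; exact: trans_alph H.
Qed.

Definition lts_par (Act : Type) (L1 L2 : LTS Act) : LTS Act :=
  MkLTS (state L1 * state L2)%type (alph L1 `|` alph L2)
        (@par_trans Act L1 L2) (init L1, init L2) (@par_alph Act L1 L2).

Record congruence (Act : Type) (cong : LTS Act -> LTS Act -> Prop) : Prop := {
  cong_equiv : Equivalence cong;
  cong_prefix : forall L L' a,
    cong L L' -> cong (lts_prefix a L) (lts_prefix a L');
  cong_hide : forall L L' A, cong L L' -> cong (lts_hide L A) (lts_hide L' A);
  cong_rename : forall L L' Phi, cong L L' -> cong (lts_rename L Phi) (lts_rename L' Phi);
  cong_par_l : forall L L' L'', cong L L' -> cong (lts_par L L'') (lts_par L' L'');
  cong_par_r : forall L L' L'', cong L L' -> cong (lts_par L'' L) (lts_par L'' L')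
}.

Inductive lpath (Act : Type) (L : LTS Act) :
    state L -> seq (option Act) -> state L -> Prop :=
| lpath_nil s : lpath s [::] s
| lpath_cons s l s' ls s'' :
    trans L s l s' -> lpath s' ls s'' -> lpath s (l :: ls) s''.

Definition ipath (Act : Type) (L : LTS Act)
    (p : nat -> state L) (l : nat -> option Act) : Prop :=
  forall i, trans L (p i) (l i) (p i.+1).

Definition visible (Act : Type) (ls : seq (option Act)) : seq Act := pmap id ls.

Definition weak_path (Act : Type) (L : LTS Act) (s : state L) (sigma : seq Act)
    (s' : state L) : Prop :=
  exists ls, lpath s ls s' /\ visible ls = sigma.

(* The visible labels of the infinite label sequence [l] form exactly the
   infinite word [xi]: every finite prefix of [xi] is the visible part of a
   finite prefix of [l]. *)
Definition ivisible (Act : Type) (l : nat -> option Act) (xi : nat -> Act) :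
    Prop :=
  forall n, exists m, visible (mkseq l m) = mkseq xi n.

Definition diverges (Act : Type) (L : LTS Act) (s : state L) : Prop :=
  exists p : nat -> state L, p 0 = s /\ ipath p (fun=> None).

Definition Tr (Act : Type) (L : LTS Act) : set (seq Act) :=
  [set sigma | exists s, weak_path (init L) sigma s].

Definition Div (Act : Type) (L : LTS Act) : set (seq Act) :=
  [set sigma | exists s, weak_path (init L) sigma s /\ diverges s].

Definition Inf (Act : Type) (L : LTS Act) : set (nat -> Act) :=
  [set xi | exists (p : nat -> state L) (l : nat -> option Act),
    [/\ p 0 = init L, ipath p l & ivisible l xi]].

Definition Sf (Act : Type) (L : LTS Act) : set (seq Act * set Act) :=
  [set x | x.2 `<=` alph L /\
    exists s, [/\ weak_path (init L) x.1 s,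
                  forall s', ~ trans L s None s'
                & forall a, x.2 a -> forall s', ~ trans L s (Some a) s']].

Definition minD (Act : Type) (L : LTS Act) : set (seq Act) :=
  [set sigma | Div L sigma /\
    forall i, i < size sigma -> ~ Div L (take i sigma)].

Definition extT (Act : Type) (L : LTS Act) : set (seq Act) :=
  [set sigma | List.Forall (alph L) sigma /\
    exists i, i <= size sigma /\ minD L (take i sigma)].

Definition extI (Act : Type) (L : LTS Act) : set (nat -> Act) :=
  [set xi | (forall i, alph L (xi i)) /\ exists i, minD L (mkseq xi i)].

Definition anI (Act : Type) (L : LTS Act) : set (nat -> Act) :=
  Inf L `\` extI L.

Definition eanI (Act : Type) (L : LTS Act) : set (nat -> Act) :=
  [set xi | Inf L xi /\ exists n, forall i, n <= i -> ~ Div L (mkseq xi i)].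

Definition aenI (Act : Type) (L : LTS Act) : set (nat -> Act) :=
  [set xi | Inf L xi /\
    forall n, exists i, n <= i /\ ~ Div L (mkseq xi i)].

Definition nF (Act : Type) (L : LTS Act) : set (seq Act * set Act) :=
  [set x | Sf L x /\ ~ Div L x.1].

Definition snF (Act : Type) (L : LTS Act) : set (seq Act * set Act) :=
  [set x | nF L x /\ forall a, x.2 a -> ~ Div L (rcons x.1 a)].

Definition anF (Act : Type) (L : LTS Act) : set (seq Act * set Act) :=
  [set x | Sf L x /\ ~ extT L x.1].

Definition sanF (Act : Type) (L : LTS Act) : set (seq Act * set Act) :=
  [set x | anF L x /\ forall a, x.2 a -> ~ minD L (rcons x.1 a)].

Definition CFFD_equiv (Act : Type) (L L' : LTS Act) : Prop :=
  [/\ alph L = alph L', Sf L = Sf L', Div L = Div L' & Inf L = Inf L'].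

Definition preserves (Act : Type) (cong : LTS Act -> LTS Act -> Prop)
    (T : Type) (X : LTS Act -> T) : Prop :=
  forall L L', cong L L' -> X L = X L'.

Definition ltsV_trans (Act : Type) (s : unit) (l : option Act) (s' : unit) :
    Prop :=
  l = None.

Lemma ltsV_alph (Act : Type) s b s' :
  @ltsV_trans Act s (Some b) s' -> (set0 : set Act) b.
Proof. by []. Qed.

Definition ltsV (Act : Type) : LTS Act :=
  MkLTS unit set0 (@ltsV_trans Act) tt (@ltsV_alph Act).

(* The initial state s0 is [false] and s1 is [true]. *)
Definition ltsB_trans (Act : Type) (s : bool) (l : option Act) (s' : bool) :
    Prop :=
  s = false /\ l = None.

Lemma ltsB_alph (Act : Type) s b s' :
  @ltsB_trans Act s (Some b) s' -> (set0 : set Act) b.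
Proof. by case. Qed.

Definition ltsB (Act : Type) : LTS Act :=
  MkLTS bool set0 (@ltsB_trans Act) false (@ltsB_alph Act).

(* Main.v *)
(* A congruence that fails to preserve a function X relates some M and M' with
   X(M) <> X(M').  Running both in a suitable context yields two related LTSs
   over a single action c that differ in one elementary respect, for instance in
   whether c may diverge.  Running these in turn next to an arbitrary LTS L, in a
   context that starts them only where the defect cannot be noticed, shows that L
   is related to an LTS in which everything that X can see and the remaining
   functions cannot has been added: V ~ B adds all stable failures after
   divergence traces, a lost Tr adds chaos after them, a lost Div adds divergence
   to all later traces, a lost snF or anF adds refusals, and a lost Inf or aenI
   adds infinite traces.  After these additions, two LTSs agreeing on the listed
   functions are CFFD-equivalent. *)

Require Import Defs.
From mathcomp Require Import all_boot.
From mathcomp Require Import boolp classical_sets functions cardinality.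
From mathcomp Require Import zify.

Set Implicit Arguments.
Unset Strict Implicit.
Unset Printing Implicit Defensive.

Local Open Scope classical_set_scope.

(** Two constraints shape the contexts. Alphabets are arbitrary, and [L] may already use every
    action. A context is written as a transducer, and expressing it by the operators takes one
    action for each pair of an input and an output. Such pairs embed into [Act] as soon as the
    inputs or the outputs are countable. This is why a single action [c] stands in the middle:
    probes read an arbitrary alphabet and show [c] or finitely many actions, while extending
    contexts read [c] and show an arbitrary alphabet. A context must also add nothing by itself.
    Hiding can create divergences, so apart from the tau-steps of [L] an extending context makes
    boundedly many silent moves between two visible actions. The LTS run beside [L] might be
    unstable or diverge from the start; it is therefore guarded by a prefix [c], whose initial state
    is stable, except where it is known to converge initially. States of an LTS form an arbitrary
    type and transitions an arbitrary relation, so a context may carry a copy of [L] together with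
    the trace so far and consult facts such as [Div L sigma]. *)

(* By Zorn there is a maximal set of injective sequences with disjoint ranges;
   they miss only finitely many points, so that [T] is a union of sequences. *)
Lemma infinite_mul_nat (T : Type) : infinite_set [set: T] ->
  exists J : T -> nat -> T, forall a m b n, J a m = J b n -> a = b /\ m = n.
Proof.
move=> infT.
pose disj (F : set (nat -> T)) :=
  forall f g m n, F f -> F g -> f m = g n -> f = g /\ m = n.
have [F [disjF maxF]] : exists F, disj F /\ forall G, F `<` G -> ~ disj G.
  apply: Zorn_bigcup => E sE totE f g m n [X EX Xf] [Y EY Yg].
  have [XY|YX] := totE _ _ EX EY.
    by apply: sE EY _ _ _ _ _ Yg; exact: XY.
  by apply: sE EX _ _ _ _ Xf _; exact: YX.
pose C := [set a | forall f n, F f -> f n <> a].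
have finC : finite_set C.
  apply: contrapT => /infiniteP /card_leP[h0].
  have [h injh hC] : exists2 h : nat -> T, injective h & forall n, C (h n).
    exists (fun n => val (h0 (SigSub (mem_set (I : [set: nat] n))))).
      move=> m n /val_inj /(inj (mem_set I) (mem_set I)).
      by move=> /(congr1 val).
    by move=> n; apply: set_mem; exact: valP.
  apply: (maxF (F `|` [set h])).
    split=> [f Ff|sub]; first by left.
    by apply: (hC 0 h 0) => //; apply: sub; right.
  move=> f g m n [Ff|->] [Fg|->] E.
  - exact: disjF.
  - by case: (hC n _ _ Ff E).
  - by case: (hC m _ n Fg).
  - by split=> //; exact: injh.
have [f0 F0] : exists f, F f.
  apply: contrapT => noF; apply: infT.
  by apply: sub_finite_set finC => a _ f n Ff; case: noF; exists f.
have /countable_injP[r rinj] : countable C by exact: finite_set_countable.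
(* Each point gets a number on one of the sequences: even numbers for the points on the sequences,
   odd numbers on [f0] for the finitely many points they miss. Every number then owns infinitely
   many positions, through [pickle]. *)
have [p pP] : {p : T -> (nat -> T) * nat & forall a,
    F (p a).1 /\ ((C a /\ p a = (f0, (r a).*2.+1)) \/
                  exists f n, f n = a /\ p a = (f, n.*2))}.
  apply: (@choice _ _ (fun a (p : (nat -> T) * nat) => F p.1 /\
    ((C a /\ p = (f0, (r a).*2.+1)) \/ exists f n, f n = a /\ p = (f, n.*2)))).
  move=> a; have [Ca|nCa] := pselect (C a).
    by exists (f0, (r a).*2.+1); split=> //; left.
  have [f [n [Ff fn]]] : exists f n, F f /\ f n = a.
    apply: contrapT => H; apply: nCa => f n Ff fn.
    by apply: H; exists f, n.
  by exists (f, n.*2); split=> //; right; exists f, n.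
exists (fun a m => (p a).1 (pickle ((p a).2, m))) => a m b n E.
have [Fa pa] := pP a; have [Fb pb] := pP b.
have [E1 /(pcan_inj pickleK) [E2 ->]] := disjF _ _ _ _ Fa Fb E.
split=> //; case: pa => [[Ca Ea]|[f [i [fi Ea]]]];
  case: pb => [[Cb Eb]|[g [j [gj Eb]]]]; move: E1 E2; rewrite Ea Eb /=.
- move=> _ [/double_inj]; apply: rinj; exact: mem_set.
- by move=> _ /(congr1 odd) /=; rewrite !odd_double.
- by move=> _ /(congr1 odd) /=; rewrite !odd_double.
- by move=> fg /double_inj ij; rewrite -fi -gj fg ij.
Qed.

(** * Executions *)

(** Dependent choice with an invariant; it turns a co-inductive description of a divergence or of an
    infinite trace into an actual path. *)
Lemma coind_seq (T : Type) (Z : T -> Prop) (R : T -> T -> Prop) :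
  (forall x, Z x -> exists y, R x y /\ Z y) ->
  forall x, Z x -> exists p : nat -> T,
    p 0 = x /\ forall i, R (p i) (p i.+1) /\ Z (p i).
Proof.
move=> H x Zx.
have [f fP] : {f : {x | Z x} -> {x | Z x} & forall u, R (sval u) (sval (f u))}.
  apply: (@choice _ _ (fun u w : {x | Z x} => R (sval u) (sval w))).
  by move=> [u Zu]; have [y [Ruy Zy]] := H u Zu; exists (exist _ y Zy).
exists (fun n => sval (iter n f (exist _ x Zx))); split=> // i.
by split; [exact: fP | exact: svalP].
Qed.

(** A discrete intermediate value argument: a counter that grows by at most one per step skips no
    value. *)
Lemma unbounded_attains (v : nat -> nat) (t0 : nat) :
  (forall t, t0 <= t -> v t.+1 = v t \/ v t.+1 = (v t).+1) ->
  (forall n, exists t, t0 <= t /\ n <= v t) ->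
  forall n, v t0 <= n -> exists t, t0 <= t /\ v t = n.
Proof.
move=> S U n len; have [t [t0t nt]] := U n.
have [d td] : exists d, t = t0 + d by exists (t - t0); lia.
subst t; move: nt; elim: d {t0t} => [|d IH] nt.
  by exists t0; split=> //; move: nt; rewrite addn0; lia.
have [le|gt] := leqP n (v (t0 + d)); first exact: IH.
by exists (t0 + d.+1); split; [lia|have := S (t0 + d); rewrite addnS in nt *; lia].
Qed.

(** Sorts the silent paths of a probe: either it consumes its word forever, or from some moment on
    only tau-steps of the driven LTS remain. *)
Lemma unbounded_or_constant (v : nat -> nat) :
  (forall t, v t <= v t.+1) ->
  (forall n, exists t, n <= v t) \/ exists t0, forall t, t0 <= t -> v t = v t0.
Proof.
move=> mono; have [U|/existsNP[n nU]] := pselect (forall n, exists t, n <= v t).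
  by left.
right; have Mono := homo_leq leqnn leq_trans mono.
have B t : v t < n by rewrite ltnNge; apply/negP => le; apply: nU; exists t.
apply: contrapT => H.
have K m : exists t, m <= v t.
  elim: m => [|m [t mt]]; first by exists 0.
  apply: contrapT => H2; apply: H; exists t => u tu.
  apply: contrapT => ne; apply: H2; exists u.
  by have := Mono _ _ tu; lia.
by have [t] := K n; have := B t; lia.
Qed.

Section Basics.
Variable Act : Type.
Implicit Types (L M N : LTS Act) (sigma : seq Act) (xi : nat -> Act).

Definition ext sigma (l : option Act) := if l is Some a then rcons sigma a else sigma.

(** Labels are added at the end, so that invariants relating the trace to the state of a context are
    proved by following a run forwards. *)
Inductive reach L : seq Act -> state L -> Prop :=
| reach_init : reach [::] (init L)
| reach_step sigma s l s' :
    reach sigma s -> trans L s l s' -> reach (ext sigma l) s'.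
Arguments reach : clear implicits.

Lemma reach_tau L sigma s s' : reach L sigma s -> trans L s None s' -> reach L sigma s'.
Proof. exact: (@reach_step L sigma s None s'). Qed.

Lemma reach_vis L sigma s a s' :
  reach L sigma s -> trans L s (Some a) s' -> reach L (rcons sigma a) s'.
Proof. exact: (@reach_step L sigma s (Some a) s'). Qed.

Lemma visible_rcons (ls : seq (option Act)) l :
  visible (rcons ls l) = ext (visible ls) l.
Proof.
by rewrite /visible -cats1 pmap_cat; case: l => [a|] /=; rewrite ?cats1 ?cats0.
Qed.

Lemma lpath_rcons L s ls s' l s'' :
  lpath s ls s' -> trans L s' l s'' -> lpath s (rcons ls l) s''.
Proof.
move=> H T; elim: H T => {s ls s'} [s|s k s' ls s1 T1 _ IH] T.
  by apply: lpath_cons T _; exact: lpath_nil.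
by apply: lpath_cons T1 _; exact: IH.
Qed.

Lemma reachP L sigma s : weak_path (init L) sigma s <-> reach L sigma s.
Proof.
split=> [[ls [H <-]]|].
  suff G s0 : lpath s0 ls s -> forall sg, reach L sg s0 -> reach L (sg ++ visible ls) s.
    by rewrite -[visible ls]cat0s; apply: G H _ _; exact: reach_init.
  elim=> {H ls} {}s0 => [sg|k s' ls s1 T _ IH sg R]; first by rewrite cats0.
  have := IH _ (reach_step R T).
  by case: (k) => [a|] //=; rewrite cat_rcons.
elim=> [|sg s0 l s' _ [ls [H <-]] T]; first by exists [::]; split=> //; exact: lpath_nil.
by exists (rcons ls l); split; [exact: lpath_rcons T|rewrite visible_rcons].
Qed.

Lemma TrP L sigma : Tr L sigma <-> exists s, reach L sigma s.
Proof. by split=> -[s /reachP]; exists s. Qed.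

Lemma DivP L sigma : Div L sigma <-> exists s, reach L sigma s /\ diverges s.
Proof. by split=> -[s [/reachP]]; exists s. Qed.

Definition stable L (s : state L) := forall s', ~ trans L s None s'.
Definition refuses L (s : state L) (A : set Act) :=
  forall a, A a -> forall s', ~ trans L s (Some a) s'.

Lemma SfP L sigma A : Sf L (sigma, A) <->
  A `<=` alph L /\ exists s, [/\ reach L sigma s, stable s & refuses s A].
Proof. by split=> -[HA [s [/reachP R S F]]]; split=> //; exists s. Qed.

Lemma reach_alph L sigma s : reach L sigma s -> List.Forall (alph L) sigma.
Proof.
elim=> [|sg s0 [a|] s' _ IH T] //; rewrite /ext -cats1; apply/List.Forall_app.
by split=> //; constructor=> //; exact: trans_alph T.
Qed.

Lemma reach_prefix L s rho pi : reach L (rho ++ pi) s ->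
  exists s', reach L rho s'.
Proof.
move E : (rho ++ pi) => sg H; elim: H rho pi E => [|{}sg s0 l s' R IH T] rho pi.
  by case: rho => // _; exists (init L); exact: reach_init.
elim/last_ind: pi => [|pi a _]; first by rewrite cats0 => ->; exists s'; exact: reach_step T.
case: l T => [b|] T; last exact: IH.
by rewrite -rcons_cat => /rcons_inj[E _]; exact: IH E.
Qed.

(** Non-divergence as well-foundedness of tau-steps, the form that supports induction and
    lexicographic combinations. *)
Definition conv L (s : state L) := Acc (fun y x => trans L x None y) s.

Lemma diverges_coind L (Z : state L -> Prop) :
  (forall x, Z x -> exists y, trans L x None y /\ Z y) ->
  forall x, Z x -> diverges x.
Proof.
move=> H x Zx; have [p [p0 pP]] := coind_seq H Zx.
by exists p; split=> // i; case: (pP i).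
Qed.

Lemma convP L (s : state L) : conv s <-> ~ diverges s.
Proof.
split.
  elim=> {}s _ IH [p [p0 pP]]; apply: (IH (p 1)); first by rewrite -p0; exact: pP.
  by exists (fun i => p i.+1); split=> // i; exact: pP.
move=> nd; apply: contrapT => nA; apply: nd.
apply: (@diverges_coind L (fun x => ~ conv x)) => // x nx.
apply: contrapT => H; apply: nx; constructor=> y xy.
by apply: contrapT => ny; apply: H; exists y.
Qed.

Lemma conv_stable L sigma s : reach L sigma s -> conv s ->
  exists s', reach L sigma s' /\ stable s'.
Proof.
move=> R C; elim: C R => {}s _ IH R.
have [[s' T]|H] := pselect (exists s', trans L s None s').
  by apply: (IH _ T); exact: reach_tau T.
by exists s; split=> // s' T; apply: H; exists s'.
Qed.

Lemma Div_reach_conv L sigma s : ~ Div L sigma -> reach L sigma s -> conv s.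
Proof. by move=> nD R; apply/convP => D; apply: nD; apply/DivP; exists s. Qed.

(** A convergent state reaches a stable one, which refuses the empty set; so [Div] and [nF]
    determine the traces. *)
Lemma TrE L sigma : Tr L sigma <-> Div L sigma \/ nF L (sigma, set0).
Proof.
split=> [/TrP[s R]|[/DivP[s [R _]]|[/SfP[_ [s [R _ _]]] _]]];
  [|by apply/TrP; exists s|by apply/TrP; exists s].
have [D|nD] := pselect (Div L sigma); first by left.
right; split=> //; apply/SfP; split; first exact: sub0set.
have [s' [R' S]] := conv_stable R (Div_reach_conv nD R).
by exists s'; split=> // a.
Qed.

(* Lexicographic termination: a tau-step decreases [rk] or moves one of two
   terminating components while the other one stays. *)
Lemma conv_lex N (A B : Type) (RA : A -> A -> Prop) (RB : B -> B -> Prop)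
    (Good : state N -> Prop) (rk : state N -> nat)
    (fA : state N -> A) (fB : state N -> B) :
  (forall y, Good y -> Acc RA (fA y) /\ Acc RB (fB y)) ->
  (forall y z, Good y -> trans N y None z -> Good z /\
    (rk z < rk y \/ rk z = rk y /\
      (RA (fA z) (fA y) /\ fB z = fB y \/ fA z = fA y /\ RB (fB z) (fB y)))) ->
  forall y, Good y -> conv y.
Proof.
move=> HA HS.
have G n : forall a, Acc RA a -> forall b, Acc RB b ->
    forall y, Good y -> rk y <= n -> fA y = a -> fB y = b -> conv y.
  elim: n => [|n IHn] a Aa; elim: Aa => {}a _ IHa b Ab; elim: Ab => {}b Ab IHb y gy ry Ea Eb;
    constructor=> z T; have [gz [lt|[E [[R1 E1]|[E1 R1]]]]] := HS _ _ gy T.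
  - lia.
  - subst; apply: (IHa _ R1 (fB z)) gz _ erefl erefl; last by lia.
    by rewrite E1; constructor.
  - by subst; apply: (IHb _ R1 z gz) => //; lia.
  (* When the rank drops, both components may change arbitrarily; [Good] provides their termination
     anew. *)
  - have [A1 B1] := HA _ gz; apply: (IHn (fA z) A1 (fB z) B1 z gz) => //; lia.
  - subst; apply: (IHa _ R1 (fB z)) gz _ erefl erefl; last by lia.
    by rewrite E1; constructor.
  - by subst; apply: (IHb _ R1 z gz) => //; lia.
by move=> y gy; have [A1 B1] := HA _ gy; exact: (G (rk y) _ A1 _ B1).
Qed.

(** The length is recorded because [inf_coind] uses it as a countdown to the next visible action. *)
Inductive tauc L : nat -> state L -> state L -> Prop :=
| tauc0 s : tauc 0 s s
| taucS n s s' s'' : trans L s None s' -> tauc n s' s'' -> tauc n.+1 s s''.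

Definition taus L (s s' : state L) := exists n, tauc n s s'.

Lemma taus_refl L (s : state L) : taus s s.
Proof. by exists 0; constructor. Qed.

Lemma taus_trans L (s s' s'' : state L) : taus s s' -> taus s' s'' -> taus s s''.
Proof.
case=> n; elim=> {n s s'} [s //|n s s1 s' T _ IH H].
by have [m H'] := IH H; exists m.+1; exact: taucS H'.
Qed.

Lemma taus1 L (s s' : state L) : trans L s None s' -> taus s s'.
Proof. by move=> T; exists 1; apply: taucS T _; constructor. Qed.

Definition wstep L (s : state L) a s' := exists s1, taus s s1 /\ trans L s1 (Some a) s'.

Lemma taus_wstep L (s s1 s' : state L) a : taus s s1 -> wstep s1 a s' -> wstep s a s'.
Proof. by move=> H [s2 [H2 T]]; exists s2; split=> //; exact: taus_trans H2. Qed.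

Lemma weak_path_nil L (s s' : state L) : weak_path s [::] s' -> taus s s'.
Proof.
case=> ls [H]; elim: H => {s ls s'} [s _|s [a|] s1 ls s' T _ IH] //=; first exact: taus_refl.
by move=> /IH; apply: taus_trans; exact: taus1.
Qed.

Lemma weak_path_cons L (s s' : state L) a sigma : weak_path s (a :: sigma) s' ->
  exists s1, wstep s a s1 /\ weak_path s1 sigma s'.
Proof.
case=> ls [H]; elim: H => {s ls s'} [s|s [b|] s1 ls s' T P IH] //=.
  case=> <- V; exists s1; split; last by exists ls.
  by exists s; split=> //; exact: taus_refl.
move=> /IH[s2 [W P2]]; exists s2; split=> //; apply: taus_wstep W; exact: taus1.
Qed.

(** A run indexed by time, with [v t] the number of visible actions before time [t]. Compared with
    [ivisible], this is a condition on single steps together with unboundedness of [v]. *)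
Definition irun L xi (p : nat -> state L) (v : nat -> nat) : Prop :=
  [/\ p 0 = init L, v 0 = 0,
      forall t, (v t.+1 = v t /\ trans L (p t) None (p t.+1)) \/
        (v t.+1 = (v t).+1 /\ trans L (p t) (Some (xi (v t))) (p t.+1))
    & forall n, exists t, n <= v t].

Lemma mkseqS (T : Type) (f : nat -> T) n : mkseq f n.+1 = rcons (mkseq f n) (f n).
Proof. by rewrite /mkseq -addn1 iotaD map_cat cats1. Qed.

Lemma InfP L xi : Inf L xi <-> exists p v, irun (L := L) xi p v.
Proof.
split=> [[p [l [p0 pP iv]]]|[p [v [p0 v0 S U]]]].
  pose v t := size (visible (mkseq l t)).
  have pre t d : exists w, visible (mkseq l (t + d)) = visible (mkseq l t) ++ w.
    elim: d => [|d [w E]]; first by exists [::]; rewrite addn0 cats0.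
    rewrite addnS mkseqS visible_rcons E; case: (l _) => [a|] /=; last by exists w.
    by exists (rcons w a); rewrite rcons_cat.
  have E t : visible (mkseq l t) = mkseq xi (v t).
    (* The first [m] labels show as many actions as the first [t], and one of the two label
       sequences extends the other; hence both show the same word. *)
    have [m Em] := iv (v t).
    have sz : size (visible (mkseq l m)) = v t by rewrite Em size_mkseq.
    rewrite -Em; have [tm|mt] := leqP t m.
      have [w Ew] := pre t (m - t); move: sz Ew; rewrite subnKC // => sz Ew.
      move: sz; rewrite Ew size_cat /v => sz; have /size0nil -> : size w = 0 by lia.
      by rewrite cats0.
    have [w Ew] := pre m (t - m); move: Ew; rewrite subnKC 1?ltnW // => Ew.
    move: sz; rewrite /v Ew size_cat => sz; have /size0nil -> : size w = 0 by lia.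
    by rewrite cats0.
  exists p, v; split=> // [t|n].
    have := E t.+1; rewrite /v mkseqS visible_rcons; have := pP t.
    case: (l t) => [a|] T /=; last by move=> _; left.
    rewrite size_rcons mkseqS -E => /rcons_inj[Ea]; right; split=> //.
    by rewrite -/(v t) -Ea.
  by have [m Em] := iv n; exists m; rewrite /v Em size_mkseq.
pose l t := if v t.+1 == v t then None else Some (xi (v t)).
exists p, l; split=> // [t|n].
  by rewrite /l; case: (S t) => [[-> T]|[-> T]]; rewrite ?eqxx // ifF //; apply/eqP; lia.
have E t : visible (mkseq l t) = mkseq xi (v t).
  elim: t => [|t IH]; first by rewrite v0.
  rewrite mkseqS visible_rcons IH /l; case: (S t) => [[-> _]|[-> _]]; first by rewrite eqxx.
  by rewrite ifF ?mkseqS //; apply/eqP; lia.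
have [|||t [_ <-]] := @unbounded_attains v 0 _ _ n; last by exists t.
- by move=> t _; have := S t; lia.
- by move=> m; have [t] := U m; exists t.
- by rewrite v0.
Qed.

Lemma irun_reach L xi p v : irun (L := L) xi p v -> forall t, reach L (mkseq xi (v t)) (p t).
Proof.
case=> p0 v0 S _; elim=> [|t IH]; first by rewrite p0 v0; exact: reach_init.
by case: (S t) => -[-> T]; [exact: reach_tau T|rewrite mkseqS; exact: reach_vis T].
Qed.

Lemma Inf_Tr L xi i : Inf L xi -> Tr L (mkseq xi i).
Proof.
move=> /InfP[p [v R]]; have [p0 v0 S U] := R.
have [|||t [_ <-]] := @unbounded_attains v 0 _ _ i.
- by move=> t _; have := S t; lia.
- by move=> m; have [t] := U m; exists t.
- by rewrite v0.
- by apply/TrP; exists (p t); exact: irun_reach.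
Qed.

Lemma irun_mono L xi p v : irun (L := L) xi p v -> forall a b, a <= b -> v a <= v b.
Proof.
case=> _ _ S _ a b; apply: (homo_leq leqnn leq_trans) => t.
by have := S t; lia.
Qed.

Lemma irun_adv L xi p v : irun (L := L) xi p v -> forall t0,
  exists t1, v t1 = (v t0).+1 /\ wstep (p t0) (xi (v t0)) (p t1).
Proof.
move=> R t0; have [_ _ S U] := R; have [t1 lt] := U (v t0).+1.
have tt : t0 < t1 by rewrite ltnNge; apply/negP => /(irun_mono R); lia.
have G d : forall t, v t < v (t + d) ->
    exists t1, v t1 = (v t).+1 /\ wstep (p t) (xi (v t)) (p t1).
  elim: d => [|d IH] u; first by rewrite addn0 ltnn.
  rewrite addnS -addSn => lu; case: (S u) => -[E' T].
    have [|t2 [E2 W]] := IH u.+1; first by rewrite E'.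
    by exists t2; rewrite E2 -E'; split=> //; apply: taus_wstep W; exact: taus1.
  by exists u.+1; split=> //; exists (p u); split=> //; exact: taus_refl.
by apply: (G (t1 - t0)); rewrite subnKC // ltnW.
Qed.

Lemma inf_coind L xi (Z : nat -> state L -> Prop) :
  Z 0 (init L) ->
  (forall n x, Z n x -> exists y, wstep x (xi n) y /\ Z n.+1 y) ->
  Inf L xi.
Proof.
move=> Z0 ZS; apply/InfP.
(* In a triple [(n, m, x)], [n] actions have been performed and [m] tau-steps remain before the next
   one. [R] lowers [m], or performs the action when [m] is 0; this refines weak steps to single
   transitions. *)
pose W (u : nat * nat * state L) := exists x1 y,
  [/\ tauc u.1.2 u.2 x1, trans L x1 (Some (xi u.1.1)) y & Z u.1.1.+1 y].
pose R (u u' : nat * nat * state L) :=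
  [/\ u'.1.1 = u.1.1, u.1.2 = u'.1.2.+1 & trans L u.2 None u'.2] \/
  [/\ u.1.2 = 0, u'.1.1 = u.1.1.+1 & trans L u.2 (Some (xi u.1.1)) u'.2].
have start n x : Z n x -> exists m, W (n, m, x).
  by move=> /ZS[y [[x1 [[m T] T1]] Zy]]; exists m, x1, y.
have [m0 W0] := start _ _ Z0.
have WS u : W u -> exists u', R u u' /\ W u'.
  case: u => [[n [|m]] x] [x1 [y [/= T T1 Zy]]].
    inversion T; subst; have [m Wm] := start _ _ Zy.
    by exists (n.+1, m, y); split=> //; right.
  inversion T; subst; exists (n, m, s'); split; last by exists x1, y.
  by left.
have [q [q0 qP]] := coind_seq WS W0.
exists (fun t => (q t).2), (fun t => (q t).1.1); split; rewrite ?q0 //.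
  move=> t; case: (qP t) => [[[E _ T]|[_ E T]] _]; [left|right]; by rewrite E.
have next m : forall t, (q t).1.2 = m -> exists t', (q t').1.1 = (q t).1.1.+1.
  elim: m => [|m IH] t Em; case: (qP t) => [[[E1 E2 _]|[E1 E2 _]] _]; try lia.
  - by exists t.+1.
  - by have [|t' E] := IH t.+1; [lia|exists t'; lia].
elim=> [|n [t nt]]; first by exists 0.
by have [t' E] := next _ t erefl; exists t'; lia.
Qed.

Lemma inf_coind_at L xi (Z : nat -> state L -> Prop) n x :
  reach L (mkseq xi n) x -> Z n x ->
  (forall n x, Z n x -> exists y, wstep x (xi n) y /\ Z n.+1 y) ->
  Inf L xi.
Proof.
move=> /reachP P Zx ZS.
(* Before position [n] the invariant only says that the rest of the finite path to [x] lies
   ahead. *)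
apply: (@inf_coind L xi (fun m y =>
  (m <= n /\ weak_path y (drop m (mkseq xi n)) x) \/ (n <= m /\ Z m y))).
  by left; rewrite drop0.
move=> m y [[mn W]|[nm Zy]]; last first.
  by have [z [Wz Zz]] := ZS _ _ Zy; exists z; split=> //; right; split=> //; lia.
move: mn; rewrite leq_eqVlt => /orP[/eqP E|lt].
  subst m; move: W; rewrite drop_oversize ?size_mkseq // => /weak_path_nil T.
  have [z [Wz Zz]] := ZS _ _ Zx; exists z; split; first exact: taus_wstep T Wz.
  by right.
move: W; rewrite (drop_nth (xi 0)) ?size_mkseq // nth_mkseq // => /weak_path_cons[z [Wz Pz]].
by exists z; split=> //; left.
Qed.

(** Carries a run from one LTS to another. The image may stutter, so steps that the target does not
    take part in are allowed as long as [k] is unbounded. *)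
Lemma inf_map L zeta (f : nat -> state L) (k : nat -> nat) t0 :
  reach L (mkseq zeta (k t0)) (f t0) ->
  (forall t, t0 <= t ->
    (k t.+1 = k t /\ taus (f t) (f t.+1)) \/
    (k t.+1 = (k t).+1 /\ trans L (f t) (Some (zeta (k t))) (f t.+1))) ->
  (forall n, exists t, t0 <= t /\ n <= k t) -> Inf L zeta.
Proof.
move=> R S U.
apply: (@inf_coind_at L zeta (fun n x => exists t, [/\ t0 <= t, k t = n & x = f t])
  (k t0) (f t0)) => //; first by exists t0.
move=> n _ [t [tt <- ->]].
have [t1 [t01 lt]] := U (k t).+1.
have mono a b : t0 <= a -> a <= b -> k a <= k b.
  move=> ta ab; rewrite -(subnKC ab); elim: (b - a) => [|d IH]; first by rewrite addn0.
  by rewrite addnS; case: (S (a + d)) => [|[-> _]|[-> _]] //; lia.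
have tt1 : t < t1.
  by rewrite ltnNge; apply/negP => le; have := mono _ _ t01 le; lia.
have G d : forall t, t0 <= t -> k t < k (t + d) ->
    exists y, wstep (f t) (zeta (k t)) y /\ exists t2, [/\ t0 <= t2, k t2 = (k t).+1 & y = f t2].
  elim: d => [|d IH] u tu lu; first by rewrite addn0 ltnn in lu.
  case: (S u tu) => [[E T]|[E T]].
    have [||y [Wy [t2 [tt2 k2 y2]]]] := IH u.+1; [lia|by rewrite E addSn -addnS|].
    exists y; split; first by rewrite -E; exact: taus_wstep T Wy.
    by exists t2; split=> //; rewrite k2 E.
  exists (f u.+1); split; last by exists u.+1; split=> //; lia.
  by exists (f u); split=> //; exact: taus_refl.
by apply: (G (t1 - t)) => //; rewrite subnKC // ltnW.
Qed.

End Basics.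

Arguments reach {Act} L _ _.

(** * Transducers as contexts *)

(** The states of a transducer and of its composite coincide literally, so extensionality and proof
    irrelevance give an equality, along which [cong] can be rewritten. *)
Lemma eq_LTS (Act : Type) (S : Type) (A A' : set Act)
    (t t' : S -> option Act -> S -> Prop) (i : S) p p' :
  A = A' -> (forall s l s', t s l s' <-> t' s l s') ->
  MkLTS S A t i p = MkLTS S A' t' i p'.
Proof.
move=> EA Et; subst A'.
have E : t = t' by apply/funext => s; apply/funext => l; apply/funext => s'; apply/propext.
by subst t'; congr MkLTS; exact: Prop_irrelevance.
Qed.

(* A transducer over states [Q]: in a step [step q i o q'] it lets the driven
   LTS perform [i] (or idle if [i = None]) and shows [o] to the outside. *)
Section Transducer.
Variables (Act : Type) (O : set Act) (Q : Type) (q0 : Q).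
Variable step : Q -> option Act -> option Act -> Q -> Prop.
Implicit Types M : LTS Act.

Definition trd_trans M (x : state M * Q) (l : option Act) (y : state M * Q) :=
  (if l is Some b then O b else True) /\
  [\/ [/\ l = None, y.2 = x.2 & trans M x.1 None y.1],
      exists2 a, trans M x.1 (Some a) y.1 & step x.2 (Some a) l y.2
    | y.1 = x.1 /\ step x.2 None l y.2].

Lemma trd_alph M s b s' : @trd_trans M s (Some b) s' -> O b.
Proof. by case. Qed.

Definition trd M : LTS Act :=
  MkLTS (state M * Q)%type O (@trd_trans M) (init M, q0) (@trd_alph M).

Lemma trd_tau M s q s' : trans M s None s' -> trans (trd M) (s, q) None (s', q).
Proof. by move=> T; split=> //; constructor 1. Qed.

Lemma trd_free M s q l q' : (if l is Some b then O b else True) ->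
  step q None l q' -> trans (trd M) (s, q) l (s, q').
Proof. by move=> Ol T; split=> //; constructor 3. Qed.

Lemma trd_sync M s q a l s' q' : (if l is Some b then O b else True) ->
  trans M s (Some a) s' -> step q (Some a) l q' -> trans (trd M) (s, q) l (s', q').
Proof. by move=> Ol T T'; split=> //; constructor 2; exists a. Qed.

Lemma trd_inv M (Inv : seq Act -> state M -> Q -> Prop) :
  Inv [::] (init M) q0 ->
  (forall o s q s', Inv o s q -> trans M s None s' -> Inv o s' q) ->
  (forall o s q a l s' q', Inv o s q -> trans M s (Some a) s' ->
     step q (Some a) l q' -> Inv (ext o l) s' q') ->
  (forall o s q l q', Inv o s q -> step q None l q' -> Inv (ext o l) s q') ->
  forall o s q, reach (trd M) o (s, q) -> Inv o s q.
Proof.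
move=> I0 It Is If o s q; move E : (s, q) => x R.
elim: R s q E => [|o0 [s0 r0] l [s1 r1] _ IH [_ T]] s q [-> ->] //.
have {}IH := IH _ _ erefl; case: T => /= [[-> -> T]|[a T T']|[-> T]].
- exact: It T.
- exact: Is T T'.
- exact: If T.
Qed.

End Transducer.

Section Trd_congruence.
Variables (Act : Type) (Act_infinite : infinite_set [set: Act]).
Variables (cong : LTS Act -> LTS Act -> Prop) (congC : congruence cong).
Variables (O : set Act) (Q : Type) (q0 : Q).
Variable step : Q -> option Act -> option Act -> Q -> Prop.

Let inopt (A : set Act) (i : option Act) := if i is Some a then A a else True.

Lemma countable_option (A : set Act) : countable A ->
  exists k : option Act -> nat, forall i j, inopt A i -> inopt A j -> k i = k j -> i = j.
Proof.
move=> /countable_injP[f fi]; exists (fun i => if i is Some a then (f a).+1 else 0).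
by move=> [a|] [b|] //= Aa Ab [/fi ->] //; exact: mem_set.
Qed.

(** The side that may be uncountable selects a sequence [J a], the countable side a position in it.
    The map [u] first absorbs [None] into [Act], by means of [J a0 1], which is no [J a 0]. *)
Lemma io_code (A : set Act) : countable A \/ countable O ->
  exists e : option Act -> option Act -> Act, forall i o i' o',
    inopt A i -> inopt O o -> inopt A i' -> inopt O o' ->
    e i o = e i' o' -> i = i' /\ o = o'.
Proof.
have [J JP] := infinite_mul_nat Act_infinite.
have [a0 _] := infinite_setN0 Act_infinite.
pose u (i : option Act) := if i is Some a then J a 0 else J a0 1.
have ui i j : u i = u j -> i = j.
  by case: i j => [a|] [b|] //= /JP[E E2]; rewrite ?E.
case=> /countable_option[k kP].
  by exists (fun i o => J (u o) (k i)) => i o i' o' Ai Oo Ai' Oo' /JP[/ui-> /kP->].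
by exists (fun i o => J (u i) (k o)) => i o i' o' Ai Oo Ai' Oo' /JP[/ui-> /kP->].
Qed.

(* One visible action codes each pair of an input and an output, so that [trd]
   is literally a composite of renaming, parallel composition and hiding. *)
Section Composite.
Variables (A : set Act) (e : option Act -> option Act -> Act).
Hypothesis eP : forall i o i' o', inopt A i -> inopt O o -> inopt A i' ->
  inopt O o' -> e i o = e i' o' -> i = i' /\ o = o'.

(** Relational renaming offers an input under all outputs at once; synchronising with [code_lts]
    then selects the output. *)
Definition code_in : set (Act * Act) :=
  [set x | exists o, [/\ A x.1, inopt O o & x.2 = e (Some x.1) o]].

Definition code_out : set (Act * Act) :=
  [set x | exists i, [/\ inopt A i, O x.2 & x.1 = e i (Some x.2)]].

Definition code_hidden : set Act := [set z | exists2 i, inopt A i & z = e i None].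

Definition code_trans (q : Q) (l : option Act) (q' : Q) :=
  if l is Some z then exists i o, [/\ inopt A i, inopt O o, z = e i o & step q i o q']
  else False.

Definition codes : set Act := [set z | exists i o, [/\ inopt A i, inopt O o & z = e i o]].

Lemma code_trans_alph s b s' : code_trans s (Some b) s' -> codes b.
Proof. by case=> i [o [Ai Oo E _]]; exists i, o. Qed.

Definition code_lts : LTS Act := MkLTS Q codes code_trans q0 code_trans_alph.

Definition composite M :=
  lts_rename (lts_hide (lts_par (lts_rename M code_in) code_lts) code_hidden) code_out.

Lemma ren_in (a z : Act) : A a ->
  ren_rel code_in a z <-> exists2 o, inopt O o & z = e (Some a) o.
Proof.
move=> Aa; split=> [[[o [_ Oo /= E]]|[_ []]]|[o Oo ->]].
- by exists o.
- by exists (e (Some a) None), None.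
- by left; exists o.
Qed.

(** Codes with output [None] lie outside the domain of [code_out] and keep their names; in
    [composite] they have been hidden before the renaming. *)
Lemma ren_out i o b : inopt A i -> inopt O o ->
  ren_rel code_out (e i o) b <-> o = Some b \/ o = None /\ b = e i None.
Proof.
move=> Ai Oo; split.
  case=> [[i' [/= Ai' Ob /eP[] //]]|[<- nd]]; first by move=> _ ->; left.
  case: o Oo nd => [c|] Oo nd; last by right.
  by case: nd; exists c, i.
case=> [E|[E ->]]; subst o; first by left; exists i.
by right; split=> // -[c [i' [/= Ai' Oc /eP[]]]].
Qed.

(** The renamed [M] only has codes with an input. Codes without one belong to the controller alone
    and are its independent moves. *)
Lemma shared_code M i o : alph M = A -> inopt A i -> inopt O o ->
  shared (lts_rename M code_in) code_lts (Some (e i o)) <-> i <> None.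
Proof.
move=> AM Ai Oo; rewrite /shared /=; split=> [[[a [Aa R]] _]|ne].
  rewrite AM in Aa; case: (proj1 (ren_in _ Aa) R) => o' Oo' E.
  by case: (eP Ai Oo (i' := Some a) Aa Oo' E) => ->.
case: i ne Ai => // a _ Aa; split; last by exists (Some a), o.
by exists a; split; rewrite ?AM //; apply/ren_in => //; exists o.
Qed.

Lemma compositeE M : alph M = A -> trd O q0 step M = composite M.
Proof.
move=> AM; apply: eq_LTS => [|[s q] l [s' q']].
  apply/predeqP => b; split=> [Ob|].
    exists (e None (Some b)); split; last by apply/ren_out => //; left.
    split; first by right; exists None, (Some b).
    by case=> i Ai /eP[].
  case=> z [[H nh] R].
  have [i [o [Ai Oo E]]] : codes z.
    case: H => // -[a [Aa R']]; rewrite AM in Aa; case: (proj1 (ren_in _ Aa) R') => o Oo ->.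
    by exists (Some a), o.
  subst z; case: (proj1 (ren_out _ Ai Oo) R) => [E|[E _]]; subst o => //.
  by case: nh; exists i.
have inA x a y : trans M x (Some a) y -> A a by rewrite -AM; exact: trans_alph.
split.
  case=> Ol [[/= El Eq T]|/= [a T St]|/= [Es St]].
  - by subst l q'; left; apply: par_left.
  - have Aa := inA _ _ _ T.
    have PT : @par_trans _ (lts_rename M code_in) code_lts (s, q) (Some (e (Some a) l)) (s', q').
      apply: par_sync; first by apply/shared_code.
        by exists a; split=> //; apply/ren_in => //; exists l.
      by exists (Some a), l.
    case: l Ol St PT => [b|] Ol St PT; last first.
      by right; exists (e (Some a) None) => //; exists (Some a).
    exists (e (Some a) (Some b)); split; last by apply/ren_out => //; left.
    by split=> //; case=> i Ai /eP[].
  - subst s'.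
    have PT : @par_trans _ (lts_rename M code_in) code_lts (s, q) (Some (e None l)) (s, q').
      by apply: par_right; [move/shared_code; apply|exists None, l].
    case: l Ol St PT => [b|] Ol St PT; last by right; exists (e None None) => //; exists None.
    exists (e None (Some b)); split; last by apply/ren_out => //; left.
    by split=> //; case=> i Ai /eP[].
have K z : @par_trans _ (lts_rename M code_in) code_lts (s, q) (Some z) (s', q') ->
    exists i o, [/\ inopt A i, inopt O o, z = e i o &
    (if i is Some a then trans M s (Some a) s' else s' = s) /\ step q i o q'].
  move=> PT; inversion PT as
    [l' s1 s1' s2 s2' Sh T1 T2|l' s1 s1' s2 Sh T1|l' s1 s2 s2' Sh T2]; subst.
  - case: T1 => a [T R1]; case: (proj1 (ren_in _ (inA _ _ _ T)) R1) => o Oo Ez.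
    case: T2 => i [o' [Ai Oo' Ez' St]]; rewrite Ez in Ez'.
    have Aa := inA _ _ _ T; have [Ei Eo] := eP (i := Some a) Aa Oo Ai Oo' Ez'; subst.
    by exists (Some a), o'.
  - case: T1 => a [T R1]; case: (proj1 (ren_in _ (inA _ _ _ T)) R1) => o Oo Ez; case: Sh.
    by rewrite Ez; apply/shared_code => //; exact: inA T.
  - case: T2 => i [o [Ai Oo Ez St]]; exists i, o; split=> //; split=> //.
    case: i Ai Ez {St} => // a Aa Ez; case: Sh; rewrite Ez; exact/shared_code.
case: l => [b|].
  case=> z [[/K[i [o [Ai Oo Ez [T St]]]] nh] R]; subst z.
  case: (proj1 (ren_out _ Ai Oo) R) => [Eo|[Eo _]]; subst o; last by case: nh; exists i.
  split=> //; clear R nh; case: i Ai T St => [a|] Ai T St; last by constructor 3.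
  by constructor 2; exists a.
case=> [PT|[z [i Ai ->]]].
  split=> //; constructor 1.
  by inversion PT; subst.
move=> /K[i' [o [Ai' Oo /eP[] // <- <- [T St]]]].
by split=> //; case: i Ai T St {Ai'} => [a|] Ai T St; [constructor 2; exists a|constructor 3].
Qed.

End Composite.

Lemma trd_cong M M' : cong M M' -> alph M = alph M' ->
  countable (alph M) \/ countable O ->
  cong (trd O q0 step M) (trd O q0 step M').
Proof.
move=> C EA cnt; have [e eP] := io_code cnt.
rewrite (compositeE eP erefl) (compositeE eP (esym EA)).
apply: (cong_rename congC); apply: (cong_hide congC); apply: (cong_par_l congC).
exact: (cong_rename congC).
Qed.

End Trd_congruence.

Section Congruence_equivalence.
Variables (Act : Type) (cong : LTS Act -> LTS Act -> Prop) (congC : congruence cong).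

Lemma congr_sym L L' : cong L L' -> cong L' L.
Proof. by case: congC => -[_ S _] *; exact: S. Qed.

Lemma congr_trans L L' L'' : cong L L' -> cong L' L'' -> cong L L''.
Proof. by case: congC => -[_ _ T] _ _ _ _ _; exact: T. Qed.

End Congruence_equivalence.

Section Walk.
Variables (Act : Type) (O : set Act) (M : LTS Act).
Variables (Q : Type) (q0 : Q) (step : Q -> option Act -> option Act -> Q -> Prop).

Lemma trd_conv_idle s q : (forall i q', ~ step q i None q') -> conv (L := M) s ->
  conv (L := trd O q0 step M) (s, q).
Proof.
move=> ns; elim=> {}s _ IH; constructor=> -[s' q'] [_ /= [[_ -> T]|[a _ /ns []]|[_ /ns []]]].
exact: IH.
Qed.

End Walk.

(** The action at position [i] of [sigma] is [a], said by means of prefixes so that it rewrites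
    directly in statements about [reach]. *)
Definition walk (Act : Type) (sigma : seq Act) (i : nat) (a : Act) :=
  take i.+1 sigma = rcons (take i sigma) a.

Lemma walk_lt (Act : Type) (sigma : seq Act) i a : walk sigma i a -> i < size sigma.
Proof.
move=> /(congr1 size); rewrite size_rcons !size_take.
by case: ltnP; case: ltnP; lia.
Qed.

Lemma trd_walk (Act : Type) O (M : LTS Act) step (sigma : seq Act) s :
  (forall i a, walk sigma i a -> step i (Some a) None i.+1) ->
  reach M sigma s -> reach (trd O 0 step M) [::] (s, size sigma).
Proof.
move=> H R.
suff G rho : reach M rho s -> forall pi, sigma = rho ++ pi ->
    reach (trd O 0 step M) [::] (s, size rho).
  by apply: (G sigma R [::]); rewrite cats0.
elim=> [_ _|{R}rho s0 l {}s R IH T pi]; first exact: reach_init.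
case: l T => [a|] T /=; last by move=> /IH R'; apply: reach_tau R' _; exact: trd_tau.
rewrite cat_rcons => E; apply: reach_tau (IH _ E) _.
rewrite size_rcons; apply: trd_sync T _ => //; apply: H.
by rewrite /walk E -[in LHS]cat_rcons !take_size_cat ?size_rcons.
Qed.

Lemma mkseq_const (T : Type) (c : T) n : mkseq (fun=> c) n = nseq n c.
Proof. by elim: n => // n IH; rewrite mkseqS IH; elim: n {IH} => //= n ->. Qed.

(** * Semantics of the action prefix *)

Section Prefix.
Variables (Act : Type) (c : Act) (L : LTS Act).

Lemma reach_lts_prefix w s : reach L w s -> reach (lts_prefix c L) (c :: w) (Some s).
Proof.
elim=> [|{}w s0 l {}s _ IH T].
  have R : reach (lts_prefix c L) [::] None by exact: reach_init.
  by apply: (reach_vis R); constructor.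
have -> : c :: ext w l = ext (c :: w) l by case: (l).
by apply: reach_step IH _; constructor.
Qed.

Lemma lts_prefix_reach w x : reach (lts_prefix c L) w x ->
  if x is Some s then exists2 w', w = c :: w' & reach L w' s else w = [::].
Proof.
elim=> [|{}w x0 l x1 R IH T] //.
case: T IH => [|s l' s' T] /=; first by move=> ->; exists [::] => //; exact: reach_init.
case=> w' -> R'; exists (ext w' l'); last exact: reach_step T.
by case: (l').
Qed.

Lemma diverges_prefix s : diverges (L := lts_prefix c L) (Some s) <-> diverges (L := L) s.
Proof.
split; last first.
  move=> D; apply: (@diverges_coind _ (lts_prefix c L) (fun x : option (state L) =>
    if x is Some y then diverges y else False)) => // -[y|] // [p [<- pP]].
  exists (Some (p 1)); split; first by constructor; exact: pP.
  by exists (fun i => p i.+1); split=> // i; exact: pP.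
move=> D; apply: contrapT => /convP C; move: D; apply/convP.
elim: C => {}s _ IH; constructor=> y T; inversion T; subst; exact: IH.
Qed.

Lemma diverges_prefixN : ~ diverges (L := lts_prefix c L) None.
Proof. by apply/convP; constructor=> y T; inversion T. Qed.

Lemma Div_prefix w : Div (lts_prefix c L) (c :: w) <-> Div L w.
Proof.
split=> /DivP[x [R D]]; apply/DivP.
  move: (lts_prefix_reach R); case: x R D => [s|] R D // [w' [<-] R'].
  by exists s; split=> //; exact/diverges_prefix.
by exists (Some x); split; [exact: reach_lts_prefix|exact/diverges_prefix].
Qed.

Lemma Div_prefix_nil : ~ Div (lts_prefix c L) [::].
Proof.
move=> /DivP[x [R D]]; move: (lts_prefix_reach R).
by case: x R D => [s|] R D; [case|case: diverges_prefixN].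
Qed.

Lemma Sf_prefix w A : Sf L (w, A) -> Sf (lts_prefix c L) (c :: w, A).
Proof.
move=> /SfP[AL [s [R S F]]]; apply/SfP; split; first by move=> a /AL; left.
exists (Some s); split; first exact: reach_lts_prefix.
  by move=> y T; inversion T as [|? ? s' T']; subst; exact: S T'.
by move=> a Aa y T; inversion T as [|? ? s' T']; subst; exact: F T'.
Qed.

Lemma prefix_Sf w A : A `<=` alph L -> Sf (lts_prefix c L) (c :: w, A) -> Sf L (w, A).
Proof.
move=> AL /SfP[_ [x [R S F]]]; apply/SfP; split=> //.
move: (lts_prefix_reach R); case: x R S F => [s|] R S F // [w' [->] R'].
exists s; split=> // [y T|a Aa y T]; first by apply: (S (Some y)); constructor.
by apply: (F a Aa (Some y)); constructor.
Qed.

Lemma Inf_prefix : Inf L (fun=> c) -> Inf (lts_prefix c L) (fun=> c).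
Proof.
move=> /InfP[p [v [p0 v0 S U]]].
have R : reach (lts_prefix c L) (mkseq (fun=> c) (v 0).+1) (Some (p 0)).
  by rewrite v0 p0; apply: reach_lts_prefix; exact: reach_init.
apply: (@inf_map _ (lts_prefix c L) _ (fun t => Some (p t)) (fun t => (v t).+1) 0) => // [t _|n].
  case: (S t) => [[-> T]|[-> T]]; [left|right]; split=> //; last by constructor.
  by apply: taus1; constructor.
by have [t nt] := U n; exists t; split=> //; lia.
Qed.

Lemma prefix_Inf : Inf (lts_prefix c L) (fun=> c) -> Inf L (fun=> c).
Proof.
move=> /InfP[p [v R]]; have [p0 v0 S U] := R; have RR := irun_reach R.
have [t0 vt0] := U 1.
have P t : t0 <= t -> exists2 s, p t = Some s & reach L (mkseq (fun=> c) (v t).-1) s.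
  move=> tt; have := lts_prefix_reach (RR t).
  have v1 : 0 < v t.
    by have := irun_mono R tt; lia.
  case E: (p t) => [s|]; last by case: (v t) v1.
  case: (v t) v1 => // n _ [w' Ew Rw]; exists s => //.
  by move: Ew; rewrite !mkseq_const => -[->].
(* The default never occurs from [t0] on, since the prefixed action has been performed by then. *)
pose f t := odflt (init L) (p t).
apply: (@inf_map _ L _ f (fun t => (v t).-1) t0).
- by have [s E] := P t0 (leqnn _); rewrite /f E.
- move=> t tt; have [s E R1] := P t tt; have [s' E' R2] := P t.+1 (leqW tt).
  have v1 : 0 < v t.
    have := RR t; rewrite E => /lts_prefix_reach[w']; by case: (v t).
  rewrite /f E E' /=; case: (S t) => [[-> T]|[-> T]]; rewrite E E' in T; inversion T; subst.
    by left; split=> //; exact: taus1.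
  by right; split=> //; lia.
- move=> n; have [t nt] := U (n + v t0).+1; exists t; split; last by lia.
  by rewrite leqNgt; apply/negP => /ltnW /(irun_mono R); lia.
Qed.

End Prefix.

(** * Contexts distinguishing two related LTSs *)

Section Probes.
Variables (Act : Type) (Act_infinite : infinite_set [set: Act]).
Variables (cong : LTS Act -> LTS Act -> Prop) (congC : congruence cong).
Variable c : Act.
Implicit Types (M : LTS Act) (sigma : seq Act).

(** Putting [b.M] next to a deadlock with alphabet [b] leaves an LTS that does nothing but keeps the
    alphabet. There, refusing [a] at the start means having [a] in the alphabet; choosing [b]
    different from [a] makes this an action of [M] itself. *)
Lemma alph_preserved : preserves cong (@sanF Act) -> preserves cong (@alph Act).
Proof.
move=> sanFC.
suff G M M' a : cong M M' -> alph M a -> alph M' a.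
  move=> M M' C; apply/predeqP => a; split; apply: G => //.
  exact: congr_sym congC _ _ _.
move=> C aM.
have [b ba] : exists b, b <> a.
  apply: contrapT => H; apply: Act_infinite.
  apply: (@sub_finite_set _ _ [set a]); last exact: finite_set1.
  by move=> b _; apply: contrapT => ne; apply: H; exists b.
pose St : LTS Act := MkLTS unit [set b] (fun _ _ _ => False) tt (fun _ _ _ => @False_ind _).
pose K M := lts_par (lts_prefix b M) St.
have stuck M0 l y : ~ trans (K M0) (init (K M0)) l y.
  move=> T; inversion T as [l' s1 s1' s2 s2' _ _ []|l' s1 s1' s2 Sh T1|l' s1 s2 s2' _ []]; subst.
  inversion T1; subst; apply: Sh; split=> //; by right.
have eps M0 : ~ Div (K M0) [::].
  move=> /DivP[s [R D]]; have Es : s = init (K M0).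
    move: (R) D; move E : [::] => w R' _; elim: R' E => // w' s0 l s' _ IH T E.
    by case: l T E => [e|] T E; [case: (w') E|move: T; rewrite IH //; move/stuck].
  by case: D => p [p0 pP]; apply: (stuck M0 None (p 1)); rewrite -Es -p0; exact: pP.
have nD M0 w : ~ Div (K M0) w.
  move=> /DivP[s [R D]]; have Es : s = init (K M0) /\ w = [::].
    by elim: R => // w' s0 l s' _ [-> ->] /stuck.
  by case: Es => Es Ew; subst; apply: (eps M0); apply/DivP; exists (init (K M0)).
have Keq : sanF (K M) = sanF (K M').
  by apply: sanFC; apply: (cong_par_l congC); exact: (cong_prefix congC).
have : sanF (K M) ([::], [set a]).
  split=> [|e _ [/nD]] //; split.
    apply/SfP; split; first by move=> _ ->; left; left.
    exists (init (K M)); split; first exact: reach_init.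
      by move=> y; exact: stuck.
    by move=> e _ y; exact: stuck.
  by case=> _ [i [_ [/nD]]].
rewrite Keq => -[[/SfP[/(_ a erefl)]]] .
by case=> [[//|E]|E] *; case: ba.
Qed.

Let cong_trd O Q q0 step M M' :=
  @trd_cong Act Act_infinite cong congC O Q q0 step M M'.
Let cnt1 M : countable (alph M) \/ countable [set c].
Proof. by right; exact: countable1. Qed.

(** The final loop can diverge and can also show [c] forever. One lost trace thus yields a trace, a
    divergence and an infinite trace at once; hence preserving [Div] or [Inf] forces preserving
    [Tr]. *)
Inductive tr_probe sigma : nat -> option Act -> option Act -> nat -> Prop :=
| tr_walk i a : walk sigma i a -> tr_probe sigma i (Some a) None i.+1
| tr_c : tr_probe sigma (size sigma) None (Some c) (size sigma).+1
| tr_loop l : l = None \/ l = Some c ->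
    tr_probe sigma (size sigma).+1 None l (size sigma).+1.

Lemma distinguish_Tr M M' sigma : cong M M' -> alph M = alph M' ->
  Tr M sigma -> ~ Tr M' sigma -> exists X X',
  [/\ cong X X', alph X = [set c] /\ alph X' = [set c], Div X [:: c], Inf X (fun=> c)
    & ~ Tr X' [:: c]].
Proof.
move=> C EA /TrP[s R] nT.
pose X := trd [set c] 0 (tr_probe sigma) M.
exists X, (trd [set c] 0 (tr_probe sigma) M').
have R1 : reach X [:: c] (s, (size sigma).+1).
  apply: (@reach_vis _ X [::] (s, size sigma) c).
    by apply: trd_walk R => i a W; constructor.
  by apply: trd_free => //; constructor.
split=> //.
- exact: cong_trd.
- apply/DivP; exists (s, (size sigma).+1); split=> //.
  apply: (@diverges_coind _ X (fun x => x = (s, (size sigma).+1))) => // _ ->.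
  by eexists; split; last reflexivity; apply: trd_free => //; constructor; left.
- apply: (@inf_coind_at _ X _ (fun _ x => x = (s, (size sigma).+1)) 1 _ R1) => //.
  move=> n _ ->; exists (s, (size sigma).+1); split=> //.
  eexists; split; first exact: taus_refl.
  by apply: trd_free => //; constructor; right.
- move=> /TrP[[s' i] R'].
  have G : forall o s0 j, reach (trd [set c] 0 (tr_probe sigma) M') o (s0, j) ->
      (j <= size sigma /\ o = [::] /\ reach M' (take j sigma) s0) \/ Tr M' sigma.
    apply: trd_inv => [|o s0 j s1 [[lj [-> R0]]|//] T|o s0 j a l s1 j' [[lj [-> R0]]|//] T St|
        o s0 j l j' [[lj [-> R0]]|//] St]; try by right.
    + by left; rewrite take0; split=> //; split=> //; exact: reach_init.
    + by left; split=> //; split=> //; exact: reach_tau T.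
    + inversion St as [i' a' W| |]; subst; left; split; first exact: walk_lt W.
      by split=> //; rewrite W; exact: reach_vis T.
    + inversion St; subst; last by rewrite ltnn in lj.
      by right; apply/TrP; exists s0; rewrite take_size in R0.
  by case: (G _ _ _ R') => [[_ []]|].
Qed.

(** The first [c] marks the end of [sigma], so a divergence after it is one of [M] after [sigma].
    Each action of [A] is then shown as a second [c], so that refusing [c] there means refusing [A].
    With [A] empty this is a probe for divergence alone. *)
Inductive refusal_probe sigma (A : set Act) :
    nat -> option Act -> option Act -> nat -> Prop :=
| refusal_walk i a : walk sigma i a -> refusal_probe sigma A i (Some a) None i.+1
| refusal_c : refusal_probe sigma A (size sigma) None (Some c) (size sigma).+1
| refusal_A a : A a ->
    refusal_probe sigma A (size sigma).+1 (Some a) (Some c) (size sigma).+2.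

Section Refusal_probe.
Variables (M : LTS Act) (sigma : seq Act) (A : set Act).
Let X := trd [set c] 0 (refusal_probe sigma A) M.

Lemma refusal_reach s : reach M sigma s -> reach X [:: c] (s, (size sigma).+1).
Proof.
move=> R; apply: (@reach_vis _ X [::] (s, size sigma) c).
  by apply: trd_walk R => i a W; constructor.
by apply: trd_free => //; constructor.
Qed.

Lemma reach_refusal o s i : reach X o (s, i) ->
  [\/ i <= size sigma /\ (o = [::] /\ reach M (take i sigma) s),
      i = (size sigma).+1 /\ (o = [:: c] /\ reach M sigma s)
    | i = (size sigma).+2 /\ (o = [:: c; c] /\ exists2 a, A a & reach M (rcons sigma a) s)].
Proof.
move: o s i; apply: trd_inv => [|o s i s' I T|o s i a l s' i' I T St|o s i l i' I St].
- by constructor 1; rewrite take0; split=> //; split=> //; exact: reach_init.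
- case: I => [[? [? R]]|[? [? R]]|[? [? [a Aa R]]]];
    [constructor 1|constructor 2|constructor 3]; split=> //; split=> //;
    try exact: reach_tau T.
  by exists a => //; exact: reach_tau T.
- case: I => [[le [-> R]]|[Ei [-> R]]|[Ei [-> R]]]; inversion St as [i0 a0 W| |a0 Aa]; subst;
    try by [lia|have := walk_lt W; lia].
    constructor 1; split; first exact: walk_lt W.
    by split=> //; rewrite W; exact: reach_vis T.
  constructor 3; split=> //; split=> //; exists a => //; exact: reach_vis T.
- case: I => [[le [-> R]]|[Ei [-> R]]|[Ei [-> R]]]; inversion St; subst; try lia.
  by constructor 2; rewrite take_size in R.
Qed.

Lemma refusal_idle i j q : size sigma < i -> ~ refusal_probe sigma A i j None q.
Proof. by move=> lt St; inversion St as [i0 a0 W| |]; subst; have := walk_lt W; lia. Qed.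

Lemma refusal_Div : Div X [:: c] <-> Div M sigma.
Proof.
split=> [/DivP[[s i] [R D]]|/DivP[s [R D]]].
  apply: contrapT => nD; move: D; apply/convP.
  case: (reach_refusal R) => [[_ [//]]|[Ei [_ R']]|[_ [//]]].
  apply: trd_conv_idle (Div_reach_conv nD R') => j q.
  by apply: refusal_idle; rewrite Ei.
apply/DivP; exists (s, (size sigma).+1); split; first exact: refusal_reach.
case: D => p [p0 pP]; exists (fun i => (p i, (size sigma).+1)); rewrite p0; split=> // i.
by apply: trd_tau; exact: pP.
Qed.

Lemma refusal_Div2 : Div X [:: c; c] -> exists2 a, A a & Div M (rcons sigma a).
Proof.
move=> /DivP[[s i] [R D]]; case: (reach_refusal R) => [[_ [//]]|[_ [//]]|[Ei [_ [a Aa R']]]].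
exists a => //; apply: contrapT => nD; move: D; apply/convP.
apply: trd_conv_idle (Div_reach_conv nD R') => j q.
by apply: refusal_idle; rewrite Ei; lia.
Qed.

Lemma refusal_Sf : A `<=` alph M -> (Sf X ([:: c], [set c]) <-> Sf M (sigma, A)).
Proof.
move=> AM; split=> /SfP[_ H]; apply/SfP; split=> //; last first.
  case: H => s [R S F]; exists (s, (size sigma).+1); split.
  - exact: refusal_reach.
  - move=> [s' i] [_ /= [[_ _ /S]|[a _ St]|[_ St]]] //; exact: refusal_idle St.
  - move=> _ -> [s' i] [_ /= [[//]|[a T St]|[_ St]]].
      by inversion St; subst; exact: F T.
    by inversion St; subst; lia.
case: H => -[s i] [R S F]; case: (reach_refusal R) => [[_ [//]]|[Ei [_ R']]|[_ [//]]].
exists s; split=> //.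
  by move=> s' T; apply: (S (s', i)); exact: trd_tau.
move=> a Aa s' T; apply: (F c erefl (s', (size sigma).+2)); rewrite Ei.
by apply: trd_sync T _ => //; constructor.
Qed.

End Refusal_probe.

Lemma distinguish_Div M M' sigma : cong M M' -> alph M = alph M' ->
  Div M sigma -> ~ Div M' sigma ->
  exists X X',
  [/\ cong X X', alph X = [set c] /\ alph X' = [set c], Div X [:: c] & ~ Div X' [:: c]].
Proof.
move=> C EA D nD.
exists (trd [set c] 0 (refusal_probe sigma set0) M),
  (trd [set c] 0 (refusal_probe sigma set0) M').
by split=> //; [exact: cong_trd|exact/refusal_Div|move/refusal_Div].
Qed.

(** The condition that separates [snF] from [nF] is what excludes a divergence after the second [c];
    the context that uses this refusal needs convergence after both. *)
Lemma distinguish_refusal M M' sigma A : cong M M' -> alph M = alph M' ->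
  Sf M (sigma, A) -> ~ Sf M' (sigma, A) -> ~ Div M sigma -> ~ Div M' sigma ->
  (forall a, A a -> ~ Div M (rcons sigma a)) ->
  (forall a, A a -> ~ Div M' (rcons sigma a)) -> exists X X',
  [/\ cong X X', alph X = [set c] /\ alph X' = [set c],
      Sf X ([:: c], [set c]) /\ ~ Sf X' ([:: c], [set c]),
      ~ Div X [:: c] /\ ~ Div X' [:: c]
    & ~ Div X [:: c; c] /\ ~ Div X' [:: c; c]].
Proof.
move=> C EA S nS D D' DA DA'; have AM : A `<=` alph M by case/SfP: S.
have AM' : A `<=` alph M' by rewrite -EA.
exists (trd [set c] 0 (refusal_probe sigma A) M), (trd [set c] 0 (refusal_probe sigma A) M').
split=> //; [exact: cong_trd|split..].
- exact/refusal_Sf.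
- by move/(refusal_Sf sigma AM').
- by move/refusal_Div.
- by move/refusal_Div.
- by move/refusal_Div2 => -[a Aa]; exact: DA.
- by move/refusal_Div2 => -[a Aa]; exact: DA'.
Qed.

(* Offering [c] at the proper prefixes of [sigma] keeps the states reached
   there from refusing it. *)
Inductive initial_probe sigma (A : set Act) :
    nat -> option Act -> option Act -> nat -> Prop :=
| initial_walk i a : walk sigma i a -> initial_probe sigma A i (Some a) None i.+1
| initial_c i : i < size sigma ->
    initial_probe sigma A i None (Some c) (size sigma).+1
| initial_A a : A a ->
    initial_probe sigma A (size sigma) (Some a) (Some c) (size sigma).+1.

Section Initial_probe.
Variables (M : LTS Act) (sigma : seq Act) (A : set Act).
Let X := trd [set c] 0 (initial_probe sigma A) M.

Lemma reach_initial o s i : reach X o (s, i) ->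
  (i <= size sigma /\ reach M (take i sigma) s) \/ o <> [::].
Proof.
move: o s i; apply: trd_inv => [|o s i s' [[le R]|I] T|o s i a l s' i' [[le R]|I] T St|
    o s i l i' [[le R]|I] St];
  try by right; case: (l) => // b; case: (o).
- by left; rewrite take0; split=> //; exact: reach_init.
- by left; split=> //; exact: reach_tau T.
- by right.
- inversion St as [i0 a0 W| |a0 Aa]; subst; last by right; case: (o).
  by left; split; [exact: walk_lt W|rewrite W; exact: reach_vis T].
- by inversion St; subst; right; case: (o).
Qed.

(** Each silent move along [sigma] lowers the number of actions left, and at a fixed position only
    tau-steps of [M] remain, which terminate because no prefix of [sigma] is a divergence trace. *)
Lemma initial_Div : (forall i, i <= size sigma -> ~ Div M (take i sigma)) -> ~ Div X [::].
Proof.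
move=> nD /DivP[[s i] [R D]]; move: D; apply/convP.
apply: (@conv_lex _ X _ unit (fun y x => trans M x None y) (fun _ _ => False)
  (fun x => reach X [::] x) (fun x => size sigma - x.2) fst (fun=> tt)); last exact: R.
  move=> [s' j] /reach_initial[[le R']|[]//]; split; last by constructor.
  exact: Div_reach_conv (nD _ le) R'.
move=> [s1 j] [s2 j'] R1 T; split; first exact: reach_tau T.
case: T => _ /= [[_ -> T]|[a _ St]|[_ St]]; first by right; split=> //; left.
  by inversion St as [i0 a0 W| |]; subst; left; have := walk_lt W; lia.
by inversion St.
Qed.

Lemma initial_Sf : A `<=` alph M -> (Sf X ([::], [set c]) <-> Sf M (sigma, A)).
Proof.
move=> AM; split=> /SfP[_ H]; apply/SfP; split=> //; last first.
  case: H => s [R S F]; exists (s, size sigma); split.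
  - by apply: trd_walk R => i a W; constructor.
  - move=> [s' i] [_ /= [[_ _ /S]|[a _ St]|[_ St]]] //; inversion St as [i0 a0 W| |]; subst.
    by have := walk_lt W; rewrite ltnn.
  - move=> _ -> [s' i] [_ /= [[//]|[a T St]|[_ St]]].
      by inversion St; subst; exact: F T.
    by inversion St; subst; lia.
case: H => -[s i] [R S F]; case: (reach_initial R) => [[le R']|] //.
have Ei : i = size sigma.
  apply/eqP; rewrite eqn_leq le leqNgt; apply/negP => lt.
  by apply: (F c erefl (s, (size sigma).+1)); apply: trd_free => //; constructor.
rewrite Ei take_size in R'; exists s; split=> //.
  by move=> s' T; apply: (S (s', i)); exact: trd_tau.
move=> a Aa s' T; apply: (F c erefl (s', (size sigma).+1)); rewrite Ei.
by apply: trd_sync T _ => //; constructor.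
Qed.

End Initial_probe.

Lemma distinguish_anF M M' sigma A : cong M M' -> alph M = alph M' ->
  Sf M (sigma, A) -> ~ Sf M' (sigma, A) ->
  (forall i, i <= size sigma -> ~ Div M (take i sigma)) ->
  (forall i, i <= size sigma -> ~ Div M' (take i sigma)) -> exists X X',
  [/\ cong X X', alph X = [set c] /\ alph X' = [set c],
      Sf X ([::], [set c]) /\ ~ Sf X' ([::], [set c])
    & ~ Div X [::] /\ ~ Div X' [::]].
Proof.
move=> C EA S nS D D'; have AM : A `<=` alph M by case/SfP: S.
have AM' : A `<=` alph M' by rewrite -EA.
exists (trd [set c] 0 (initial_probe sigma A) M), (trd [set c] 0 (initial_probe sigma A) M').
split=> //; [exact: cong_trd|split|split].
- exact/initial_Sf.
- by move/(initial_Sf sigma AM').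
- exact: initial_Div.
- exact: initial_Div.
Qed.

End Probes.

(** * Probes for infinite traces *)

Section Infinite_probes.
Variables (Act : Type) (Act_infinite : infinite_set [set: Act]).
Variables (cong : LTS Act -> LTS Act -> Prop) (congC : congruence cong).
Variable c : Act.
Implicit Types (M : LTS Act) (xi : nat -> Act).

Lemma mkseq_minS (T : Type) (xi : nat -> T) n i : mkseq xi (minn i.+1 n) =
  ext (mkseq xi (minn i n)) (if i < n then Some (xi i) else None).
Proof.
case: (ltnP i n) => lt; last by congr mkseq; lia.
by rewrite (minn_idPl lt) mkseqS.
Qed.

Section Tail_probe.
Variables (xi : nat -> Act) (n : nat).

(** The first [n] actions of [xi] stay visible and the later ones are hidden, so that an infinite
    trace becomes a divergence after [mkseq xi n]. Keeping the beginning visible excludes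
    interference from divergences of [M] at earlier prefixes. *)
Inductive tail_probe : nat -> option Act -> option Act -> nat -> Prop :=
| tail_step i : tail_probe i (Some (xi i)) (if i < n then Some (xi i) else None) i.+1.

Definition tail_alph : set Act := [set xi i | i in `I_n].

Variable M : LTS Act.
Let X := trd tail_alph 0 tail_probe M.

Lemma reach_tail o s i : reach X o (s, i) ->
  o = mkseq xi (minn i n) /\ reach M (mkseq xi i) s.
Proof.
move: o s i; apply: trd_inv => [|o s i s' [Eo R] T|o s i a l s' i' [-> R] T St|o s i l i' _ St].
- by rewrite min0n; split=> //; exact: reach_init.
- by split=> //; exact: reach_tau T.
- by inversion St; subst; rewrite mkseq_minS mkseqS; split; last exact: reach_vis T.
- by inversion St.
Qed.

Lemma tail_out i : if (if i < n then Some (xi i) else None) is Some b then tail_alph b else True.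
Proof. by case: ltnP => // lt; exists i. Qed.

Lemma tail_Div : Inf M xi -> Div X (mkseq xi n).
Proof.
move=> /InfP[p [v R]]; have [p0 v0 S U] := R.
have [|||t0 [_ vt0]] := @unbounded_attains v 0 _ _ n.
- by move=> t _; have := S t; lia.
- by move=> m; have [t] := U m; exists t.
- by rewrite v0.
have RX t : reach X (mkseq xi (minn (v t) n)) (p t, v t).
  elim: t => [|t IH]; first by rewrite p0 v0 min0n; exact: reach_init.
  case: (S t) => -[-> T]; first by apply: reach_tau IH _; exact: trd_tau.
  rewrite mkseq_minS.
  apply: reach_step IH _; apply: trd_sync T _; [exact: tail_out|constructor].
apply/DivP; exists (p t0, v t0); split; first by have := RX t0; rewrite vt0 minnn.
have mono d : v t0 <= v (t0 + d) by apply: (irun_mono R); exact: leq_addr.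
exists (fun d => (p (t0 + d), v (t0 + d))); rewrite addn0; split=> // d.
rewrite addnS; case: (S (t0 + d)) => -[-> T]; first exact: trd_tau.
have St := tail_step (v (t0 + d)); rewrite ltnNge -vt0 mono /= in St.
exact: trd_sync T St.
Qed.

Lemma Div_tail : (forall i, n <= i -> ~ Div M (mkseq xi i)) ->
  Div X (mkseq xi n) -> Inf M xi.
Proof.
move=> nD /DivP[[s i] [R [p [p0 pP]]]].
have RX t : reach X (mkseq xi n) (p t).
  by elim: t => [|t IH]; [rewrite p0|apply: reach_tau IH (pP t)].
have RM t : n <= (p t).2 /\ reach M (mkseq xi (p t).2) (p t).1.
  have := RX t; case: (p t) => s1 i1 /reach_tail[/(congr1 size)].
  by rewrite !size_mkseq /= => E; split=> //; lia.
have St t : ((p t.+1).2 = (p t).2 /\ trans M (p t).1 None (p t.+1).1) \/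
    ((p t.+1).2 = (p t).2.+1 /\ trans M (p t).1 (Some (xi (p t).2)) (p t.+1).1).
  have := pP t; case: (p t) (p t.+1) => [s1 i1] [s2 i2] [_ /= [[_ -> T]|[a T St]|[_ St]]].
  - by left.
  - by inversion St; subst; right.
  - by inversion St.
have mono t : (p t).2 <= (p t.+1).2 by case: (St t) => -[->].
(* Either the silent path consumes all of [xi], or it ends in a divergence of [M] after a prefix of
   length at least [n], which is excluded. *)
have [U|[t0 cst]] := unbounded_or_constant mono.
- apply: (@inf_map _ M xi (fun t => (p t).1) (fun t => (p t).2) 0).
  + by case: (RM 0).
  + by move=> t _; case: (St t) => -[E T]; [left|right]; split=> //; exact: taus1.
  + by move=> m; have [t mt] := U m; exists t.
- case: (RM t0) => le R0; case: (nD _ le); apply/DivP; exists (p t0).1; split=> //.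
  exists (fun d => (p (t0 + d)).1); rewrite addn0; split=> // d; rewrite addnS.
  case: (St (t0 + d)) => -[E T] //.
  by move: (cst (t0 + d)) (cst (t0 + d).+1); lia.
Qed.

End Tail_probe.

Lemma distinguish_Inf_tail M M' xi n : cong M M' -> alph M = alph M' ->
  Inf M xi -> ~ Inf M' xi -> (forall i, n <= i -> ~ Div M' (mkseq xi i)) ->
  exists X X', [/\ cong X X', Div X (mkseq xi n) & ~ Div X' (mkseq xi n)].
Proof.
move=> C EA I nI nD.
exists (trd (tail_alph xi n) 0 (tail_probe xi n) M), (trd (tail_alph xi n) 0 (tail_probe xi n) M').
split; [|exact: tail_Div|by move/(Div_tail nD)].
apply: trd_cong => //; right; apply: finite_set_countable.
by apply: finite_image; exact: finite_II.
Qed.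

(* The LTS executes [xi] invisibly.  At a position [i] satisfying [P], [c] is
   shown twice in a row, so that an odd power of [c] can diverge only where
   [mkseq xi i] does. *)
Section Count_probe.
Variables (xi : nat -> Act) (P : nat -> Prop).

Inductive count_probe : nat * nat -> option Act -> option Act -> nat * nat -> Prop :=
| count_skip i : count_probe (i, 0) (Some (xi i)) None (i.+1, 0)
| count_enter i : P i -> count_probe (i, 0) None (Some c) (i, 1)
| count_leave i : count_probe (i, 1) None (Some c) (i, 2)
| count_next i : count_probe (i, 2) (Some (xi i)) None (i.+1, 0).

Variable M : LTS Act.
Let X := trd [set c] (0, 0) count_probe M.

Lemma reach_count o s i ph : reach X o (s, (i, ph)) ->
  [/\ reach M (mkseq xi i) s, ph < 3, odd (size o) = (ph == 1),
      size o <= i.*2 + ph & ph = 1 -> P i].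
Proof.
move=> R.
suff G : forall o s q, reach X o (s, q) -> [/\ reach M (mkseq xi q.1) s, q.2 < 3,
    odd (size o) = (q.2 == 1), size o <= q.1.*2 + q.2 & q.2 = 1 -> P q.1] by exact: G _ _ _ R.
apply: trd_inv => {R o s i ph} [|o s q s' [R lt od sz PP] T|o s q a l s' q' [R lt od sz PP] T St|
    o s q l q' [R lt od sz PP] St].
- by split=> //; exact: reach_init.
- by split=> //; exact: reach_tau T.
- by inversion St; subst; move: R lt od sz PP => /= R lt od sz PP; split=> //;
    rewrite ?mkseqS; (try by exact: reach_vis T); lia.
- by inversion St; subst; move: R lt od sz PP => /= R lt od sz PP; split=> //;
    rewrite ?size_rcons /= ?od //; lia.
Qed.

Lemma count_Div k : Div X (nseq k.*2.+1 c) -> exists i, P i /\ Div M (mkseq xi i).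
Proof.
move=> /DivP[[s [i ph]] [R D]].
have [R' _ od _ Pi] := reach_count R.
have Eph : ph = 1 by apply/eqP; rewrite -od size_nseq /= odd_double.
exists i; split; first exact: Pi.
apply: contrapT => nD; move: D; apply/convP.
by apply: trd_conv_idle (Div_reach_conv nD R') => j q St; rewrite Eph in St; inversion St.
Qed.

Lemma count_Inf : Inf X (fun=> c) -> Inf M xi.
Proof.
move=> /InfP[p [v R]]; have RX := irun_reach R; have [p0 v0 S U] := R.
apply: (@inf_map _ M xi (fun t => (p t).1) (fun t => (p t).2.1) 0).
- by rewrite p0; exact: reach_init.
- move=> t _.
  have T : exists l, trans X (p t) l (p t.+1).
    by case: (S t) => -[_ T]; [exists None|exists (Some c)].
  case: T => l; case: (p t) (p t.+1) => [s1 q1] [s2 q2] [_ /= [[_ -> T]|[a T St]|[-> St]]].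
  + by left; split=> //; exact: taus1.
  + by right; inversion St; subst.
  + by left; split; [inversion St; subst|exact: taus_refl].
(* At most two [c]s are shown per position, so infinitely many of them force unbounded positions;
   the extra 2 accounts for the current position. *)
- move=> n; have [t nt] := U (n.*2.+2); exists t; split=> //.
  have := RX t; rewrite mkseq_const; case: (p t) => s [i ph] /reach_count[_ + _].
  by rewrite size_nseq /=; lia.
Qed.

Lemma Inf_count : (forall n, exists i, n <= i /\ P i) -> Inf M xi -> Inf X (fun=> c).
Proof.
move=> PI /InfP[p [v R]]; have [p0 v0 S U] := R.
pose Z (_ : nat) (x : state X) := exists t, x.1 = p t /\ x.2.1 = v t /\ x.2.2 < 3.
apply: (@inf_coind _ X _ Z); first by exists 0; rewrite p0 v0.
move=> m0 [s [i ph]] [t [/= -> [-> ph3]]] {s i}.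
have adv := irun_adv R.
have lift s s' q : taus s s' -> taus (L := X) (s, q) (s', q).
  by case=> m; elim=> {m s s'} [s|m s s' s'' T _ IH]; [exact: taus_refl|
    apply: taus_trans IH; apply: taus1; exact: trd_tau].
have hid t0 f : f = 0 \/ f = 2 ->
    exists t1, v t1 = (v t0).+1 /\ taus (L := X) (p t0, (v t0, f)) (p t1, (v t1, 0)).
  move=> Ef; have [t1 [E [s1 [T1 T]]]] := adv t0.
  exists t1; split=> //; apply: taus_trans (lift _ _ _ T1) _; apply: taus1; rewrite E.
  by apply: trd_sync T _ => //; case: Ef => ->; constructor.
have reachP0 d : forall t0, P (v t0 + d) ->
    exists t1, taus (L := X) (p t0, (v t0, 0)) (p t1, (v t1, 0)) /\ P (v t1).
  elim: d => [|d IH] t0 Pd; first by exists t0; rewrite addn0 in Pd; split=> //; exact: taus_refl.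
  have [t1 [E T]] := hid t0 0 (or_introl erefl).
  have [|t2 [T2 P2]] := IH t1; first by rewrite E addSn -addnS.
  by exists t2; split=> //; exact: taus_trans T T2.
(* From phase 0, positions are skipped silently up to the next one satisfying [P]; it exists because
   [P] holds infinitely often. *)
have from0 t0 : exists y, wstep (L := X) (p t0, (v t0, 0)) c y /\ Z 0 y.
  have [i [le Pi]] := PI (v t0).
  have [|t1 [T P1]] := reachP0 (i - v t0) t0; first by rewrite subnKC.
  exists (p t1, (v t1, 1)); split; last by exists t1.
  by exists (p t1, (v t1, 0)); split=> //; apply: trd_free => //; constructor.
case: ph ph3 => [|[|[|//]]] _.
- exact: from0.
- exists (p t, (v t, 2)); split; last by exists t.
  by exists (p t, (v t, 1)); split; [exact: taus_refl|apply: trd_free => //; constructor].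
- have [t1 [E T]] := hid t 2 (or_intror erefl); have [y [W Zy]] := from0 t1.
  by exists y; split=> //; exact: taus_wstep T W.
Qed.

End Count_probe.

Lemma distinguish_Inf M M' xi (P : nat -> Prop) : cong M M' -> alph M = alph M' ->
  Inf M xi -> ~ Inf M' xi -> (forall n, exists i, n <= i /\ P i) -> exists X X',
  [/\ cong X X', alph X = [set c] /\ alph X' = [set c],
      Inf X (fun=> c) /\ ~ Inf X' (fun=> c)
    & forall k, Div X (nseq k.*2.+1 c) \/ Div X' (nseq k.*2.+1 c) ->
      exists i, P i /\ (Div M (mkseq xi i) \/ Div M' (mkseq xi i))].
Proof.
move=> C EA I nI PI.
exists (trd [set c] (0, 0) (count_probe xi P) M), (trd [set c] (0, 0) (count_probe xi P) M').
split=> //.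
- by apply: trd_cong => //; right; exact: countable1.
- by split; [exact: Inf_count|move/count_Inf].
- by move=> k [] /count_Div[i [Pi D]]; exists i; split=> //; [left|right].
Qed.

End Infinite_probes.

(** * Contexts extending an LTS *)

(** [extT] without its alphabet condition and with [Div] in place of [minD]; a shortest diverging
    prefix is minimal, so the two agree on words over the alphabet. *)
Definition div_prefix (Act : Type) (L : LTS Act) (sigma : seq Act) :=
  exists rho pi, sigma = rho ++ pi /\ Div L rho.

Lemma Div_div_prefix (Act : Type) (L : LTS Act) sigma : Div L sigma -> div_prefix L sigma.
Proof. by move=> D; exists sigma, [::]; rewrite cats0. Qed.

Lemma div_prefix_rcons (Act : Type) (L : LTS Act) sigma a :
  div_prefix L sigma -> div_prefix L (rcons sigma a).
Proof. by case=> rho [pi [-> D]]; exists rho, (rcons pi a); rewrite rcons_cat. Qed.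

Lemma minD_prefix (Act : Type) (L : LTS Act) sigma : div_prefix L sigma ->
  exists i, i <= size sigma /\ minD L (take i sigma).
Proof.
case=> rho [pi [-> D]].
have ex : exists i, `[< Div L (take i (rho ++ pi)) >].
  by exists (size rho); apply/asboolP; rewrite take_size_cat.
case: (ex_minnP ex) => i /asboolP Di mi; exists i.
have le : i <= size rho by apply: mi; apply/asboolP; rewrite take_size_cat.
have le2 : i <= size (rho ++ pi) by rewrite size_cat; lia.
split=> //; split=> // j; rewrite (size_takel le2) => lt.
by rewrite take_takel 1?ltnW // => /asboolP /mi; lia.
Qed.

Lemma extTP (Act : Type) (L : LTS Act) sigma :
  extT L sigma <-> List.Forall (alph L) sigma /\ div_prefix L sigma.
Proof.
split=> [[F [i [_ [D _]]]]|[F /minD_prefix H]]; split=> //.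
by exists (take i sigma), (drop i sigma); rewrite cat_take_drop.
Qed.

Lemma Tr_alph (Act : Type) (L : LTS Act) sigma : Tr L sigma -> List.Forall (alph L) sigma.
Proof. by move=> /TrP[s]; exact: reach_alph. Qed.

Lemma Div_Tr (Act : Type) (L : LTS Act) sigma : Div L sigma -> Tr L sigma.
Proof. by move=> /DivP[s [R _]]; apply/TrP; exists s. Qed.

Lemma extT_Div (Act : Type) (L : LTS Act) sigma : Div L sigma -> extT L sigma.
Proof.
by move=> D; apply/extTP; split; [exact/Tr_alph/Div_Tr|exact: Div_div_prefix].
Qed.

Lemma reach_split (Act : Type) (L : LTS Act) s rho pi : reach L (rho ++ pi) s ->
  exists s0, reach L rho s0 /\ weak_path s0 pi s.
Proof.
move E : (rho ++ pi) => sg H; elim: H rho pi E => [|{}sg s0 l s' R IH T] rho pi.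
  case: rho pi => // -[] // _; exists (init L); split; first exact: reach_init.
  by exists [::]; split=> //; exact: lpath_nil.
case: l T => [b|] T; last first.
  move=> /IH[s1 [R1 [ls [P V]]]]; exists s1; split=> //.
  by exists (rcons ls None); rewrite visible_rcons; split=> //; exact: lpath_rcons T.
elim/last_ind: pi => [|pi a _]; rewrite ?cats0.
  move=> ->; exists s'; split; first exact: reach_vis T.
  by exists [::]; split=> //; exact: lpath_nil.
rewrite -rcons_cat => /rcons_inj[/IH[s1 [R1 [ls [P V]]]] ->]; exists s1; split=> //.
by exists (rcons ls (Some b)); rewrite visible_rcons /= V; split=> //; exact: lpath_rcons T.
Qed.

(** Symmetry of [cong] allows the difference to be oriented, so that the first LTS always has the
    property and the second lacks it. *)
Lemma separated (Act T : Type) (cong : LTS Act -> LTS Act -> Prop) (F : LTS Act -> set T) :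
  congruence cong -> ~ preserves cong F ->
  exists M M' x, [/\ cong M M', F M x & ~ F M' x].
Proof.
move=> congC nP; apply: contrapT => H; apply: nP.
suff G M M' x : cong M M' -> F M x -> F M' x.
  by move=> M M' C; apply/predeqP => x; split; apply: G => //; exact: congr_sym congC _ _ _.
by move=> C FM; apply: contrapT => nF'; apply: H; exists M, M', x.
Qed.

Lemma exists_act (Act : Type) : infinite_set [set: Act] -> exists c : Act, True.
Proof. by move=> /infinite_setN0[c _]; exists c. Qed.

(* A context built from a copy of [L]: the mode of a state records what has
   been demanded from the driven LTS [X], whose only action is [c]; [sw] changes
   the mode, [mt] allows the tau-steps of [L] and [vis] its visible steps, where
   the boolean says whether [X] takes part.  [kk] counts the [c]s of [X]. *)
Section Mode.
Variables (Act : Type) (c : Act) (X L : LTS Act).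
Variable sw : nat -> bool -> nat -> seq Act -> state L -> Prop.
Variable mt : nat -> Prop.
Variable vis : nat -> bool -> nat -> seq Act -> Act -> Prop.

Definition inp (b : bool) := if b then Some c else None.

Inductive mode_step : seq Act * state L * nat -> option Act -> option Act ->
    seq Act * state L * nat -> Prop :=
| mode_sw m b m' sigma s : sw m b m' sigma s ->
    mode_step (sigma, s, m) (inp b) None (sigma, s, m')
| mode_tau m sigma s s' : mt m -> trans L s None s' ->
    mode_step (sigma, s, m) None None (sigma, s', m)
| mode_vis m b m' sigma s a s' : vis m b m' sigma a -> trans L s (Some a) s' ->
    mode_step (sigma, s, m) (inp b) (Some a) (rcons sigma a, s', m').

Definition mode_lts := trd (alph L) ([::], init L, 0) mode_step X.

(** Mode 0 is an unrestricted copy of [L], so nothing of [L] is lost. Switches raise the mode, so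
    only finitely many occur in a row; 4 is the largest mode of the contexts below. *)
Record mode_ok (kk : nat -> nat) (Inv : seq Act -> state L -> nat -> Prop) : Prop := {
  ok_mt0 : mt 0;
  ok_vis0 : forall sigma a, vis 0 false 0 sigma a;
  ok_kk0 : kk 0 = 0;
  ok_Inv0 : Inv [::] (init L) 0;
  ok_sw : forall m b m' sigma s, sw m b m' sigma s -> reach L sigma s ->
    Inv sigma s m -> [/\ m < m', m' <= 4, kk m' = kk m + b & Inv sigma s m'];
  ok_mt : forall m sigma s s', mt m -> trans L s None s' -> Inv sigma s m -> Inv sigma s' m;
  ok_vis : forall m b m' sigma a s s', vis m b m' sigma a -> Inv sigma s m ->
    trans L s (Some a) s' -> kk m' = kk m + b /\ Inv (rcons sigma a) s' m'
}.

Variables (kk : nat -> nat) (Inv : seq Act -> state L -> nat -> Prop).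
Hypothesis ok : mode_ok kk Inv.

Let mt0 : mt 0. Proof. exact: ok_mt0 ok. Qed.
Let vis0 sigma a : vis 0 false 0 sigma a. Proof. exact: ok_vis0 ok _ _. Qed.
Let Inv_sw := ok_sw ok.
Let Inv_mt := ok_mt ok.
Let Inv_vis := ok_vis ok.

Local Notation N := mode_lts.

Lemma nseqD1 k (b : bool) : ext (nseq k c) (inp b) = nseq (k + b) c.
Proof.
case: b; rewrite ?addn0 // addn1 /=.
by elim: k => //= k ->.
Qed.

Lemma mode_reach o x sigma s m : reach N o (x, (sigma, s, m)) ->
  [/\ o = sigma, reach L sigma s, reach X (nseq (kk m) c) x & Inv sigma s m].
Proof.
move=> R.
suff G : forall o x q, reach N o (x, q) -> [/\ o = q.1.1, reach L q.1.1 q.1.2,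
    reach X (nseq (kk q.2) c) x & Inv q.1.1 q.1.2 q.2] by exact: G R.
apply: trd_inv => {R o x sigma s m} [|o x q x' [Eo R RX I] T|
    o x q a l x' q' [-> R RX I] T St|o x q l q' [-> R RX I] St].
- by rewrite (ok_kk0 ok); split; [|exact: reach_init..|exact: ok_Inv0 ok].
- by split=> //; exact: reach_tau T.
- move Ei : (Some a) St => i St; case: St Ei R RX I =>
    [m b m' sigma s Hs|m sigma s s' _ _|m b m' sigma s e s' Hv T'] //= Ei R RX I.
    have [_ _ -> I'] := Inv_sw Hs R I; split=> //.
    by rewrite -nseqD1 -Ei; exact: reach_step RX T.
  have [-> I'] := Inv_vis Hv I T'; split=> //; first exact: reach_vis T'.
  by rewrite -nseqD1 -Ei; exact: reach_step RX T.
- move Ei : None St => i St; case: St Ei R RX I =>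
    [m b m' sigma s Hs|m sigma s s' Hm T|m b m' sigma s e s' Hv T'] /= Ei R RX I.
  + have [_ _ -> I'] := Inv_sw Hs R I; split=> //.
    by rewrite -nseqD1 -Ei.
  + by split=> //; [exact: reach_tau T|exact: Inv_mt T I].
  + have [-> I'] := Inv_vis Hv I T'; split=> //; first exact: reach_vis T'.
    by rewrite -nseqD1 -Ei.
Qed.

Lemma mode_step_tau x sigma s m s' : mt m -> trans L s None s' ->
  trans N (x, (sigma, s, m)) None (x, (sigma, s', m)).
Proof. by move=> Hm T; apply: trd_free => //; constructor. Qed.

Lemma mode_step_vis x sigma s m a m' s' : vis m false m' sigma a -> trans L s (Some a) s' ->
  trans N (x, (sigma, s, m)) (Some a) (x, (rcons sigma a, s', m')).
Proof.
move=> Hv T; apply: trd_free; first exact: trans_alph T.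
exact: (@mode_vis m false).
Qed.

Lemma mode_sync_vis x x' sigma s m a m' s' : vis m true m' sigma a -> trans L s (Some a) s' ->
  trans X x (Some c) x' ->
  trans N (x, (sigma, s, m)) (Some a) (x', (rcons sigma a, s', m')).
Proof.
move=> Hv T TX; apply: trd_sync TX _; first exact: trans_alph T.
exact: (@mode_vis m true).
Qed.

Lemma mode_step_sw x sigma s m m' : sw m false m' sigma s ->
  trans N (x, (sigma, s, m)) None (x, (sigma, s, m')).
Proof. by move=> Hs; apply: trd_free => //; exact: (@mode_sw m false). Qed.

Lemma mode_sync_sw x x' sigma s m m' : sw m true m' sigma s -> trans X x (Some c) x' ->
  trans N (x, (sigma, s, m)) None (x', (sigma, s, m')).
Proof. by move=> Hs TX; apply: trd_sync TX _ => //; exact: (@mode_sw m true). Qed.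

Lemma reach_mode0 sigma s : reach L sigma s -> reach N sigma (init X, (sigma, s, 0)).
Proof.
elim=> [|{}sigma s0 l {}s _ IH T]; first exact: reach_init.
apply: reach_step IH _; case: l T => [a|] T; first exact: mode_step_vis.
exact: mode_step_tau.
Qed.

Lemma mode_lift_X rho s0 k x : (forall j, j < k -> sw j true j.+1 rho s0) ->
  reach L rho s0 -> reach X (nseq k c) x -> reach N rho (x, (rho, s0, k)).
Proof.
move=> Hs R; move E : (nseq k c) => w RX.
elim: RX k Hs E => [|{}w x0 l x1 RX IH T] k Hs E.
  by case: k Hs E => // _ _; exact: reach_mode0.
case: l T E => [a|] T E; last first.
  by apply: reach_tau (IH _ Hs E) _; exact: trd_tau.
case: k Hs E => [|k] Hs E; first by case: (w) E.
have {}E : rcons (nseq k c) c = rcons w a by rewrite -[rcons w a]E -[k.+1]addn1 -(nseqD1 k true).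
have [Ew Ea] := rcons_inj E; subst a.
have {}IH := IH k (fun j lt => Hs j (leqW lt)) Ew.
apply: reach_tau IH _; apply: mode_sync_sw T; exact: Hs.
Qed.

Lemma mode_lift_L x rho s0 m pi s : mt m -> (forall sigma a, vis m false m sigma a) ->
  reach N rho (x, (rho, s0, m)) -> weak_path s0 pi s ->
  reach N (rho ++ pi) (x, (rho ++ pi, s, m)).
Proof.
move=> Hm Hv R [ls [P <-]].
elim: P rho R => {s0 s ls} [s|s [a|] s1 ls s2 T _ IH] rho R /=; first by rewrite cats0.
  by rewrite -cat_rcons; apply: IH; apply: reach_vis R _; exact: mode_step_vis.
by apply: IH; apply: reach_tau R _; exact: mode_step_tau.
Qed.

(** In every mode the visible actions are those of the copy of [L], while [X] contributes silent
    moves and permissions only. Traces and infinite traces are therefore those of [L], whatever [X]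
    is. *)
Lemma mode_Tr : Tr N = Tr L.
Proof.
apply/predeqP => sigma; split=> /TrP.
  by case=> -[x [[sg s] m]] /mode_reach[-> R _ _]; apply/TrP; exists s.
by case=> s /reach_mode0 R; apply/TrP; eexists; exact: R.
Qed.

Lemma mode_step_proj x y l : trans N x l y ->
  if l is Some a then trans L x.2.1.2 (Some a) y.2.1.2
  else taus x.2.1.2 y.2.1.2.
Proof.
case: x y => [x q] [y q'] [_ /= T].
have G i : mode_step q i l q' ->
    if l is Some a then trans L q.1.2 (Some a) q'.1.2 else taus q.1.2 q'.1.2.
  by case=> [? ? ? ? ? _|? ? ? ? _ H|? ? ? ? ? ? ? _ H] //=; [exact: taus_refl|exact: taus1].
case: T => [[-> -> _]|[a _ /G]|[_ /G]] //; exact: taus_refl.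
Qed.

Lemma mode_Inf : Inf N = Inf L.
Proof.
apply/predeqP => xi; split=> /InfP[p [v [p0 v0 S U]]].
  apply: (@inf_map _ L xi (fun t => (p t).2.1.2) v 0).
  - by rewrite v0 p0; exact: reach_init.
  - by move=> t _; case: (S t) => -[-> /mode_step_proj T]; [left|right].
  - by move=> n; have [t nt] := U n; exists t.
apply: (@inf_map _ N xi (fun t => (init X, (mkseq xi (v t), p t, 0))) v 0).
- by rewrite v0 p0; exact: reach_init.
- move=> t _; case: (S t) => -[-> T]; [left|right]; split=> //.
    by apply: taus1; exact: mode_step_tau.
  by rewrite mkseqS; exact: mode_step_vis.
- by move=> n; have [t nt] := U n; exists t.
Qed.

Lemma Div_mode sigma : Div L sigma -> Div N sigma.
Proof.
move=> /DivP[s [R [p [p0 pP]]]]; apply/DivP; exists (init X, (sigma, s, 0)).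
split; first exact: reach_mode0.
exists (fun i => (init X, (sigma, p i, 0))); rewrite p0; split=> // i.
by apply: mode_step_tau.
Qed.

Lemma mode_diverges x q : diverges x -> diverges (L := N) (x, q).
Proof.
case=> p [p0 pP]; exists (fun i => (p i, q)); rewrite p0; split=> // i.
by apply: trd_tau; exact: pP.
Qed.

(** A silent path contains finitely many switches, so an infinite one needs infinitely many
    tau-steps of [L] or of [X]; the mode says how many [c]s [X] has done by then. *)
Lemma mode_Div sigma : Div N sigma ->
  Div L sigma \/ exists m s, [/\ Inv sigma s m, reach L sigma s & Div X (nseq (kk m) c)].
Proof.
move=> D; apply: contrapT => /not_orP[nD nX]; move: D => /DivP[y [R D]].
move: D; apply/convP.
apply: (@conv_lex _ N _ _ (fun y x => trans X x None y) (fun y x => trans L x None y)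
  (fun y => reach N sigma y) (fun y => 4 - y.2.2) fst (fun y => y.2.1.2)); last exact: R.
  move=> [x [[sg s] m]] /mode_reach[Eo RL RX I]; subst sg; split.
    apply/convP => D; apply: nX; exists m, s; split=> //; apply/DivP; by exists x.
  exact: Div_reach_conv nD RL.
move=> [x [[sg s] m]] [x' q'] R1 T; split; first exact: reach_tau T.
have [Eo RL _ I] := mode_reach R1.
have G i : mode_step (sg, s, m) i None q' ->
    4 - q'.2 < 4 - m \/ q'.2 = m /\ (i = None /\ trans L s None q'.1.2).
  move E1 : (sg, s, m) => q; move E2 : None => l St.
  case: St E1 E2 => [m0 b m' sg0 s1 Hs|m0 sg0 s1 s' Hm T'|//] [? ? ?] _; subst.
    by left; have [] := Inv_sw Hs RL I => /=; lia.
  by right.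
case: T => _ /= [[_ -> T]|[a _ /G[lt|[_ []//]]]|[-> /G[lt|[-> [_ T]]]]].
- by right; split=> //; left.
- by left.
- by left.
- by right; split=> //; right.
Qed.

Lemma mode_stable x sigma s m : mt m -> stable (L := N) (x, (sigma, s, m)) -> stable s.
Proof. by move=> Hm S s' T; apply: S (x, (sigma, s', m)) _; exact: mode_step_tau. Qed.

Lemma mode_stable_X x q : stable (L := N) (x, q) -> stable x.
Proof. by move=> S x' T; apply: S (x', q) _; exact: trd_tau. Qed.

Lemma mode_refuses x sigma s m m' A : (forall a, A a -> vis m false m' sigma a) ->
  refuses (L := N) (x, (sigma, s, m)) A -> refuses s A.
Proof.
move=> Hv F a Aa s' T; apply: (F a Aa (x, (rcons sigma a, s', m'))).
by apply: mode_step_vis T; exact: Hv.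
Qed.

Lemma stable_mode x sigma s m : stable x -> (mt m -> stable s) ->
  (forall b m', sw m b m' sigma s -> b /\ forall y, ~ trans X x (Some c) y) ->
  stable (L := N) (x, (sigma, s, m)).
Proof.
move=> SX Ss Hs [x' q'] [_ /= T].
have G i : mode_step (sigma, s, m) i None q' -> i = Some c /\ forall y, ~ trans X x (Some c) y.
  move E1 : (sigma, s, m) => q; move E2 : None => l St.
  case: St E1 E2 => [m0 b m' sg0 s1 H|m0 sg0 s1 s' Hm T'|//] [? ? ?] _; subst.
    by have [Eb H'] := Hs _ _ H; rewrite /inp Eb.
  by case: (Ss Hm _ T').
by case: T => [[_ _ /SX]|[a Tx /G[[<-] /(_ _ Tx)]]|[_ /G[]]].
Qed.

Lemma refuses_mode x sigma s m A :
  (forall a b m' s', A a -> vis m b m' sigma a -> trans L s (Some a) s' ->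
     b /\ forall y, ~ trans X x (Some c) y) ->
  refuses (L := N) (x, (sigma, s, m)) A.
Proof.
move=> H a Aa [x' q'] [_ /= T].
have G i : mode_step (sigma, s, m) i (Some a) q' ->
    i = Some c /\ forall y, ~ trans X x (Some c) y.
  move E1 : (sigma, s, m) => q; move E2 : (Some a) => l St.
  case: St E1 E2 => [//|//|m0 b m' sg0 s1 e s' Hv T'] [? ? ?] [?]; subst.
  by have [Eb H'] := H _ _ _ _ Aa Hv T'; rewrite /inp Eb.
by case: T => [[]|[e Tx /G[[<-] /(_ _ Tx)]]|[_ /G[]]].
Qed.

Lemma Sf_mode0 sigma A : stable (init X) -> (forall s b m', ~ sw 0 b m' sigma s) ->
  Sf L (sigma, A) -> Sf N (sigma, A).
Proof.
move=> SX nsw /SfP[AL [s [R S F]]]; apply/SfP; split=> //.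
exists (init X, (sigma, s, 0)); split; first exact: reach_mode0.
  by apply: stable_mode => // b m' /nsw.
by apply: refuses_mode => a b m' s' Aa _ T; case: (F _ Aa _ T).
Qed.

End Mode.

Lemma Forall_mkseq (Act : Type) (P : set Act) (xi : nat -> Act) i n :
  List.Forall P (mkseq xi n) -> i < n -> P (xi i).
Proof.
elim: n => // n IH; rewrite mkseqS -cats1 => /List.Forall_app[F1 F2].
rewrite ltnS leq_eqVlt => /orP[/eqP->|]; last exact: IH.
by inversion F2.
Qed.

Lemma Inf_alph (Act : Type) (L : LTS Act) xi i : Inf L xi -> alph L (xi i).
Proof. by move=> /(Inf_Tr i.+1) /Tr_alph /Forall_mkseq; apply. Qed.

Lemma extIP (Act : Type) (L : LTS Act) xi : extI L xi <->
  (forall i, alph L (xi i)) /\ exists i, div_prefix L (mkseq xi i).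
Proof.
split=> -[al [i]] H; split=> //.
  by exists i; apply: Div_div_prefix; case: H.
have [j [le D]] := minD_prefix H; exists j.
by move: D; rewrite size_mkseq in le; rewrite /mkseq -map_take take_iota (minn_idPl le).
Qed.

Section Count.
Variable D : nat -> Prop.

Definition cnt n := count (fun j => `[< D j >]) (iota 0 n).

Lemma cntS n : cnt n.+1 = cnt n + `[< D n >].
Proof. by rewrite /cnt -addn1 iotaD count_cat /= addn0 add0n. Qed.

Lemma cnt_le n : cnt n <= n.
Proof. by elim: n => // n IH; rewrite cntS; case: `[< _ >]; lia. Qed.

Lemma cnt_mono m n : m <= n -> cnt m <= cnt n.
Proof.
by apply: (homo_leq leqnn leq_trans) => i; rewrite cntS; lia.
Qed.

Lemma cnt_unbounded : (forall m, exists i, m <= i /\ D i) -> forall m, exists i, m <= cnt i.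
Proof.
move=> H; elim=> [|m [i mi]]; first by exists 0.
have [j [ij Dj]] := H i; exists j.+1; rewrite cntS (asboolT Dj).
by have := cnt_mono ij; lia.
Qed.

End Count.

Section Extensions.
Variables (Act : Type) (Act_infinite : infinite_set [set: Act]).
Variables (cong : LTS Act -> LTS Act -> Prop) (congC : congruence cong).
Hypothesis CFFD_cong : forall L L' : LTS Act, CFFD_equiv L L' -> cong L L'.
Hypothesis V_cong_B : cong (ltsV Act) (ltsB Act).
Implicit Types (L M X : LTS Act) (sigma : seq Act).

Lemma cong_mode_lts c X X' L sw mt vis : cong X X' -> alph X = [set c] -> alph X' = [set c] ->
  cong (mode_lts c X (L := L) sw mt vis) (mode_lts c X' (L := L) sw mt vis).
Proof.
by move=> C E E'; apply: trd_cong => //; [rewrite E E'|left; rewrite E; exact: countable1].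
Qed.

Lemma alph_prefix1 c X : alph X `<=` [set c] -> alph (lts_prefix c X) = [set c].
Proof. by move=> H; apply/predeqP => a; split=> [[/H|]|] //; right. Qed.

Lemma cong_prefix_mode c X X' L sw mt vis : cong X X' ->
  alph X `<=` [set c] -> alph X' `<=` [set c] ->
  cong (mode_lts c (lts_prefix c X) (L := L) sw mt vis)
       (mode_lts c (lts_prefix c X') (L := L) sw mt vis).
Proof.
move=> C E E'; apply: cong_mode_lts; [exact: cong_prefix congC _ _ _ C|exact: alph_prefix1..].
Qed.

Lemma prefix_init_stable c X : stable (init (lts_prefix c X)).
Proof. by move=> y T; inversion T. Qed.

(* A diverging state of [L] may be abandoned for [Y], which is [V] or [B]. *)
Section Diverging_mode.
Variables (c : Act) (Y L : LTS Act).

(** The state itself has to diverge, not only its trace: a stable state of [L] then has no silent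
    switch and keeps its stable failures. *)
Definition div_sw m b m' (sigma : seq Act) (s : state L) :=
  [/\ m = 0, b = true, m' = 1 & diverges s].
Definition div_vis m b m' (sigma : seq Act) (a : Act) := [/\ m = 0, b = false & m' = 0].
Definition div_inv sigma (s : state L) m := m <= 1 /\ (m = 1 -> Div L sigma).

Definition div_lts := mode_lts c (lts_prefix c Y) div_sw (fun m => m = 0) div_vis.

Lemma div_ok : mode_ok div_sw (fun m => m = 0) div_vis id div_inv.
Proof.
split=> // [m b m' sigma s [-> -> -> D] R _|m b m' sigma a s s' [-> -> ->] //].
by split=> //; split=> // _; apply/DivP; exists s.
Qed.

Lemma div_lts_Inf : Inf div_lts = Inf L.
Proof. exact: mode_Inf div_ok. Qed.

Lemma div_lts_Div : Div div_lts = Div L.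
Proof.
apply/predeqP => sigma; split; last exact: Div_mode div_ok _.
move=> D; have := mode_Div div_ok D.
case=> // -[[|[|m]] [s [[le H] _ +]]] //; last by move=> _; exact: H.
by move=> D0; case: (Div_prefix_nil D0).
Qed.

Lemma Sf_div_lts sigma A : Sf L (sigma, A) -> Sf div_lts (sigma, A).
Proof.
move=> /SfP[AL [s [R S F]]]; apply/SfP; split=> //.
exists (None, (sigma, s, 0)); split.
- exact: (reach_mode0 c (lts_prefix c Y) div_ok).
- apply: stable_mode => //; first exact: prefix_init_stable.
  by move=> b m' [_ _ _ [p [p0 pP]]]; case: (S (p 1)); rewrite -p0.
- by apply: refuses_mode => a b m' s' Aa _ T; case: (F _ Aa _ T).
Qed.

Lemma div_lts_Sf sigma A : Sf div_lts (sigma, A) -> Sf L (sigma, A) \/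
  [/\ Div L sigma, A `<=` alph L & exists2 y, reach Y [::] y & stable y].
Proof.
move=> /SfP[AL [[x [[sg s] m]] [R S F]]].
have [Esg RL RX [le H]] := mode_reach div_ok R; subst sg.
case: m le R S F RX H => [|[|//]] _ R S F RX H.
  left; apply/SfP; split=> //; exists s; split=> //; first exact: mode_stable S.
  by apply: (mode_refuses (m' := 0)) F.
right; split=> //; first exact: H.
move: (lts_prefix_reach RX); case: x R S F {RX} => [y|] // R S F [w [<-] Ry].
by exists y => // y' T; apply: (mode_stable_X S (s' := Some y')); constructor.
Qed.

Lemma div_lts_all sigma A : Div L sigma -> A `<=` alph L ->
  (exists2 y, reach Y [::] y & stable y) -> Sf div_lts (sigma, A).
Proof.
move=> /DivP[s [R D]] AL [y Ry S]; apply/SfP; split=> //.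
exists (Some y, (sigma, s, 1)); split.
- apply: (mode_lift_X div_ok) => //.
    by move=> [|//] _.
  exact: reach_lts_prefix.
- apply: stable_mode => //; last by move=> b m' [].
  by move=> x' T; inversion T as [|? ? ? T']; subst; exact: S T'.
- by apply: refuses_mode => a b m' s' _ [].
Qed.

End Diverging_mode.

(** Mode 1 of [div_lts] shows nothing and only runs the abandoned alternative. With [V] it never
    becomes stable, so nothing changes; with [B] it can stop and refuse everything, so the failures
    of [L] after divergence traces are blurred. *)
Lemma cong_nF L L' : alph L = alph L' -> nF L = nF L' -> Div L = Div L' ->
  Inf L = Inf L' -> cong L L'.
Proof.
move=> EA EF ED EI; have [c _] := exists_act Act_infinite.
have VL M : cong M (div_lts c (ltsV Act) M).
  apply: CFFD_cong; split; rewrite ?div_lts_Div ?div_lts_Inf //.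
  apply/predeqP => -[sigma A]; split; first exact: Sf_div_lts.
  by case/div_lts_Sf => // -[_ _ [y _ S]]; case: (S tt).
have VB M : cong (div_lts c (ltsV Act) M) (div_lts c (ltsB Act) M).
  by apply: cong_prefix_mode => // a [].
have RB : exists2 y, reach (ltsB Act) [::] y & stable y.
  exists true; last by move=> y [].
  by apply: (reach_tau (reach_init (ltsB Act))).
suff BB : cong (div_lts c (ltsB Act) L) (div_lts c (ltsB Act) L').
  have T := congr_trans congC; have Sy := congr_sym congC.
  apply: (T _ _ _ (VL L)); apply: (T _ _ _ (VB L)); apply: (T _ _ _ BB).
  by apply: (T _ _ _ (Sy _ _ (VB L'))); exact: Sy.
apply: CFFD_cong; split; rewrite ?div_lts_Div ?div_lts_Inf //.
suff G M M' sigma A : alph M = alph M' -> nF M = nF M' -> Div M = Div M' ->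
    Sf (div_lts c (ltsB Act) M) (sigma, A) -> Sf (div_lts c (ltsB Act) M') (sigma, A).
  by apply/predeqP => -[sigma A]; split; apply: G.
move=> EA' EF' ED' /div_lts_Sf H.
have [D|nD] := pselect (Div M sigma).
  apply: div_lts_all => //; first by rewrite -ED'.
  by rewrite -EA'; case: H => [/SfP[]|[]].
apply: Sf_div_lts; case: H => [S|[]//].
by have : nF M (sigma, A) by []; rewrite EF' => -[].
Qed.

(* After a divergence trace, [X] is started by a first [c] (mode 1) and asked
   for a second one (mode 2), from where [L] goes on next to it. *)
Section Late_divergence_mode.
Variables (c : Act) (X L : LTS Act).

(** By [cong_nF], failures after divergence traces no longer count, so the switch may be allowed by
    the trace alone. The first [c] is that of the prefix, the second that of [X]. Mode 1 shows
    nothing visible, so a divergence of [X] before its own [c] can only occur at a divergence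
    trace. *)
Definition late_sw m b m' (sigma : seq Act) (s : state L) :=
  [/\ m < 2, b = true, m' = m.+1 & Div L sigma].
Definition late_mt m := m <> 1.
Definition late_vis m b m' (sigma : seq Act) (a : Act) := [/\ m <> 1, b = false & m' = m].
Definition late_inv sigma (s : state L) m :=
  [/\ m <= 2, m = 1 -> Div L sigma & m = 2 -> div_prefix L sigma].

Definition late_lts := mode_lts c (lts_prefix c X) late_sw late_mt late_vis.

Lemma late_ok : mode_ok late_sw late_mt late_vis id late_inv.
Proof.
split=> //.
- move=> m b m' sigma s [lt -> -> D] R _; split; [lia..|split=> // _].
  exact: Div_div_prefix.
- move=> m b m' sigma a s s' [ne -> ->] [le _ H] _; split; first by rewrite addn0.
  by split=> // /H; exact: div_prefix_rcons.
Qed.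

Lemma late_Div sigma : Div late_lts sigma ->
  Div L sigma \/ Div X [:: c] /\ div_prefix L sigma.
Proof.
move=> D; case: (mode_Div late_ok D); first by left.
case=> [[|[|[|m]]] [s [[le H1 H2] _ DX]]] //.
- by case: (Div_prefix_nil DX).
- by left; exact: H1.
- by right; split; [exact: (proj1 (Div_prefix _ _ _) DX)|exact: H2].
Qed.

Lemma Div_late sigma : Div X [:: c] -> Tr L sigma -> div_prefix L sigma ->
  Div late_lts sigma.
Proof.
move=> /(Div_prefix c) /DivP[x [RX DX]] /TrP[s R] [rho [pi [E D]]]; subst sigma.
have [s0 [R0 P]] := reach_split R.
apply/DivP; exists (x, (rho ++ pi, s, 2)); split; last exact: mode_diverges.
apply: mode_lift_L P => //.
by apply: (mode_lift_X late_ok (k := 2)) => // -[|[|//]].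
Qed.

Lemma late_nF sigma A : nF late_lts (sigma, A) <-> Sf L (sigma, A) /\ ~ Div late_lts sigma.
Proof.
split=> [[/SfP[AL [[x [[sg s] m]] [R S F]]] nD]|[S nD]]; last first.
  split=> //; apply: (Sf_mode0 c late_ok) S; first exact: prefix_init_stable.
  by move=> s b m' [_ _ _ /(Div_mode c (lts_prefix c X) late_ok)].
have [Esg RL RX [le H1 H2]] := mode_reach late_ok R; subst sg; split=> //.
apply/SfP; split=> //.
have m1 : m <> 1 by move/H1 => D; apply: nD; exact: (Div_mode _ _ late_ok).
exists s; split=> //; first exact: mode_stable S.
by apply: (mode_refuses (m' := m)) F.
Qed.

End Late_divergence_mode.

Hypothesis alphC : preserves cong (@alph Act).

Lemma add_Div L : ~ preserves cong (@Div Act) -> exists L',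
  [/\ cong L L', alph L' = alph L, Div L' = Tr L `&` extT L, Inf L' = Inf L & nF L' = anF L].
Proof.
move=> /(separated congC)[M [M' [sigma [C D nD]]]].
have [c _] := exists_act Act_infinite.
have EA := alphC C.
have [X [X' [CX [EX EX'] DX nDX']]] := distinguish_Div Act_infinite congC c C EA D nD.
exists (late_lts c X L); split=> //.
(* [X'] does not diverge after [c], so the context around it agrees with [L] in everything that
   [cong_nF] compares. *)
- apply: (congr_trans congC) (_ : cong L (late_lts c X' L)) _.
    apply: cong_nF => //; last by rewrite (mode_Inf _ _ (late_ok L)).
      apply/predeqP => -[tau A]; split; last first.
        case/late_nF => S nDt; split=> // Dt; apply: nDt.
        exact: (Div_mode c (lts_prefix c X') (late_ok L)).
      by move=> [S nDt]; apply/late_nF; split=> // /late_Div[/nDt|[/nDX']].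
    apply/predeqP => tau; split; first exact: (Div_mode _ _ (late_ok L)).
    by case/late_Div => // -[].
  apply: cong_prefix_mode; rewrite ?EX ?EX' //.
  exact: (congr_sym congC).
- apply/predeqP => tau; split.
    move=> /[dup] /Div_Tr; rewrite (mode_Tr _ _ (late_ok L)) => T H; split=> //.
    case/late_Div: H => [/extT_Div|[_ P]] //.
    by apply/extTP; split=> //; exact: Tr_alph.
  by case=> T /extTP[_ P]; exact: Div_late.
- exact: (mode_Inf _ _ (late_ok L)).
- apply/predeqP => -[tau A]; split.
    move=> /late_nF[S nDt]; split=> // /extTP[_ P]; apply: nDt; apply: Div_late => //.
    by case/SfP: S => _ [s [R _ _]]; apply/TrP; exists s.
  case=> S nP; apply/late_nF; split=> // /late_Div[/extT_Div|[_ P]] //; apply: nP.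
  apply/extTP; split=> //; apply: Tr_alph; apply/TrP.
  by case/SfP: S => _ [s [R _ _]]; exists s.
Qed.

(* As in [late_lts], but in mode 3 every visible step of [L] needs a third [c],
   so that [X] may block all of them; mode 4 is a free copy of [L]. *)
Section Late_refusal_mode.
Variables (c : Act) (X L : LTS Act).

Definition ref_sw m b m' (sigma : seq Act) (s : state L) :=
  [/\ m < 2, b = true, m' = m.+1 & Div L sigma] \/ [/\ m = 2, b = false & m' = 3].
Definition ref_mt m := m <> 1.
Definition ref_vis m b m' (sigma : seq Act) (a : Act) :=
  [/\ m <> 1, m <> 3, b = false & m' = m] \/ [/\ m = 3, b = true & m' = 4].
(** Mode 3 is entered from mode 2 without a [c], so from there on the number of [c]s is one less
    than the mode. *)
Definition ref_kk m := if m <= 2 then m else m.-1.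
Definition ref_inv sigma (s : state L) m :=
  [/\ m <= 4, m = 1 -> Div L sigma & 2 <= m -> div_prefix L sigma].

Definition ref_lts := mode_lts c (lts_prefix c X) ref_sw ref_mt ref_vis.

Lemma ref_ok : mode_ok ref_sw ref_mt ref_vis ref_kk ref_inv.
Proof.
split=> //.
- by move=> sigma a; left.
- move=> m b m' sigma s [[lt -> -> D]|[-> -> ->]] R [le H1 H2].
    case: m lt {le H1 H2} => [|[|//]] _; split=> //; split=> // _; exact: Div_div_prefix.
  by split=> //; split=> // _; exact: H2.
- move=> m b m' sigma a s s' [[n1 n3 -> ->]|[-> -> ->]] [le H1 H2] _.
    by rewrite addn0; split=> //; split=> // /H2; exact: div_prefix_rcons.
  by split=> //; split=> // _; apply: div_prefix_rcons; exact: H2.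
Qed.

Hypotheses (nD1 : ~ Div X [:: c]) (nD2 : ~ Div X [:: c; c]).

Lemma ref_Div : Div ref_lts = Div L.
Proof.
apply/predeqP => sigma; split; last exact: (Div_mode _ _ ref_ok).
move=> D; case: (mode_Div ref_ok D) => // -[m [s [[le H1 H2] _ DX]]].
case: m le H1 H2 DX => [|[|[|[|[|//]]]]] _ H1 H2 DX.
- by case: (Div_prefix_nil DX).
- exact: H1.
- by case: nD1; exact: (proj1 (Div_prefix _ _ _) DX).
- by case: nD1; exact: (proj1 (Div_prefix _ _ _) DX).
- by case: nD2; exact: (proj1 (Div_prefix _ _ _) DX).
Qed.

Lemma nF_ref sigma A : nF L (sigma, A) -> nF ref_lts (sigma, A).
Proof.
move=> [S nD]; split; last by rewrite ref_Div.
apply: (Sf_mode0 c ref_ok) S; first exact: prefix_init_stable.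
by move=> s b m' [[_ _ _ /nD]|[]].
Qed.

Lemma ref_nF sigma A : nF ref_lts (sigma, A) -> nF L (sigma, A) \/
  [/\ A `<=` alph L, Tr L sigma, div_prefix L sigma & ~ Div L sigma].
Proof.
rewrite /nF /= ref_Div => -[/SfP[AL [[x [[sg s] m]] [R S F]]] nD].
have [Esg RL RX [le H1 H2]] := mode_reach ref_ok R; subst sg.
have [m2|m2] := leqP 2 m.
  by right; split=> //; [apply/TrP; exists s|exact: H2].
have m0 : m = 0 by case: m m2 H1 {R S F RX le H2} => [|[|]] // _ /(_ erefl).
subst m; left; split=> //; apply/SfP; split=> //; exists s; split=> //.
  exact: mode_stable S.
by apply: (mode_refuses (m' := 0)) F => a _; left.
Qed.

(** If every stable state of [X] after its [c] offers another one, mode 3 blocks no step of [L], and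
    a refusal there is a refusal of [L]. *)
Lemma ref_nF_offers : alph X = [set c] -> ~ Sf X ([:: c], [set c]) ->
  nF ref_lts = nF L.
Proof.
move=> EX nS; apply/predeqP => -[sigma A]; split; last exact: nF_ref.
rewrite /nF /= ref_Div => -[/SfP[AL [[x [[sg s] m]] [R S F]]] nD].
have [Esg RL RX [le H1 H2]] := mode_reach ref_ok R; subst sg.
split=> //; apply/SfP; split=> //; exists s.
have m1 : m <> 1 by move/H1.
split=> //; first exact: mode_stable S.
have [E3|m3] := pselect (m = 3); last first.
  by apply: (mode_refuses (m' := m)) F => a _; left.
subst m; move=> a Aa s' T.
have [y TX] : exists y, trans (lts_prefix c X) x (Some c) y.
  apply: contrapT => H; apply: nS; apply: (@prefix_Sf _ c); rewrite ?EX //.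
  apply/SfP; split; first by move=> b ->; right.
  exists x; split=> //; first exact: mode_stable_X S.
  by move=> _ -> y Ty; apply: H; exists y.
by apply: (F _ Aa (y, (rcons sigma a, s', 4))); apply: mode_sync_vis T TX; right.
Qed.

Lemma nF_ref_refuses sigma A : Sf X ([:: c], [set c]) ->
  A `<=` alph L -> Tr L sigma -> div_prefix L sigma -> ~ Div L sigma -> nF ref_lts (sigma, A).
Proof.
move=> /(Sf_prefix c)/SfP[_ [x [RX SX FX]]] AL /TrP[s1 R1] [rho [pi [E D]]] nD.
split; last by rewrite ref_Div.
(* As [sigma] is not itself a divergence trace, it leads to a stable state of [L]. The path is cut
   at the divergence prefix [rho], where [X] is started, and continues in mode 2. *)
have [s [R S]] := conv_stable R1 (Div_reach_conv nD R1).
rewrite E in R; have [s0 [R0 P]] := reach_split R.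
apply/SfP; split=> //; exists (x, (sigma, s, 3)); split.
- apply: (@reach_tau _ ref_lts _ (x, (sigma, s, 2))); last by apply: mode_step_sw; right.
  rewrite E; apply: mode_lift_L P => //; first by move=> ? ?; left.
  by apply: (mode_lift_X ref_ok (k := 2)) => // -[|[|//]] _; left.
- by apply: stable_mode => // b m' [[]|[]].
- move=> a Aa; move: a Aa; apply: refuses_mode => a b m' s' Aa [[]|[_ -> _]] // _.
  by split=> //; exact: FX.
Qed.

End Late_refusal_mode.

Lemma add_refusals L : preserves cong (@Div Act) -> ~ preserves cong (@snF Act) -> exists L',
  [/\ cong L L', alph L' = alph L, Div L' = Div L, Inf L' = Inf L &
      forall sigma A, nF L' (sigma, A) <-> nF L (sigma, A) \/
        [/\ A `<=` alph L, Tr L sigma, div_prefix L sigma & ~ Div L sigma]].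
Proof.
move=> DivC /(separated congC)[M [M' [[sigma A] [C [[S nD] nDA] nsnF]]]].
have [c _] := exists_act Act_infinite.
have EA := alphC C; have ED := DivC _ _ C; rewrite ED in nD.
(* Divergences agree on [M] and [M'], so the difference in [snF] must come from the stable
   failure. *)
have nS : ~ Sf M' (sigma, A).
  by move=> S'; apply: nsnF; split=> [|a]; rewrite -?ED //; exact: nDA.
have [||||X [X' [CX [EX EX'] [SX nSX'] [nD1 nD1'] [nD2 nD2']]]] :=
  distinguish_refusal Act_infinite congC c C EA S nS.
- by rewrite ED.
- by [].
- by move=> a Aa; exact: nDA.
- by move=> a Aa; rewrite -ED; exact: nDA.
exists (ref_lts c X L); split=> //.
- apply: (congr_trans congC) (_ : cong L (ref_lts c X' L)) _.
    by apply: cong_nF; rewrite // ?(mode_Inf _ _ (ref_ok L)) ?ref_Div ?ref_nF_offers.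
  apply: cong_prefix_mode; rewrite ?EX ?EX' //.
  exact: (congr_sym congC).
- exact: ref_Div.
- exact: (mode_Inf _ _ (ref_ok L)).
- move=> tau B; split; first exact: ref_nF.
  by case=> [|[]]; [exact: nF_ref|exact: nF_ref_refuses].
Qed.

(* In mode 1, steps of [L] into a divergence need a [c] of [X], and lead to a
   dead end, which is harmless after a divergence trace.  Mode 0 can
   always take such steps freely, but every stable state of mode 0 moves on. *)
Section Initial_refusal_mode.
Variables (c : Act) (X L : LTS Act).

Definition ini_sw m b m' (sigma : seq Act) (s : state L) :=
  [/\ m = 0, b = false, m' = 1 & stable s].
Definition ini_vis m b m' sigma (a : Act) :=
  [\/ [/\ m = 0, b = false & m' = 0],
      [/\ m = 1, b = false, m' = 0 & ~ Div L (rcons sigma a)]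
    | [/\ m = 1, b = true, m' = 2 & Div L (rcons sigma a)]].
Definition ini_kk m := m.-1.
Definition ini_inv sigma (s : state L) m :=
  [/\ m <= 2, m = 1 -> stable s & m = 2 -> Div L sigma].

Definition ini_lts := mode_lts c X ini_sw (fun m => m = 0) ini_vis.

Lemma ini_ok : mode_ok ini_sw (fun m => m = 0) ini_vis ini_kk ini_inv.
Proof.
split=> //.
- by move=> sigma a; constructor 1.
- by move=> m b m' sigma s [-> -> -> S] R _; split.
- by move=> m sigma s s' ->.
- by move=> m b m' sigma a s s' [[-> -> ->]|[-> -> -> nD]|[-> -> -> D]] _ _; split.
Qed.

Hypothesis nD : ~ Div X [::].

Lemma ini_Div : Div ini_lts = Div L.
Proof.
apply/predeqP => sigma; split; last exact: (Div_mode _ _ ini_ok).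
move=> D; case: (mode_Div ini_ok D) => // -[m [s [[le _ H2] _ DX]]].
by case: m le H2 DX => [|[|[|//]]] _ H2 DX //; exact: H2.
Qed.

(** The part of [A] that [L] itself still has to refuse when [X] blocks all steps into a
    divergence. *)
Definition fill sigma (A : set Act) := A `&` [set a | ~ Div L (rcons sigma a)].

Lemma ini_nF sigma A : nF ini_lts (sigma, A) ->
  [/\ A `<=` alph L, ~ Div L sigma & Sf L (sigma, fill sigma A)].
Proof.
rewrite /nF /= ini_Div => -[/SfP[AL [[x [[sg s] m]] [R S F]]] nDs].
have [Esg RL RX [le H1 H2]] := mode_reach ini_ok R; subst sg; split=> //.
apply/SfP; split; first by move=> a [/AL].
case: m le H1 H2 R S F {RX} => [|[|[|//]]] _ H1 H2 R S F.
- case: (S (x, (sigma, s, 1))); apply: mode_step_sw; split=> //; exact: mode_stable S.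
- exists s; split=> //; first exact: H1.
  move=> a [Aa nDa] s' T; apply: (F _ Aa (x, (rcons sigma a, s', 0))).
  by apply: mode_step_vis T; constructor 2.
- by case: nDs; exact: H2.
Qed.

(** If stable states of [X] at the empty trace always offer [c], mode 1 cannot block the steps into
    a divergence. Conversely, a failure of [L] reappears in mode 1 next to a stable state of [X],
    which exists because [X] converges initially. *)
Lemma ini_nF_offers : alph X = [set c] -> ~ Sf X ([::], [set c]) -> nF ini_lts = nF L.
Proof.
move=> EX nS; apply/predeqP => -[sigma A]; split.
  rewrite /nF /= ini_Div => -[/SfP[AL [[x [[sg s] m]] [R S F]]] nDs]; split=> //.
  have [Esg RL RX [le H1 H2]] := mode_reach ini_ok R; subst sg.
  apply/SfP; split=> //.
  case: m le H1 H2 R S F RX => [|[|[|//]]] _ H1 H2 R S F RX.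
  - case: (S (x, (sigma, s, 1))); apply: mode_step_sw; split=> //; exact: mode_stable S.
  - exists s; split=> //; first exact: H1.
    move=> a Aa s' T; have [Da|nDa] := pselect (Div L (rcons sigma a)); last first.
      by apply: (F _ Aa (x, (rcons sigma a, s', 0))); apply: mode_step_vis T; constructor 2.
    have [y TX] : exists y, trans X x (Some c) y.
      apply: contrapT => H; apply: nS; apply/SfP; rewrite EX; split=> //.
      exists x; split=> //; first exact: mode_stable_X S.
      by move=> _ -> y Ty; apply: H; exists y.
    by apply: (F _ Aa (y, (rcons sigma a, s', 2))); apply: mode_sync_vis T TX; constructor 3.
  - by case: nDs; exact: H2.
move=> [/SfP[AL [s [R S F]]] nDs]; split; last by rewrite ini_Div.
have RX := reach_init X.
have [x [Rx Sx]] := conv_stable RX (Div_reach_conv nD RX).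
apply/SfP; split=> //; exists (x, (sigma, s, 1)); split.
- apply: (@reach_tau _ ini_lts _ (x, (sigma, s, 0))); last exact: mode_step_sw.
  exact: (mode_lift_X ini_ok (k := 0)).
- by apply: stable_mode => // b m' [].
- by apply: refuses_mode => a b m' s' Aa _ T; case: (F a Aa s' T).
Qed.

Lemma nF_ini_refuses sigma A : Sf X ([::], [set c]) ->
  A `<=` alph L -> ~ Div L sigma -> Sf L (sigma, fill sigma A) -> nF ini_lts (sigma, A).
Proof.
move=> /SfP[_ [x [Rx Sx Fx]]] AL nDs /SfP[_ [s [R S F]]]; split; last by rewrite ini_Div.
apply/SfP; split=> //; exists (x, (sigma, s, 1)); split.
- apply: (@reach_tau _ ini_lts _ (x, (sigma, s, 0))); last exact: mode_step_sw.
  exact: (mode_lift_X ini_ok (k := 0)).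
- by apply: stable_mode => // b m' [].
- apply: refuses_mode => a b m' s' Aa [[//]|[_ _ _ nDa]|[_ -> _ Da]] T.
    by case: (F a _ s' T).
  by split=> //; exact: Fx.
Qed.

End Initial_refusal_mode.

Lemma cong_snF L L' : preserves cong (@minD Act) -> ~ preserves cong (@anF Act) ->
  alph L = alph L' -> snF L = snF L' -> Div L = Div L' -> Inf L = Inf L' -> cong L L'.
Proof.
move=> minDC /(separated congC)[M [M' [[sigma A] [C [S nE] nanF]]]] EA ES ED EI.
have [c _] := exists_act Act_infinite.
have EAM := alphC C.
(* Both sides have the same [extT], so the difference in [anF] is a stable failure at a trace none
   of whose prefixes diverges, as the initial probe demands. *)
have EE : extT M = extT M' by rewrite /extT (minDC _ _ C) EAM.
have nS : ~ Sf M' (sigma, A) by move=> S'; apply: nanF; split; rewrite -?EE.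
have al : List.Forall (alph M) sigma.
  by case/SfP: (S) => _ [s [R _ _]]; exact: reach_alph R.
have nD i : ~ Div M (take i sigma).
  move=> D; apply: nE; apply/extTP; split=> //.
  by exists (take i sigma), (drop i sigma); rewrite cat_take_drop.
have nD' i : ~ Div M' (take i sigma).
  move=> D; apply: nE; rewrite EE; apply/extTP; split; first by rewrite -EAM.
  by exists (take i sigma), (drop i sigma); rewrite cat_take_drop.
have [X [X' [CX [EX EX'] [SX nSX'] [DX DX']]]] := distinguish_anF Act_infinite congC c C EAM S nS
  (fun i _ => nD i) (fun i _ => nD' i).
have step N : cong N (ini_lts c X N).
  apply: (congr_trans congC) (_ : cong N (ini_lts c X' N)) _.
    by apply: cong_nF; rewrite // ?(mode_Inf _ _ (ini_ok N)) ?ini_Div ?ini_nF_offers.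
  by apply: cong_mode_lts => //; exact: (congr_sym congC).
apply: (congr_trans congC (step L)); apply: (congr_sym congC).
apply: (congr_trans congC (step L')); apply: (congr_sym congC).
apply: cong_nF => //; rewrite ?(mode_Inf _ _ (ini_ok L)) ?(mode_Inf _ _ (ini_ok L')) ?ini_Div //.
suff G N N' tau B : alph N = alph N' -> snF N = snF N' -> Div N = Div N' ->
    nF (ini_lts c X N) (tau, B) -> nF (ini_lts c X N') (tau, B).
  by apply/predeqP => -[tau B]; split; apply: G.
move=> EA' ES' ED' /(ini_nF DX)[BN nDt Sf1]; apply: nF_ini_refuses => //.
- by rewrite -EA'.
- by rewrite -ED'.
(* No action of the reduced refusal leads into a divergence, so the failure belongs to [snF]: this
   is why [snF] determines all failures of the context. *)
- have : snF N (tau, fill N tau B) by split=> // a [].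
  rewrite ES' => -[[+ _] _]; by rewrite /fill ED'.
Qed.

(** * Arbitrary behaviour after divergence traces *)

Section Chaos.
Variables (c : Act) (X L : LTS Act).

(** [CWait] separates the [c] of the prefix from that of [X]. It is entered at a divergence trace
    and shows nothing visible, so an [X] that can never do its own [c] adds no visible behaviour. *)
Inductive chaos_state :=
| CLts of seq Act & state L
| CWait of seq Act
| CChaos of seq Act.

Inductive chaos_step : chaos_state -> option Act -> option Act -> chaos_state -> Prop :=
| chaos_follow sigma s l s' : trans L s l s' ->
    chaos_step (CLts sigma s) None l (CLts (ext sigma l) s')
| chaos_start sigma s : Div L sigma -> chaos_step (CLts sigma s) (Some c) None (CWait sigma)
| chaos_release sigma : chaos_step (CWait sigma) (Some c) None (CChaos sigma)
| chaos_any sigma a : alph L a -> chaos_step (CChaos sigma) None (Some a) (CChaos (rcons sigma a)).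

Definition chaos_lts := trd (alph L) (CLts [::] (init L)) chaos_step (lts_prefix c X).
Local Notation N := chaos_lts.

Definition chaos_inv (o : seq Act) (x : option (state X)) (q : chaos_state) :=
  match q with
  | CLts sigma s => [/\ o = sigma, reach L sigma s & x = None]
  | CWait sigma => [/\ o = sigma, Div L sigma & reach (lts_prefix c X) [:: c] x]
  | CChaos sigma => [/\ o = sigma, div_prefix L sigma, List.Forall (alph L) sigma
                      & reach (lts_prefix c X) [:: c; c] x]
  end.

Lemma chaos_reach o x q : reach N o (x, q) -> chaos_inv o x q.
Proof.
move: o x q; apply: trd_inv => [|o x q x' I T|o x q a l x' q' I T St|o x q l q' I St].
- by split=> //; exact: reach_init.
- case: q I => [sg s|sg|sg] I; case: I.
  + by move=> _ _ E; rewrite E in T; inversion T.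
  + by move=> -> D R; split=> //; exact: reach_tau T.
  + by move=> -> D F R; split=> //; exact: reach_tau T.
- inversion St as [|sg s D|sg|]; subst; case: I => E I1 I2; subst.
  + by split=> //; apply: (@reach_vis _ (lts_prefix c X) [::] None c) T; exact: reach_init.
  + split=> //; [exact: Div_div_prefix|exact/Tr_alph/Div_Tr|].
    exact: (@reach_vis _ (lts_prefix c X) [:: c] x c) T.
- inversion St as [sg s ? s' T| | |sg a al]; subst; case: I => E I1 I2; subst.
  + by split=> //; exact: reach_step T.
  + move=> I3; split=> //; first exact: div_prefix_rcons.
    by rewrite -cats1; apply/List.Forall_app; split=> //; constructor.
Qed.

Lemma reach_chaos_lts sigma s : reach L sigma s -> reach N sigma (None, CLts sigma s).
Proof.
elim=> [|{}sigma s0 l {}s _ IH T]; first exact: reach_init.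
apply: reach_step IH _; apply: trd_free; last by constructor.
by case: l T => // a; exact: trans_alph.
Qed.

Lemma chaos_conv sigma s : ~ Div L sigma -> conv s -> conv (L := N) (None, CLts sigma s).
Proof.
move=> nD; elim=> {}s _ IH; constructor=> y [_ /= [[_ _ T]|[a _ St]|[Ex St]]].
- by inversion T.
- by inversion St.
- by case: y Ex St => y q /= -> St; inversion St as [? ? ? s' T| | |]; subst; exact: IH.
Qed.

Lemma chaos_Div sigma : Div N sigma -> Div L sigma \/ Tr X [:: c] /\ extT L sigma.
Proof.
move=> D; apply: contrapT => /not_orP[nD nT].
case/DivP: D => -[x q] [R D].
case: q R D => [sg s|sg|sg] /chaos_reach[Eo].
- move=> RL Ex; subst; apply/convP; exact: chaos_conv nD (Div_reach_conv nD RL).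
- by move=> D; subst.
- move=> P F R _; apply: nT; split; last by apply/extTP; subst.
  move: (lts_prefix_reach R); case: (x) => // s' [w [<-] R']; apply/TrP; by exists s'.
Qed.

Lemma Div_chaos_lts sigma : Div L sigma -> Div N sigma.
Proof.
move=> /DivP[s [R [p [p0 pP]]]]; apply/DivP; exists (None, CLts sigma s).
split; first exact: reach_chaos_lts.
exists (fun i => (None, CLts sigma (p i))); rewrite p0; split=> // i.
by apply: trd_free => //; exact: (@chaos_follow sigma (p i) None).
Qed.

Lemma reach_chaos rho pi x : Div L rho -> reach X [:: c] x -> List.Forall (alph L) (rho ++ pi) ->
  reach N (rho ++ pi) (Some x, CChaos (rho ++ pi)).
Proof.
move=> D RX; elim/last_ind: pi => [|pi a IH] F.
  rewrite cats0; case/DivP: (D) => s [R _].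
  have G w y : reach X w y -> (w = [::] -> reach N rho (Some y, CWait rho)) /\
      (w = [:: c] -> reach N rho (Some y, CChaos rho)).
    elim=> [|w0 y0 l y1 _ [IH1 IH2] T].
      split=> // _; apply: reach_tau (reach_chaos_lts R) _.
      by apply: (@trd_sync _ _ _ _ _ _ _ _ c) => //; constructor.
    split; case: l T => [a|] T /=.
    - by case: (w0).
    - by move=> /IH1 H; apply: reach_tau H _; apply: trd_tau; constructor.
    - case: w0 IH1 IH2 => [|b w0] IH1 _ /=; last by case: (w0).
      move=> [Ea]; subst a; apply: reach_tau (IH1 erefl) _.
      by apply: (@trd_sync _ _ _ _ _ _ _ _ c) => //; constructor.
    - by move=> /IH2 H; apply: reach_tau H _; apply: trd_tau; constructor.
  by case: (G _ _ RX) => _; apply.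
move: F; rewrite -rcons_cat -cats1 => /List.Forall_app[F1 F2].
rewrite cats1; apply: reach_vis (IH F1) _.
by inversion F2; subst; apply: trd_free => //; constructor.
Qed.

Lemma Div_chaos_all sigma : Div X [:: c] -> extT L sigma -> Div N sigma.
Proof.
move=> /DivP[x [RX [p [p0 pP]]]] /extTP[F [rho [pi [E D]]]]; subst sigma.
apply/DivP; exists (Some x, CChaos (rho ++ pi)); split; first exact: reach_chaos.
exists (fun i => (Some (p i), CChaos (rho ++ pi))); rewrite p0; split=> // i.
by apply: trd_tau; constructor; exact: pP.
Qed.

Lemma chaos_nF sigma A : nF N (sigma, A) ->
  nF L (sigma, A) \/ Tr X [:: c] /\ extT L sigma.
Proof.
case=> /SfP[AL [[x q] [R S F]]] /= nD.
have nDL : ~ Div L sigma by move/Div_chaos_lts.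
case: q R S F => [sg s|sg|sg] /chaos_reach[Eo]; subst.
- move=> RL -> S F; left; split=> //; apply/SfP; split=> //; exists s; split=> //.
    move=> s' T; apply: (S (None, CLts sg s')); apply: trd_free => //.
    exact: (@chaos_follow sg s None).
  move=> a Aa s' T; apply: (F a Aa (None, CLts (rcons sg a) s')); apply: trd_free.
    exact: trans_alph T.
  exact: (@chaos_follow sg s (Some a)).
- by [].
- move=> P FA R _ _; right; split; last by apply/extTP.
  move: (lts_prefix_reach R); case: (x) => // s' [w [<-] R']; apply/TrP; by exists s'.
Qed.

Lemma nF_chaos sigma A : Sf L (sigma, A) -> ~ Div N sigma -> nF N (sigma, A).
Proof.
move=> /SfP[AL [s [R S F]]] nD; split=> //; apply/SfP; split=> //.
exists (None, CLts sigma s); split; first exact: reach_chaos_lts.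
  move=> [y q] [_ /= [[_ _ T]|[a _ St]|[_ St]]]; first by inversion T.
    by inversion St; subst; apply: nD; exact: Div_chaos_lts.
  by inversion St as [? ? ? s' T| | |]; subst; exact: S T.
move=> a Aa [y q] [_ /= [[//]|[b _ St]|[_ St]]]; first by inversion St.
by inversion St as [? ? ? s' T| | |]; subst; exact: F T.
Qed.

Lemma Inf_chaos xi : Inf L xi -> Inf N xi.
Proof.
move=> /InfP[p [v [p0 v0 S U]]].
apply: (@inf_map _ N xi (fun t => (None, CLts (mkseq xi (v t)) (p t))) v 0).
- by rewrite v0 p0; exact: reach_init.
- move=> t _; case: (S t) => -[-> T]; [left|right]; split=> //.
    by apply: taus1; apply: trd_free => //; exact: (@chaos_follow _ (p t) None).
  rewrite mkseqS; apply: trd_free; first exact: trans_alph T.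
  exact: (@chaos_follow _ (p t) (Some _)).
- by move=> n; have [t nt] := U n; exists t.
Qed.

Lemma Inf_chaos_all xi : Tr X [:: c] -> extI L xi -> Inf N xi.
Proof.
move=> /TrP[x RX] [al [i [D _]]].
have F n : List.Forall (alph L) (mkseq xi n).
  elim: n => [|n IH]; first by constructor.
  by rewrite mkseqS -cats1; apply/List.Forall_app; split=> //; constructor.
apply: (@inf_coind_at _ N xi (fun n y => y = (Some x, CChaos (mkseq xi n))) i
  (Some x, CChaos (mkseq xi i))) => //.
  by rewrite -[mkseq xi i]cats0; apply: reach_chaos; rewrite ?cats0.
move=> n _ ->; eexists; split; last reflexivity.
eexists; split; first exact: taus_refl.
by rewrite mkseqS; apply: trd_free => //; constructor.
Qed.

Lemma chaos_lts_proj x sigma s l y sigma' s' :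
  trans N (x, CLts sigma s) l (y, CLts sigma' s') ->
  if l is Some a then trans L s (Some a) s' else taus s s'.
Proof.
case=> _ /= [[-> [_ ->] _]|[a _ St]|[_ St]]; first exact: taus_refl.
  by inversion St.
by inversion St as [? ? ? ? T| | |]; subst; case: (l) T => // T; exact: taus1.
Qed.

Lemma chaos_Inf xi : Inf N xi -> Inf L xi \/ Tr X [:: c] /\ extI L xi.
Proof.
move=> I; have al i : alph L (xi i) := Inf_alph i I.
move: I => /InfP[p [v R]]; have RR := irun_reach R; have [p0 v0 S U] := R.
have T t : exists l, trans N (p t) l (p t.+1).
  by case: (S t) => -[_ H]; [exists None|exists (Some (xi (v t)))].
(* A run that never waits stays in the copy of [L] and projects to it. *)
have [[t0 [sg E0]]|nW] := pselect (exists t sg, (p t).2 = CWait sg); last first.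
  left; have AL t : exists sg s, (p t).2 = CLts sg s.
    elim: t => [|t [sg [s E]]]; first by rewrite p0; exists [::], (init L).
    case: (T t) => l [_ [[_ -> _]|[a _ St]|[_ St]]]; first by exists sg, s.
      rewrite E in St; inversion St; subst.
      by case: nW; exists t.+1, sg.
    move: St; rewrite E; move Eq : (p t.+1).2 => q' St.
    by inversion St; subst; eexists; eexists.
  pose f t := if (p t).2 is CLts _ s then s else init L.
  apply: (@inf_map _ L xi f v 0).
  - by rewrite /f v0 p0; exact: reach_init.
  - move=> t _; have [sg [s E]] := AL t; have [sg' [s' E']] := AL t.+1.
    rewrite /f E E'; case: (S t); rewrite (surjective_pairing (p t))
      (surjective_pairing (p t.+1)) E E' => -[-> /chaos_lts_proj H]; by [left|right].
  - by move=> n; have [t nt] := U n; exists t.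
have W t : t0 <= t -> (p t).2 = CWait sg \/ exists sg', (p t).2 = CChaos sg'.
  move=> le; rewrite -(subnKC le); elim: (t - t0) => [|d IH]; first by rewrite addn0; left.
  rewrite addnS; case: (T (t0 + d)) => l [_ +]; move: (p (t0 + d).+1).2 => q'.
  case=> [[_ -> _]|[a _ St]|[_ St]] //; case: IH => [E|[sg' E]];
    rewrite E in St; inversion St; subst; right; by eexists.
have PP t : reach N (mkseq xi (v t)) ((p t).1, (p t).2) by rewrite -surjective_pairing.
right; split; last first.
  apply/extIP; split=> //; exists (v t0); apply: Div_div_prefix.
  by have := PP t0; rewrite E0 => /chaos_reach[-> D _].
(* A waiting state shows no action, so a run with infinitely many actions has to leave it for chaos,
   which takes the [c] of [X]. *)
have [t [lt [sg' E]]] : exists t, t0 <= t /\ exists sg', (p t).2 = CChaos sg'.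
  apply: contrapT => H.
  have C d : v (t0 + d) = v t0.
    elim: d => [|d IH]; first by rewrite addn0.
    rewrite addnS -IH; case: (S (t0 + d)) => -[-> //] [_ St].
    have EW e : (p (t0 + e)).2 = CWait sg.
      by case: (W (t0 + e)) => [|//|H']; [lia|case: H; exists (t0 + e); split; [lia|]].
    have := EW d; have := EW d.+1; rewrite addnS => E1 E2; rewrite E1 E2 in St.
    by case: St => [[//]|[a _ St]|[_ St]]; inversion St.
  have [t nt] := U (v t0).+1; have [le|gt] := leqP t0 t.
    by have := C (t - t0); rewrite subnKC //; lia.
  by have := irun_mono R (ltnW gt); lia.
have := PP t; rewrite E => /chaos_reach[_ _ _ RX].
move: (lts_prefix_reach RX); case: (p t).1 => // s [w [<-] R']; apply/TrP; by exists s.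
Qed.

End Chaos.

Lemma add_traces L : ~ preserves cong (@Tr Act) -> exists L',
  [/\ cong L L', alph L' = alph L, Div L' = extT L, Inf L' = Inf L `|` extI L & nF L' = anF L].
Proof.
move=> /(separated congC)[M [M' [sigma [C T nT]]]].
have [c _] := exists_act Act_infinite.
have [X [X' [CX [EX EX'] DX _ nTX']]] := distinguish_Tr Act_infinite congC c C (alphC C) T nT.
exists (chaos_lts c X L); split=> //.
- apply: (congr_trans congC) (_ : cong L (chaos_lts c X' L)) _.
    have ED : Div L = Div (chaos_lts c X' L).
      apply/predeqP => tau; split; first exact: Div_chaos_lts.
      by case/chaos_Div => // -[].
    apply: cong_nF => //; apply/predeqP.
      move=> -[tau A]; split; last by case/chaos_nF => // -[].
      by case=> S nD; apply: nF_chaos => //; rewrite -ED.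
    by move=> xi; split; [exact: Inf_chaos|case/chaos_Inf => // -[]].
  apply: (trd_cong Act_infinite congC).
  + by apply: (cong_prefix congC); exact: (congr_sym congC).
  + by rewrite !alph_prefix1 ?EX ?EX'.
  + by left; rewrite alph_prefix1 ?EX' //; exact: countable1.
- apply/predeqP => tau; split; last exact: Div_chaos_all.
  by case/chaos_Div => [/extT_Div|[]].
- apply/predeqP => xi; split; first by case/chaos_Inf => [|[]]; [left|right].
  by case; [exact: Inf_chaos|exact/Inf_chaos_all/Div_Tr].
- apply/predeqP => -[tau A]; split.
    move=> H; have nE : ~ extT L tau by case: H => _ nD /(Div_chaos_all DX).
    by case/chaos_nF: H => [[S _]|[]].
  by case=> S nE; apply: nF_chaos => // /chaos_Div[/extT_Div|[]].
Qed.

(* Besides [L], this context can follow a word [xi] from a position [n] with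
   [Z xi n], consuming two [c]s of [Y] at every divergence prefix; [Y] has then
   done an even number of [c]s whenever a prefix of [xi] is not a divergence
   trace, and there the context may always fall back to [L]. *)
Section Word_context.
Variables (c : Act) (Y L : LTS Act) (Z : (nat -> Act) -> nat -> Prop).

(** In [WPath xi n i ph k], the path was entered at [n] and stands at position [i]; [Y] has done [k]
    actions in all, [ph] of them at the current position. *)
Inductive word_state :=
| WStart of seq Act & state L
| WPath of (nat -> Act) & nat & nat & nat & nat
| WBack of seq Act & state L.

Inductive word_step : word_state -> option Act -> option Act -> word_state -> Prop :=
| word_follow sigma s l s' : trans L s l s' ->
    word_step (WStart sigma s) None l (WStart (ext sigma l) s')
| word_enter xi n s : Z xi n ->
    word_step (WStart (mkseq xi n) s) (Some c) None (WPath xi n n 1 1)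
| word_c0 xi n i k : Div L (mkseq xi i) ->
    word_step (WPath xi n i 0 k) (Some c) None (WPath xi n i 1 k.+1)
| word_c1 xi n i k : word_step (WPath xi n i 1 k) (Some c) None (WPath xi n i 2 k.+1)
| word_go2 xi n i k : word_step (WPath xi n i 2 k) None (Some (xi i)) (WPath xi n i.+1 0 k)
| word_go0 xi n i k : ~ Div L (mkseq xi i) ->
    word_step (WPath xi n i 0 k) None (Some (xi i)) (WPath xi n i.+1 0 k)
| word_back xi n i k s : ~ Div L (mkseq xi i) -> reach L (mkseq xi i) s ->
    word_step (WPath xi n i 0 k) None None (WBack (mkseq xi i) s)
| word_back_follow sigma s l s' : trans L s l s' ->
    word_step (WBack sigma s) None l (WBack (ext sigma l) s').

Definition word_lts := trd (alph L) (WStart [::] (init L)) word_step Y.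
Local Notation N := word_lts.

Hypothesis Y_stable : stable (init Y).
Hypothesis Y_nil : ~ Div Y [::].
Hypothesis Z_Tr : forall xi n i, Z xi n -> Tr L (mkseq xi i).
Hypothesis Z_Div : forall xi n, Z xi n -> Div L (mkseq xi n).
Hypothesis Z_inf : forall xi n, Z xi n -> forall m, exists i, m <= i /\ Div L (mkseq xi i).
Hypothesis Y_even : forall k, Div Y (nseq k.*2 c) ->
  forall xi n i, Z xi n -> n <= i -> Div L (mkseq xi i).

(** The last clause for a path bounds the number of divergence prefixes passed: those before [n] by
    [n], the later ones by the number of [c]s. Staying on a path forever thus drives [Y] through
    infinitely many [c]s. *)
Definition word_inv (o : seq Act) (y : state Y) (q : word_state) :=
  match q with
  | WStart sigma s => [/\ o = sigma, reach L sigma s & reach Y [::] y]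
  | WPath xi n i ph k =>
    [/\ o = mkseq xi i, Z xi n /\ n <= i, reach Y (nseq k c) y,
        [/\ odd k = (ph == 1), ph < 3 & 0 < ph -> Div L (mkseq xi i)]
      & cnt (fun j => Div L (mkseq xi j)) i + (ph == 2) <= n + k]
  | WBack sigma s => [/\ o = sigma, reach L sigma s &
      exists k xi n i, [/\ reach Y (nseq k.*2 c) y, Z xi n, n <= i & ~ Div L (mkseq xi i)]]
  end.

Lemma rcons_nseq k : rcons (nseq k c) c = nseq k.+1 c.
Proof. by elim: k => //= k ->. Qed.

Lemma word_reach o y q : reach N o (y, q) -> word_inv o y q.
Proof.
move: o y q; apply: trd_inv => [|o y q y' I T|o y q a l y' q' I T St|o y q l q' I St].
- by split=> //; exact: reach_init.
- case: q I => [sg s|xi n i ph k|sg s] /=.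
  + by case=> -> R RY; split=> //; exact: reach_tau T.
  + by case=> -> ZZ RY H1 H2; split=> //; exact: reach_tau T.
  + case=> -> R [k [xi [n [i [RY ZZ le nD]]]]]; split=> //; exists k, xi, n, i.
    by split=> //; exact: reach_tau T.
- inversion St as [|xi n s ZZ|xi n i k D|xi n i k| | | |]; subst.
  + case: I => Eo RL RY; split=> //.
    * exact: (@reach_vis _ Y [::] y c).
    * by split=> // _; exact: Z_Div.
    * by rewrite addn0; have := cnt_le (fun j => Div L (mkseq xi j)) n; lia.
  + case: I => Eo ZZ RY [od _ _] le; split=> //.
    * by rewrite -rcons_nseq; exact: reach_vis T.
    * by split; [rewrite /= od|by []|by []].
    * by move: le => /=; lia.
  + case: I => Eo ZZ RY [od _ D] le; split=> //.
    * by rewrite -rcons_nseq; exact: reach_vis T.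
    * by split; [rewrite /= od|by []|move=> _; exact: D].
    * by move: le => /=; lia.
- inversion St as [sg s ? s' T| | | |xi n i k|xi n i k nD|xi n i k s nD R|sg s ? s' T]; subst.
  + by case: I => Eo RL RY; split=> //; [rewrite Eo|exact: reach_step T].
  + case: I => Eo [ZZ le] RY [od _ D] lc; split=> //.
    * by rewrite /= mkseqS Eo.
    * by split=> //; lia.
    * by move: lc; rewrite cntS (asboolT (D erefl)) /= addn0.
  + case: I => Eo [ZZ le] RY [od _ D] lc; split=> //.
    * by rewrite /= mkseqS Eo.
    * by split=> //; lia.
    * by move: lc; rewrite cntS (asboolF nD) /= !addn0.
  + case: I => Eo [ZZ le] RY [od _ D] lc; split=> //.
    exists k./2, xi, n, i; split=> //.
    by have := odd_double_half k; rewrite od add0n => ->.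
  + case: I => Eo RL H; split=> //; first by rewrite Eo.
    exact: reach_step T.
Qed.

Lemma reach_word sigma s : reach L sigma s -> reach N sigma (init Y, WStart sigma s).
Proof.
elim=> [|{}sigma s0 l {}s _ IH T]; first exact: reach_init.
apply: reach_step IH _; apply: trd_free; last by constructor.
by case: l T => // a; exact: trans_alph.
Qed.

(** At a trace outside [Div L] a path is in phase 0, so [Y] has done an even number of [c]s and
    converges by [Y_even]. The only silent move of the context there is the fallback to [L], which
    lowers the rank. *)
Lemma word_Div : Div N = Div L.
Proof.
apply/predeqP => sigma; split=> [D|/DivP[s [R [p [p0 pP]]]]]; last first.
  apply/DivP; exists (init Y, WStart sigma s); split; first exact: reach_word.
  exists (fun i => (init Y, WStart sigma (p i))); rewrite p0; split=> // i.
  by apply: trd_free => //; exact: (@word_follow sigma (p i) None).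
apply: contrapT => nD; move: D => /DivP[x [R D]]; move: D; apply/convP.
pose fB (y : state N) := match y.2 with WPath _ _ _ _ _ => None
  | WStart _ s => Some s | WBack _ s => Some s end.
pose rk (y : state N) := if y.2 is WPath _ _ _ _ _ then 1 else 0.
pose RB (u w : option (state L)) :=
  if (u, w) is (Some s', Some s) then trans L s None s' else False.
have AccB s : conv s -> Acc RB (Some s).
  by elim=> {}s _ IH; constructor=> -[s'|//] T; exact: IH.
have even y k xi n i : reach Y (nseq k c) y -> ~~ odd k -> Z xi n -> n <= i ->
    ~ Div L (mkseq xi i) -> conv y.
  move=> Ry ok ZZ le nDi; apply/convP => Dy; apply: nDi; apply: (@Y_even k./2) ZZ le.
  by rewrite even_halfK //; apply/DivP; exists y.
apply: (@conv_lex _ N _ _ (fun z y => trans Y y None z) RB (fun y => reach N sigma y) rk fst fB);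
  last exact: R.
  move=> [y [sg s|xi n i ph k|sg s]] /word_reach.
  - move=> [Eo RL RY]; subst sg; split; last exact/AccB/(Div_reach_conv nD).
    exact: Div_reach_conv Y_nil RY.
  - move=> [Eo [ZZ le] RY [od lt D] _]; split; last by constructor=> -[].
    have nDi : ~ Div L (mkseq xi i) by rewrite -Eo.
    apply: (even _ _ _ _ _ RY _ ZZ le nDi); rewrite od; apply/negP => /eqP E.
    by apply: nDi; apply: D; rewrite E.
  - move=> [Eo RL [k [xi [n [i [RY ZZ le nDi]]]]]]; subst sg.
    split; last exact/AccB/(Div_reach_conv nD).
    by apply: (even _ _ _ _ _ RY _ ZZ le nDi); rewrite odd_double.
move=> [y q] [y' q'] R1 T; split; first exact: reach_tau T.
have I := word_reach R1.
case: T => _ /= [[_ -> T]|[a _ St]|[Ey St]]; first by right; split=> //; left.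
  inversion St as [|xi n s ZZ|xi n i k D|xi n i k| | | |]; subst; case: I => Eo.
  - by move=> _ _; case: nD; rewrite Eo; exact: Z_Div.
  - by move=> _ _ _ _; case: nD; rewrite Eo.
  - by move=> _ _ [_ _ D] _; case: nD; rewrite Eo; exact: D.
subst y'; inversion St as [sg s ? s' T| | | | | |xi n i k s nDi Rs|sg s ? s' T]; subst.
- by right; split=> //; right.
- by left.
- by right; split=> //; right.
Qed.

(** At a trace outside [Div L] a path always has a silent fallback and is not stable, so every
    failure there comes from a copy of [L]. *)
Lemma word_nF : nF N = nF L.
Proof.
apply/predeqP => -[sigma A]; rewrite /nF /= word_Div; split.
  case=> /SfP[AL [[y q] [R S F]]] nD; split=> //; apply/SfP; split=> //.
  case: q R S F => [sg s|xi n i ph k|sg s] /word_reach.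
  - case=> -> RL _ S F; exists s; split=> //.
      move=> s' T; apply: (S (y, WStart sg s')); apply: trd_free => //.
      exact: (@word_follow sg s None).
    move=> a Aa s' T; apply: (F a Aa (y, WStart (rcons sg a) s')); apply: trd_free.
      exact: trans_alph T.
    exact: (@word_follow sg s (Some a)).
  - case=> Eo [ZZ le] RY [_ _ D] _ S _.
    have nDi : ~ Div L (mkseq xi i) by rewrite -Eo.
    have ph0 : ph = 0 by case: ph D {S} => // ph /(_ erefl).
    have /TrP[s Rs] := Z_Tr i ZZ.
    by case: (S (y, WBack (mkseq xi i) s)); rewrite ph0; apply: trd_free => //; constructor.
  - case=> -> RL _ S F; exists s; split=> //.
      move=> s' T; apply: (S (y, WBack sg s')); apply: trd_free => //.
      exact: (@word_back_follow sg s None).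
    move=> a Aa s' T; apply: (F a Aa (y, WBack (rcons sg a) s')); apply: trd_free.
      exact: trans_alph T.
    exact: (@word_back_follow sg s (Some a)).
case=> /SfP[AL [s [R S F]]] nD; split=> //; apply/SfP; split=> //.
exists (init Y, WStart sigma s); split; first exact: reach_word.
  move=> [y q] [_ /= [[_ _ T]|[a _ St]|[_ St]]]; first exact: Y_stable T.
    by inversion St; subst; apply: nD; exact: Z_Div.
  by inversion St as [? ? ? s' T| | | | | | |]; subst; exact: S T.
move=> a Aa [y q] [_ /= [[//]|[b _ St]|[_ St]]]; first by inversion St.
by inversion St as [? ? ? s' T| | | | | | |]; subst; exact: F T.
Qed.

Lemma Inf_word xi : Inf L xi -> Inf N xi.
Proof.
move=> /InfP[p [v [p0 v0 S U]]].
apply: (@inf_map _ N xi (fun t => (init Y, WStart (mkseq xi (v t)) (p t))) v 0).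
- by rewrite v0 p0; exact: reach_init.
- move=> t _; case: (S t) => -[-> T]; [left|right]; split=> //.
    by apply: taus1; apply: trd_free => //; exact: (@word_follow _ (p t) None).
  rewrite mkseqS; apply: trd_free; first exact: trans_alph T.
  exact: (@word_follow _ (p t) (Some _)).
- by move=> n; have [t nt] := U n; exists t.
Qed.

Lemma Inf_word_path xi n : Inf Y (fun=> c) -> Z xi n -> Inf N xi.
Proof.
move=> /InfP[p [v R]] ZZ; have adv := irun_adv R; have [p0 v0 _ _] := R.
have lift y y' q : taus y y' -> taus (L := N) (y, q) (y', q).
  by case=> m; elim=> {m y y'} [y|m y y' y'' T _ IH]; [exact: taus_refl|
    apply: taus_trans IH; apply: taus1; exact: trd_tau].
have sync t0 q q' : word_step q (Some c) None q' ->
    exists t1, v t1 = (v t0).+1 /\ taus (L := N) (p t0, q) (p t1, q').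
  move=> St; have [t1 [E [y1 [T1 T]]]] := adv t0; exists t1; split=> //.
  by apply: taus_trans (lift _ _ _ T1) _; apply: taus1; apply: trd_sync T St.
have out m : alph L (xi m).
  by have := Tr_alph (Z_Tr m.+1 ZZ); move/Forall_mkseq; apply.
(* Phase 1 occurs at the entry position, where the first [c] has been taken already; every later
   position starts in phase 0. *)
pose W m (x : state N) := n <= m /\ exists t ph, x = (p t, WPath xi n m ph (v t)) /\
  (ph = 0 \/ ph = 1 /\ Div L (mkseq xi m)).
have from1 m t : n <= m ->
    exists y, wstep (L := N) (p t, WPath xi n m 1 (v t)) (xi m) y /\ W m.+1 y.
  move=> le; have [t1 [E T]] := sync t _ _ (word_c1 xi n m (v t)).
  exists (p t1, WPath xi n m.+1 0 (v t1)); split; last first.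
    by split; [lia|exists t1, 0; split=> //; left].
  exists (p t1, WPath xi n m 2 (v t).+1); split=> //; apply: trd_free; first exact: out.
  by rewrite E; constructor.
have /DivP[s [Rs _]] := Z_Div ZZ.
have [t1 [E1 T1]] := sync 0 _ _ (word_enter s ZZ).
have R1 : reach N (mkseq xi n) (p t1, WPath xi n n 1 1).
  have : reach N (mkseq xi n) (p 0, WStart (mkseq xi n) s) by rewrite p0; exact: reach_word.
  case: T1 => m; move: (p 0, _) (p t1, _) => x x'.
  elim=> {x x'} // m' x x' x'' T _ IH H; apply: IH; exact: reach_tau T.
apply: (inf_coind_at R1 (Z := W)).
  split=> //; exists t1, 1; split; first by rewrite E1 v0.
  by right; split=> //; exact: Z_Div.
move=> m _ [le [t [ph [-> [->|[-> D]]]]]]; last exact: from1.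
have [D|nD] := pselect (Div L (mkseq xi m)).
  have [t2 [E T]] := sync t _ _ (word_c0 n (v t) D).
  have [y [W1 W2]] := from1 m t2 le; exists y; split=> //.
  by apply: taus_wstep T _; rewrite -E.
exists (p t, WPath xi n m.+1 0 (v t)); split; last first.
  by split; [lia|exists t, 0; split=> //; left].
exists (p t, WPath xi n m 0 (v t)); split; first exact: taus_refl.
by apply: trd_free; [exact: out|constructor].
Qed.

Definition word_L (q : word_state) :=
  match q with WStart _ s => s | WBack _ s => s | WPath _ _ _ _ _ => init L end.

Lemma word_follow_proj x l x' : trans N x l x' ->
  (exists sg s, x.2 = WBack sg s) \/
  (exists sg s, x.2 = WStart sg s) /\ (exists sg s, x'.2 = WStart sg s) ->
  if l is Some a then trans L (word_L x.2) (Some a) (word_L x'.2)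
  else taus (word_L x.2) (word_L x'.2).
Proof.
case: x x' => [y q] [y' q'] [_ /= T] [[sg [s E]]|[[sg [s E]] [sg' [s' E']]]]; subst;
  case: T => [[-> E _]|[a _ St]|[_ St]]; rewrite ?E; try exact: taus_refl;
  inversion St as [? ? ? s2 T| | | | | | |? ? ? s2 T]; subst => //=;
  by case: (l) T => // T; exact: taus1.
Qed.

Lemma word_Inf xi : Inf N xi -> Inf L xi \/ Inf Y (fun=> c) /\ exists n, Z xi n.
Proof.
move=> /InfP[p [v R]]; have RR := irun_reach R; have [p0 v0 S U] := R.
have RI t : word_inv (mkseq xi (v t)) (p t).1 (p t).2.
  by apply: word_reach; rewrite -surjective_pairing.
have T t : exists l, trans N (p t) l (p t.+1).
  by case: (S t) => -[_ H]; [exists None|exists (Some (xi (v t)))].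
have U' t0 m : exists t, t0 <= t /\ m <= v t.
  have [t mt] := U m; exists (maxn t0 t); split; first by lia.
  by apply: leq_trans mt _; apply: (irun_mono R); lia.
have [[t0 [sg [s E0]]]|nB] := pselect (exists t sg s, (p t).2 = WBack sg s).
  left; have B t : t0 <= t -> exists sg s, (p t).2 = WBack sg s.
    move=> le; rewrite -(subnKC le); elim: (t - t0) => [|d [sg1 [s1 IH]]].
      by rewrite addn0; exists sg, s.
    rewrite addnS; case: (T (t0 + d)) => l [_ +]; move: (p (t0 + d).+1).2 => q'; rewrite IH.
    case=> [[_ -> _]|[a _ St]|[_ St]]; first by exists sg1, s1.
      by inversion St.
    by inversion St; subst; eexists; eexists.
  apply: (@inf_map _ L xi (fun t => word_L (p t).2) v t0).
  - by have := RI t0; rewrite E0 => -[<-].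
  - move=> t le; have [sg1 [s1 E1]] := B t le.
    have H1 : exists sg s, (p t).2 = WBack sg s by exists sg1, s1.
    by case: (S t) => -[-> /word_follow_proj H]; [left|right]; split=> //; apply: H; left.
  - exact: U'.
have [[t0 [z [n [i [ph [k E0]]]]]]|nP] :=
    pselect (exists t z n i ph k, (p t).2 = WPath z n i ph k); last first.
  left; have A t : exists sg s, (p t).2 = WStart sg s.
    case E: (p t).2 => [sg s|z n i ph k|sg s]; first by exists sg, s.
      by case: nP; exists t, z, n, i, ph, k.
    by case: nB; exists t, sg, s.
  apply: (@inf_map _ L xi (fun t => word_L (p t).2) v 0).
  - by rewrite v0 p0; exact: reach_init.
  - move=> t le; have A0 := A t; have A1 := A t.+1.
    by case: (S t) => -[-> /word_follow_proj H]; [left|right]; split=> //; apply: H; right.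
  - exact: U'.
right; have P t : t0 <= t -> exists i ph k, (p t).2 = WPath z n i ph k.
  move=> le; rewrite -(subnKC le); elim: (t - t0) => [|d [i1 [ph1 [k1 IH]]]].
    by rewrite addn0; exists i, ph, k.
  rewrite addnS; case: (T (t0 + d)) => l [_ +]; move Eq : (p (t0 + d).+1).2 => q'; rewrite IH.
  case=> [[_ -> _]|[a _ St]|[_ St]]; first by exists i1, ph1, k1.
    by inversion St; subst; do 3 eexists.
  inversion St; subst; try by do 3 eexists.
  by case: nB; exists (t0 + d).+1; do 2 eexists; symmetry; eassumption.
have ZZ : Z z n by have := RI t0; rewrite E0 => -[_ []].
split; last first.
  (* The trace on the path is always a prefix of [z], and it becomes arbitrarily long. *)
  exists n; suff -> : xi = z by [].
  apply/funext => j; have [t [le jt]] := U' t0 j.+1.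
  have := RI t; have [i1 [ph1 [k1 ->]]] := P t le => -[Eo _ _ _ _].
  have Ei : v t = i1 by have := congr1 size Eo; rewrite !size_mkseq.
  by subst i1; have := congr1 (nth (xi 0)^~ j) Eo; rewrite !nth_mkseq.
pose kc t := if (p t).2 is WPath _ _ _ _ k then k else 0.
apply: (@inf_map _ Y (fun=> c) (fun t => (p t).1) kc t0).
- by rewrite mkseq_const /kc E0; have := RI t0; rewrite E0 => -[].
- move=> t le; have [i1 [ph1 [k1 E1]]] := P t le; have [i2 [ph2 [k2 E2]]] := P t.+1 (leqW le).
  rewrite /kc E1 E2; case: (T t) => l [_]; rewrite E1 E2.
  case=> [[_ [_ _ ->] H]|[a H St]|[-> St]].
  + by left; split=> //; exact: taus1.
  + by right; inversion St; subst.
  + by left; split; [inversion St|exact: taus_refl].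
(* Infinitely many prefixes of [z] diverge; after [n + m] of them the invariant has charged at least
   [m] actions to [Y]. *)
- move=> m; have [i0 le0] := cnt_unbounded (Z_inf ZZ) (n + m).
  have [t [le lei]] := U' t0 i0; exists t; split=> //.
  have := RI t; have [i1 [ph1 [k1 E1]]] := P t le; rewrite /kc E1 => -[Eo _ _ _ lc].
  have Ei : v t = i1 by have := congr1 size Eo; rewrite !size_mkseq.
  by subst i1; have := cnt_mono (fun j => Div L (mkseq z j)) lei; lia.
Qed.

End Word_context.

Lemma add_Inf L c X X' (Z : (nat -> Act) -> nat -> Prop) :
  cong X X' -> alph X = [set c] -> alph X' = [set c] ->
  Inf X (fun=> c) -> ~ Inf X' (fun=> c) ->
  (forall xi n i, Z xi n -> Tr L (mkseq xi i)) ->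
  (forall xi n, Z xi n -> Div L (mkseq xi n)) ->
  (forall xi n, Z xi n -> forall m, exists i, m <= i /\ Div L (mkseq xi i)) ->
  (forall k, Div X (nseq k.*2.+1 c) \/ Div X' (nseq k.*2.+1 c) ->
    forall xi n i, Z xi n -> n <= i -> Div L (mkseq xi i)) ->
  exists L', [/\ cong L L', alph L' = alph L, Div L' = Div L,
    Inf L' = Inf L `|` [set xi | exists n, Z xi n] & nF L' = nF L].
Proof.
move=> CX EX EX' I nI ZT ZD ZI H.
pose G Y := word_lts c (lts_prefix c Y) L Z.
(* A positive even number of [c]s of the prefixed LTS is an odd number of [c]s of [Y] itself: this
   is the parity that the count probe controls. *)
have ev Y : (forall k, Div Y (nseq k.*2.+1 c) ->
      forall xi n i, Z xi n -> n <= i -> Div L (mkseq xi i)) ->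
    forall k, Div (lts_prefix c Y) (nseq k.*2 c) ->
    forall xi n i, Z xi n -> n <= i -> Div L (mkseq xi i).
  move=> HY [|k] D; first by case: (Div_prefix_nil D).
  by apply: (HY k); exact: (proj1 (Div_prefix _ _ _) D).
have evX := ev X (fun k D => H k (or_introl D)).
have evX' := ev X' (fun k D => H k (or_intror D)).
have st Y : stable (init (lts_prefix c Y)) by exact: prefix_init_stable.
have ni Y := @Div_prefix_nil _ c Y.
exists (G X); split=> //.
- apply: (congr_trans congC) (_ : cong L (G X')) _.
    apply: cong_nF => //; [exact/esym/(word_nF (st _) (ni _) ZT ZD evX')|
      exact/esym/(word_Div (ni _) ZD evX')|].
    apply/predeqP => xi; split; first exact: Inf_word.
    by move=> H1; case: (word_Inf ZD ZI H1) => // -[H2 _]; case: nI; exact: prefix_Inf H2.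
  apply: (trd_cong Act_infinite congC).
  + by apply: (cong_prefix congC); exact: (congr_sym congC).
  + by rewrite !alph_prefix1 ?EX ?EX'.
  + by left; rewrite alph_prefix1 ?EX' //; exact: countable1.
- exact: (word_Div (ni _) ZD evX).
- apply/predeqP => xi; split.
    by move=> H1; case: (word_Inf ZD ZI H1) => [|[_]]; [left|right].
  case=> [|[n ZZ]]; first exact: Inf_word.
  exact: (Inf_word_path ZT ZD (Inf_prefix I) ZZ).
- exact: (word_nF (st _) (ni _) ZT ZD evX).
Qed.

Lemma Tr_mkseq_le L xi i j : Tr L (mkseq xi j) -> i <= j -> Tr L (mkseq xi i).
Proof.
move=> /TrP[s R] le; apply/TrP; apply: (@reach_prefix _ _ s _ (drop i (mkseq xi j))).
have -> : mkseq xi i = take i (mkseq xi j) by rewrite /mkseq -map_take take_iota (minn_idPl le).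
by rewrite cat_take_drop.
Qed.

Lemma add_Inf_eventually L : ~ preserves cong (@Inf Act) -> exists L',
  [/\ cong L L', alph L' = alph L, Div L' = Div L,
    Inf L' = Inf L `|` [set xi | exists n, forall i, n <= i -> Div L (mkseq xi i)]
    & nF L' = nF L].
Proof.
move=> /(separated congC)[M [M' [xi [C I nI]]]].
have [c _] := exists_act Act_infinite.
(* The probe may show [c] at every position: from [n] on, all prefixes of the added words are
   divergence traces, where a divergence of [X] or [X'] goes unnoticed. *)
have [|X [X' [CX [EX EX'] [IX nIX'] _]]] :=
  distinguish_Inf Act_infinite congC c (P := fun=> True) C (alphC C) I nI.
  by move=> n; exists n.
apply: (@add_Inf L c X X' (fun xi n => forall i, n <= i -> Div L (mkseq xi i))) => //.
- move=> z n i H; apply: (@Tr_mkseq_le _ _ _ (n + i)); last by lia.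
  by apply: Div_Tr; apply: H; lia.
- by move=> z n; apply.
- by move=> z n H m; exists (n + m); split; [lia|apply: H; lia].
- by move=> k _ z n i; apply.
Qed.

Lemma add_Inf_often L : preserves cong (@Div Act) -> ~ preserves cong (@aenI Act) -> exists L',
  [/\ cong L L', alph L' = alph L, Div L' = Div L,
    Inf L' = Inf L `|` [set xi | (forall i, Tr L (mkseq xi i)) /\
                                 forall m, exists i, m <= i /\ Div L (mkseq xi i)]
    & nF L' = nF L].
Proof.
move=> DivC /(separated congC)[M [M' [xi [C [I H] nI]]]].
have [c _] := exists_act Act_infinite; have ED := DivC _ _ C.
have nI' : ~ Inf M' xi.
  by move=> I'; apply: nI; split=> // n; have [i [le nD]] := H n; exists i; rewrite -ED.
(* Showing [c] only at prefixes outside [Div M], of which [aenI] provides infinitely many, excludes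
   every divergence after an odd power of [c]. This is required here because the added words may
   return to prefixes outside [Div L]. *)
have [X [X' [CX [EX EX'] [IX nIX'] HD]]] :=
  distinguish_Inf Act_infinite congC c (P := fun i => ~ Div M (mkseq xi i)) C (alphC C) I nI' H.
have [||||L' [CL EA EDL EI EF]] := @add_Inf L c X X' (fun z n => [/\ forall i, Tr L (mkseq z i),
    forall m, exists i, m <= i /\ Div L (mkseq z i) & Div L (mkseq z n)]) CX EX EX' IX nIX'.
- by move=> z n i [].
- by move=> z n [].
- by move=> z n [].
- by move=> k /HD[i [nD]]; rewrite -ED => -[].
exists L'; split=> //; rewrite EI; congr (_ `|` _); apply/predeqP => z; split.
  by case=> n [].
by case=> T O; have [n [_ D]] := O 0; exists n.
Qed.

End Extensions.

(** * The induced equivalences *)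

Section Final.
Variables (Act : Type) (Act_infinite : infinite_set [set: Act]).
Variables (cong : LTS Act -> LTS Act -> Prop) (congC : congruence cong).
Implicit Types (L M : LTS Act) (sigma : seq Act).

Lemma Tr_preserved_of_Inf : preserves cong (@alph Act) -> preserves cong (@Inf Act) ->
  preserves cong (@Tr Act).
Proof.
move=> alphC InfC; apply: contrapT => /(separated congC)[M [M' [sigma [C T nT]]]].
have [c _] := exists_act Act_infinite.
have [X [X' [CX _ _ IX nTX']]] := distinguish_Tr Act_infinite congC c C (alphC _ _ C) T nT.
by apply: nTX'; rewrite (InfC _ _ CX) in IX; exact: (Inf_Tr 1 IX).
Qed.

Lemma Tr_preserved_of_Div : preserves cong (@alph Act) -> preserves cong (@Div Act) ->
  preserves cong (@Tr Act).
Proof.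
move=> alphC DivC; apply: contrapT => /(separated congC)[M [M' [sigma [C T nT]]]].
have [c _] := exists_act Act_infinite.
have [X [X' [CX _ DX _ nTX']]] := distinguish_Tr Act_infinite congC c C (alphC _ _ C) T nT.
by apply: nTX'; rewrite (DivC _ _ CX) in DX; exact: Div_Tr.
Qed.

(** For an infinite trace outside [extI] no prefix diverges, so all of it can be hidden ([n] is 0).
    The difference becomes a divergence at the empty trace, where [Div] and [minD] coincide. *)
Lemma anI_preserved : preserves cong (@alph Act) -> preserves cong (@minD Act) ->
  preserves cong (@anI Act).
Proof.
move=> alphC minDC; apply: contrapT => /(separated congC)[M [M' [xi [C [I nE] nA]]]].
have EE : extI M = extI M' by rewrite /extI (minDC _ _ C) (alphC _ _ C).
have nI : ~ Inf M' xi by move=> I'; apply: nA; split; rewrite -?EE.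
have [|X [X' [CX DX nDX']]] :=
  distinguish_Inf_tail Act_infinite congC C (alphC _ _ C) I nI (n := 0).
  move=> i _ D; apply: nE; rewrite EE; apply/extIP; split.
    by move=> j; rewrite -(alphC _ _ C); exact: Inf_alph.
  by exists i; exact: Div_div_prefix.
have : minD X [::] by split.
by rewrite (minDC _ _ CX) => -[].
Qed.

(** Only the tail of [xi] is hidden, from a position after which no prefix is a divergence trace;
    [Div] then sees the difference. *)
Lemma eanI_preserved : preserves cong (@alph Act) -> preserves cong (@Div Act) ->
  preserves cong (@eanI Act).
Proof.
move=> alphC DivC; apply: contrapT => /(separated congC)[M [M' [xi [C [I [n nD]] nA]]]].
rewrite (DivC _ _ C) in nD.
have nI : ~ Inf M' xi by move=> I'; apply: nA; split=> //; exists n.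
have [X [X' [CX DX nDX']]] := distinguish_Inf_tail Act_infinite congC C (alphC _ _ C) I nI nD.
by rewrite (DivC _ _ CX) in DX.
Qed.

Lemma extT_rcons L sigma a : ~ extT L sigma -> extT L (rcons sigma a) -> minD L (rcons sigma a).
Proof.
move=> nE [F [i [le D]]].
have [lt|ge] := ltnP i (size (rcons sigma a)); last by rewrite take_oversize in D.
rewrite size_rcons ltnS in lt; case: nE; split.
  by move: F; rewrite -cats1 => /List.Forall_app[].
by exists i; split=> //; move: D; rewrite -cats1 takel_cat.
Qed.

(** Outside [extT L], one further action enters [extT L] only by completing a minimal divergence
    trace. There every choice of [Div L1] between [Div L] and [extT L] gives the same condition on
    the refused actions. *)
Lemma snF_sanF L L1 : Div L `<=` Div L1 -> Div L1 `<=` extT L -> nF L1 = anF L ->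
  snF L1 = sanF L.
Proof.
move=> D1 D2 EF; apply/predeqP => -[sigma A]; rewrite /snF /sanF /= EF.
split=> -[H HA]; split=> // a Aa D; apply: (HA a Aa).
  by apply: D1; case: D.
by apply: extT_rcons (D2 _ D); case: H.
Qed.

Lemma eq_snF L L' : nF L = nF L' -> Div L = Div L' -> snF L = snF L'.
Proof. by move=> EF ED; rewrite /snF EF ED. Qed.

Lemma div_prefix_mkseq L (xi : nat -> Act) i j : i <= j -> Div L (mkseq xi i) ->
  div_prefix L (mkseq xi j).
Proof.
move=> le D; exists (mkseq xi i), (drop i (mkseq xi j)); split=> //.
have -> : mkseq xi i = take i (mkseq xi j) by rewrite /mkseq -map_take take_iota (minn_idPl le).
by rewrite cat_take_drop.
Qed.

Section Add_refusals.
Variables (L L1 : LTS Act).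
Hypothesis ED : Div L1 = Div L.
Hypothesis EF : forall sigma A, nF L1 (sigma, A) <-> nF L (sigma, A) \/
  [/\ A `<=` alph L, Tr L sigma, div_prefix L sigma & ~ Div L sigma].

Lemma filled_Tr : Tr L1 = Tr L.
Proof.
apply/predeqP => sigma; split=> [/TrE|T]; rewrite ?ED.
  by case=> [/Div_Tr|/EF[H|[]]] //; apply/TrE; right.
apply/TrE; rewrite ED; case/TrE: T; [by left|right].
by apply/EF; left.
Qed.

End Add_refusals.

(** At traces outside [Div] that extend a divergence trace, both sides have every refusal; elsewhere
    a failure in [snF] already belongs to [sanF]. *)
Lemma filled_snF L L1 M M1 : alph L = alph M -> Tr L = Tr M -> sanF L = sanF M -> Div L = Div M ->
  Div L1 = Div L -> Div M1 = Div M ->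
  (forall sigma A, nF L1 (sigma, A) <-> nF L (sigma, A) \/
    [/\ A `<=` alph L, Tr L sigma, div_prefix L sigma & ~ Div L sigma]) ->
  (forall sigma A, nF M1 (sigma, A) <-> nF M (sigma, A) \/
    [/\ A `<=` alph M, Tr M sigma, div_prefix M sigma & ~ Div M sigma]) ->
  snF L1 `<=` snF M1.
Proof.
move=> EA ET ES ED EL EM FL FM [sigma A] [H HA]; split; last by rewrite EM -ED -EL.
have HP tau : div_prefix L tau = div_prefix M tau by rewrite /div_prefix ED.
apply/FM; rewrite -EA -ET -HP -ED; case/FL: H => [[S nD]|]; last by right.
have [P|nP] := pselect (div_prefix L sigma).
  right; split=> //; first by case/SfP: S.
  by case/SfP: S => _ [s [R _ _]]; apply/TrP; exists s.
have : sanF L (sigma, A).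
  split; first by split=> // /extTP[].
  by move=> a Aa [D _]; apply: (HA a Aa); rewrite EL.
by rewrite ES => -[[SM _] _]; left; split=> //; rewrite -ED.
Qed.

Hypothesis CFFD_cong : forall L L' : LTS Act, CFFD_equiv L L' -> cong L L'.
Hypothesis V_cong_B : cong (ltsV Act) (ltsB Act).
Hypothesis sanFC : preserves cong (@sanF Act).
Hypothesis nanFC : ~ preserves cong (@anF Act).

Let alphC : preserves cong (@alph Act) := alph_preserved Act_infinite congC sanFC.

Lemma minD_preserved : preserves cong (@Div Act) -> preserves cong (@minD Act).
Proof. by move=> DivC M M' C; rewrite /minD (DivC _ _ C). Qed.

Let join L L' L1 L1' : cong L L1 -> cong L' L1' -> cong L1 L1' -> cong L L'.
Proof.
move=> C C' C1; apply: (congr_trans congC C); apply: (congr_trans congC C1).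
exact: (congr_sym congC).
Qed.

Let cong_snF := cong_snF Act_infinite congC CFFD_cong V_cong_B alphC.

Lemma cong_anI L L' : preserves cong (@minD Act) -> ~ preserves cong (@Tr Act) ->
  alph L = alph L' -> sanF L = sanF L' -> minD L = minD L' -> anI L = anI L' -> cong L L'.
Proof.
move=> minDC nTr EA ES EM EI.
have [L1 [C1 A1 D1 I1 F1]] :=
  add_traces Act_infinite congC CFFD_cong V_cong_B alphC L nTr.
have [L2 [C2 A2 D2 I2 F2]] :=
  add_traces Act_infinite congC CFFD_cong V_cong_B alphC L' nTr.
apply: join C1 C2 _; apply: cong_snF => //.
- by rewrite A1 A2.
- rewrite (@snF_sanF L) ?(@snF_sanF L') // ?D1 ?D2 // => sigma; exact: extT_Div.
- by rewrite D1 D2 /extT EA EM.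
- have EE : extI L = extI L' by rewrite /extI EA EM.
  have K M : Inf M `|` extI M = anI M `|` extI M.
    apply/predeqP => xi; split=> -[]; try by right.
      by move=> I; have [E|nE] := pselect (extI M xi); [right|left].
    by case; left.
  by rewrite I1 I2 !K EI EE.
Qed.

(** Here [I] is the set of infinite traces, [W] its preserved part and [Z] the words a context adds.
    As soon as [Z] covers what [W] omits, the extended set depends on [W] and [Z] alone. *)
Lemma Inf_split (I Z W : set (nat -> Act)) : W `<=` I -> I `<=` W `|` Z -> I `|` Z = W `|` Z.
Proof.
move=> WI IW; apply/predeqP => xi; split; first by case=> [/IW|]; [|right].
by case=> [/WI|]; [left|right].
Qed.

Lemma late_normal_forms L L' : preserves cong (@minD Act) -> ~ preserves cong (@Div Act) ->
  alph L = alph L' -> Tr L = Tr L' -> sanF L = sanF L' -> minD L = minD L' ->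
  exists L1 L2, [/\ cong L L1 /\ cong L' L2, alph L1 = alph L2 /\ snF L1 = snF L2,
    Div L1 = Tr L `&` extT L /\ Div L2 = Tr L `&` extT L, Inf L1 = Inf L & Inf L2 = Inf L'].
Proof.
move=> minDC nDiv EA ET ES EM.
have [L1 [C1 A1 D1 I1 F1]] :=
  add_Div Act_infinite congC CFFD_cong V_cong_B alphC L nDiv.
have [L2 [C2 A2 D2 I2 F2]] :=
  add_Div Act_infinite congC CFFD_cong V_cong_B alphC L' nDiv.
have EE : extT L = extT L' by rewrite /extT EA EM.
exists L1, L2; split=> //; split=> //; first by rewrite A1 A2.
  by rewrite (@snF_sanF L) ?(@snF_sanF L') // ?D1 ?D2 => sigma //;
    [move=> D; split; [exact: Div_Tr|exact: extT_Div]|case|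
     move=> D; split; [exact: Div_Tr|exact: extT_Div]|case].
by rewrite D2 -ET -EE.
Qed.

(** Divergences are added before infinite traces: only then are the prefixes of an infinite trace in
    [extI] eventually all divergence traces, so that [add_Inf_eventually] covers it. *)
Lemma cong_Tr_anI L L' : preserves cong (@minD Act) -> ~ preserves cong (@Div Act) ->
  ~ preserves cong (@Inf Act) -> alph L = alph L' -> Tr L = Tr L' -> sanF L = sanF L' ->
  minD L = minD L' -> anI L = anI L' -> cong L L'.
Proof.
move=> minDC nDiv nInf EA ET ES EM EI.
have [M [M' [[C C'] [EA' ES'] [D D'] I I']]] := late_normal_forms minDC nDiv EA ET ES EM.
have [M1 [C1 A1 D1 I1 F1]] :=
  add_Inf_eventually Act_infinite congC CFFD_cong V_cong_B alphC M nInf.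
have [M2 [C2 A2 D2 I2 F2]] :=
  add_Inf_eventually Act_infinite congC CFFD_cong V_cong_B alphC M' nInf.
apply: join C C' _; apply: join C1 C2 _; apply: cong_snF => //.
- by rewrite A1 A2.
- by rewrite (eq_snF F1 D1) (eq_snF F2 D2).
- by rewrite D1 D2 D D'.
rewrite I1 I2 D D' I I'.
have K N : Tr N = Tr L -> extT N = extT L -> Inf N `<=` anI N `|` [set xi |
    exists n, forall i, n <= i -> (Tr L `&` extT L) (mkseq xi i)].
  move=> <- <- xi Ix; have [[al [i [Di _]]]|nE] := pselect (extI N xi); last by left.
  right; exists i => j le; have T := Inf_Tr j Ix; split=> //; apply/extTP; split.
    exact: Tr_alph.
  exact: div_prefix_mkseq Di.
have EE : extT L' = extT L by rewrite /extT EA EM.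
have P (N : LTS Act) : anI N `<=` Inf N by move=> xi [].
rewrite (@Inf_split _ _ _ (P L) (K L erefl erefl)).
by rewrite (@Inf_split _ _ _ (P L') (K L' (esym ET) EE)) EI.
Qed.

Lemma cong_minD_Inf L L' : preserves cong (@minD Act) -> ~ preserves cong (@Div Act) ->
  alph L = alph L' -> Tr L = Tr L' -> sanF L = sanF L' ->
  minD L = minD L' -> Inf L = Inf L' -> cong L L'.
Proof.
move=> minDC nDiv EA ET ES EM EI.
have [M [M' [[C C'] [EA' ES'] [D D'] I I']]] := late_normal_forms minDC nDiv EA ET ES EM.
by apply: join C C' _; apply: cong_snF => //; rewrite ?D ?D' ?I ?I'.
Qed.

Section Preserves_Div.
Hypotheses (DivC : preserves cong (@Div Act)) (nsnFC : ~ preserves cong (@snF Act)).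

Lemma filled_normal_forms L L' : alph L = alph L' -> Tr L = Tr L' -> sanF L = sanF L' ->
  Div L = Div L' ->
  exists L1 L2, [/\ cong L L1 /\ cong L' L2, alph L1 = alph L2 /\ snF L1 = snF L2,
    Div L1 = Div L /\ Div L2 = Div L, Tr L1 = Tr L /\ Tr L2 = Tr L
    & Inf L1 = Inf L /\ Inf L2 = Inf L'].
Proof.
move=> EA ET ES ED.
have [L1 [C1 A1 D1 I1 F1]] :=
  add_refusals Act_infinite congC CFFD_cong V_cong_B alphC L DivC nsnFC.
have [L2 [C2 A2 D2 I2 F2]] :=
  add_refusals Act_infinite congC CFFD_cong V_cong_B alphC L' DivC nsnFC.
exists L1, L2; split=> //; split=> //; rewrite ?A1 ?A2 ?D2 ?ED //.
- apply/predeqP => x; split; first exact: (filled_snF EA ET ES ED D1 D2 F1 F2).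
  exact: (filled_snF (esym EA) (esym ET) (esym ES) (esym ED) D2 D1 F2 F1).
- exact: filled_Tr F1.
- by rewrite ET; exact: filled_Tr F2.
Qed.

Lemma cong_eanI L L' : ~ preserves cong (@aenI Act) ->
  alph L = alph L' -> Tr L = Tr L' -> sanF L = sanF L' -> Div L = Div L' ->
  eanI L = eanI L' -> cong L L'.
Proof.
move=> naenI EA ET ES ED EI.
have [M [M' [[C C'] [EA' ES'] [D D'] [T T'] [I I']]]] := filled_normal_forms EA ET ES ED.
have [M1 [C1 A1 D1 I1 F1]] :=
  add_Inf_often Act_infinite congC CFFD_cong V_cong_B alphC M DivC naenI.
have [M2 [C2 A2 D2 I2 F2]] :=
  add_Inf_often Act_infinite congC CFFD_cong V_cong_B alphC M' DivC naenI.
apply: join C C' _; apply: join C1 C2 _; apply: cong_snF => //; first exact: minD_preserved.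
- by rewrite A1 A2.
- by rewrite (eq_snF F1 D1) (eq_snF F2 D2).
- by rewrite D1 D2 D D'.
rewrite I1 I2 D D' T T' I I'.
(* An infinite trace outside [eanI] has infinitely many diverging prefixes, and all its prefixes are
   traces; it is among the words added. *)
have K N : Tr N = Tr L -> Div N = Div L -> Inf N `<=` eanI N `|` [set xi |
    (forall i, Tr L (mkseq xi i)) /\ forall m, exists i, m <= i /\ Div L (mkseq xi i)].
  move=> <- <- xi Ix; have [E|nE] := pselect (eanI N xi); first by left.
  right; split=> [i|m]; first exact: Inf_Tr.
  apply: contrapT => H; apply: nE; split=> //; exists m => i le Di.
  by apply: H; exists i.
have P (N : LTS Act) : eanI N `<=` Inf N by move=> xi [].
rewrite (@Inf_split _ _ _ (P L) (K L erefl erefl)).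
by rewrite (@Inf_split _ _ _ (P L') (K L' (esym ET) (esym ED))) EI.
Qed.

Lemma cong_aenI L L' : ~ preserves cong (@Inf Act) ->
  alph L = alph L' -> Tr L = Tr L' -> sanF L = sanF L' -> Div L = Div L' ->
  aenI L = aenI L' -> cong L L'.
Proof.
move=> nInf EA ET ES ED EI.
have [M [M' [[C C'] [EA' ES'] [D D'] [T T'] [I I']]]] := filled_normal_forms EA ET ES ED.
have [M1 [C1 A1 D1 I1 F1]] :=
  add_Inf_eventually Act_infinite congC CFFD_cong V_cong_B alphC M nInf.
have [M2 [C2 A2 D2 I2 F2]] :=
  add_Inf_eventually Act_infinite congC CFFD_cong V_cong_B alphC M' nInf.
apply: join C C' _; apply: join C1 C2 _; apply: cong_snF => //; first exact: minD_preserved.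
- by rewrite A1 A2.
- by rewrite (eq_snF F1 D1) (eq_snF F2 D2).
- by rewrite D1 D2 D D'.
rewrite I1 I2 D D' I I'.
(* An infinite trace outside [aenI] has only diverging prefixes from some point on, which is the
   kind of word that a lost [Inf] adds. *)
have K N : Div N = Div L -> Inf N `<=` aenI N `|` [set xi |
    exists n, forall i, n <= i -> Div L (mkseq xi i)].
  move=> <- xi Ix; have [E|nE] := pselect (aenI N xi); first by left.
  right; apply: contrapT => H; apply: nE; split=> // n.
  apply: contrapT => H2; apply: H; exists n => i le.
  by apply: contrapT => nD; apply: H2; exists i.
have P (N : LTS Act) : aenI N `<=` Inf N by move=> xi [].
rewrite (@Inf_split _ _ _ (P L) (K L erefl)).
by rewrite (@Inf_split _ _ _ (P L') (K L' (esym ED))) EI.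
Qed.

Lemma cong_Div_Inf L L' : alph L = alph L' -> Tr L = Tr L' -> sanF L = sanF L' ->
  Div L = Div L' -> Inf L = Inf L' -> cong L L'.
Proof.
move=> EA ET ES ED EI.
have [M [M' [[C C'] [EA' ES'] [D D'] [T T'] [I I']]]] := filled_normal_forms EA ET ES ED.
apply: join C C' _; apply: cong_snF => //; rewrite ?D ?D' ?I ?I' //.
exact: minD_preserved.
Qed.

End Preserves_Div.

End Final.

Theorem theorem7p7 (Act : Type) (Act_infinite : infinite_set [set: Act])
    (cong : LTS Act -> LTS Act -> Prop)
    (cong_congruence : congruence cong)
    (CFFD_cong : forall L L' : LTS Act, CFFD_equiv L L' -> cong L L')
    (V_cong_B : cong (ltsV Act) (ltsB Act)) :
  (* (1) *)
  (preserves cong (@sanF Act) -> preserves cong (@minD Act) ->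
   ~ preserves cong (@Tr Act) -> ~ preserves cong (@anF Act) ->
   forall L L' : LTS Act, cong L L' <->
     (alph L = alph L' /\ sanF L = sanF L' /\ minD L = minD L' /\
      anI L = anI L')) /\
  (* (2) *)
  (preserves cong (@Tr Act) -> preserves cong (@sanF Act) ->
   preserves cong (@minD Act) ->
   ~ preserves cong (@anF Act) -> ~ preserves cong (@Div Act) ->
   ~ preserves cong (@Inf Act) ->
   forall L L' : LTS Act, cong L L' <->
     (alph L = alph L' /\ Tr L = Tr L' /\ sanF L = sanF L' /\
      minD L = minD L' /\ anI L = anI L')) /\
  (* (3) *)
  (preserves cong (@sanF Act) -> preserves cong (@minD Act) ->
   preserves cong (@Inf Act) ->
   ~ preserves cong (@anF Act) -> ~ preserves cong (@Div Act) ->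
   forall L L' : LTS Act, cong L L' <->
     (alph L = alph L' /\ Tr L = Tr L' /\ sanF L = sanF L' /\
      minD L = minD L' /\ Inf L = Inf L')) /\
  (* (4) *)
  (preserves cong (@sanF Act) -> preserves cong (@Div Act) ->
   ~ preserves cong (@anF Act) -> ~ preserves cong (@snF Act) ->
   ~ preserves cong (@aenI Act) ->
   forall L L' : LTS Act, cong L L' <->
     (alph L = alph L' /\ Tr L = Tr L' /\ sanF L = sanF L' /\
      Div L = Div L' /\ eanI L = eanI L')) /\
  (* (5) *)
  (preserves cong (@sanF Act) -> preserves cong (@Div Act) ->
   preserves cong (@aenI Act) ->
   ~ preserves cong (@anF Act) -> ~ preserves cong (@snF Act) ->
   ~ preserves cong (@Inf Act) ->
   forall L L' : LTS Act, cong L L' <->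
     (alph L = alph L' /\ Tr L = Tr L' /\ sanF L = sanF L' /\
      Div L = Div L' /\ aenI L = aenI L')) /\
  (* (6) *)
  (preserves cong (@sanF Act) -> preserves cong (@Div Act) ->
   preserves cong (@Inf Act) ->
   ~ preserves cong (@anF Act) -> ~ preserves cong (@snF Act) ->
   forall L L' : LTS Act, cong L L' <->
     (alph L = alph L' /\ Tr L = Tr L' /\ sanF L = sanF L' /\
      Div L = Div L' /\ Inf L = Inf L')).
Proof.
split; [|split; [|split; [|split; [|split]]]].
- move=> sanFC minDC nTr nanF L L'.
  have alphC := alph_preserved Act_infinite cong_congruence sanFC.
  split=> [C|[EA [ES [EM EI]]]]; last exact: cong_anI.
  by rewrite (alphC _ _ C) (sanFC _ _ C) (minDC _ _ C)
    (anI_preserved Act_infinite cong_congruence alphC minDC C).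
- move=> TrC sanFC minDC nanF nDiv nInf L L'.
  have alphC := alph_preserved Act_infinite cong_congruence sanFC.
  split=> [C|[EA [ET [ES [EM EI]]]]]; last exact: cong_Tr_anI.
  by rewrite (alphC _ _ C) (TrC _ _ C) (sanFC _ _ C) (minDC _ _ C)
    (anI_preserved Act_infinite cong_congruence alphC minDC C).
- move=> sanFC minDC InfC nanF nDiv L L'.
  have alphC := alph_preserved Act_infinite cong_congruence sanFC.
  have TrC := Tr_preserved_of_Inf Act_infinite cong_congruence alphC InfC.
  split=> [C|[EA [ET [ES [EM EI]]]]]; last exact: cong_minD_Inf.
  by rewrite (alphC _ _ C) (TrC _ _ C) (sanFC _ _ C) (minDC _ _ C) (InfC _ _ C).
- move=> sanFC DivC nanF nsnF naenI L L'.
  have alphC := alph_preserved Act_infinite cong_congruence sanFC.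
  have TrC := Tr_preserved_of_Div Act_infinite cong_congruence alphC DivC.
  split=> [C|[EA [ET [ES [ED EI]]]]]; last exact: cong_eanI.
  by rewrite (alphC _ _ C) (TrC _ _ C) (sanFC _ _ C) (DivC _ _ C)
    (eanI_preserved Act_infinite cong_congruence alphC DivC C).
- move=> sanFC DivC aenIC nanF nsnF nInf L L'.
  have alphC := alph_preserved Act_infinite cong_congruence sanFC.
  have TrC := Tr_preserved_of_Div Act_infinite cong_congruence alphC DivC.
  split=> [C|[EA [ET [ES [ED EI]]]]]; last exact: cong_aenI.
  by rewrite (alphC _ _ C) (TrC _ _ C) (sanFC _ _ C) (DivC _ _ C) (aenIC _ _ C).
- move=> sanFC DivC InfC nanF nsnF L L'.
  have alphC := alph_preserved Act_infinite cong_congruence sanFC.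
  have TrC := Tr_preserved_of_Div Act_infinite cong_congruence alphC DivC.
  split=> [C|[EA [ET [ES [ED EI]]]]]; last exact: cong_Div_Inf.
  by rewrite (alphC _ _ C) (TrC _ _ C) (sanFC _ _ C) (DivC _ _ C) (InfC _ _ C).
Qed.
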